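(* Let $\mathcal{H}$ be a finite-dimensional Hilbert space, let $\mathcal{A}=(\mathcal{A}_n)_{n\ge1}$ be a sequence of sets $\mathcal{A}_n\subseteq\mathcal{D}(\mathcal{H}^{\otimes n})$, and let $\mathcal{B}_1\subseteq\mathcal{D}(\mathcal{H})$ be a non-empty, topologically closed set of states. Assume that every $\mathcal{A}_n$ is topologically closed and convex, and that $\mathcal{A}$ satisfies Axioms Q.I, Q.II, Q.III and Q.IV (see context). Then $$\mathrm{Stein}(\mathcal{A}\|\mathcal{B}_1^{\mathrm{iid}})=\operatorname{min^*}_{\mu\in\mathcal{P}(\mathcal{B}_1)}\ \lim_{n\to\infty}\frac1n\inf_{\rho_n\in\mathcal{A}_n}D\Big(\rho_n\,\Big\|\,\int_{\mathcal{B}_1}\mathrm{d}\mu(\sigma_1)\,\sigma_1^{\otimes n}\Big),$$ and $$\mathrm{Stein}(\mathcal{A}\|\mathcal{B}_1^{\mathrm{av}})=\mathrm{Stein}(\mathcal{A}\|\mathrm{co}(\mathcal{B}_1)^{\mathrm{av}})=\mathrm{Stein}(\mathcal{A}\|\mathrm{co}(\mathcal{B}_1)^{\mathrm{iid}})=\operatorname{min^*}_{\mu\in\mathcal{P}(\mathrm{co}(\mathcal{B}_1))}\ \lim_{n\to\infty}\frac1n\inf_{\rho_n\in\mathcal{A}_n}D\Big(\rho_n\,\Big\|\,\int_{\mathrm{co}(\mathcal{B}_1)}\mathrm{d}\mu(\sigma_1)\,\sigma_1^{\otimes n}\Big).$$ Here, in each formula, the set of measures $\mu$ for which the inner limit in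 $n$ exists is non-empty, and the minimum over that set exists.
   Context: $\mathcal{D}(\mathcal{K})$ denotes the set of density operators (positive semidefinite, trace one) on a finite-dimensional Hilbert space $\mathcal{K}$. For $X\le Y$ we mean $Y-X$ is positive semidefinite. For a set $\mathcal{F}_1\subseteq\mathcal{D}(\mathcal{H})$: $\mathcal{F}_1^{\otimes n,\mathrm{iid}}:=\{\rho^{\otimes n}:\rho\in\mathcal{F}_1\}$, $\mathcal{F}_1^{\mathrm{iid}}:=(\mathcal{F}_1^{\otimes n,\mathrm{iid}})_n$; $\mathcal{F}_1^{\otimes n,\mathrm{av}}:=\{\rho_1\otimes\cdots\otimes\rho_n:\rho_1,\dots,\rho_n\in\mathcal{F}_1\}$, $\mathcal{F}_1^{\mathrm{av}}:=(\mathcal{F}_1^{\otimes n,\mathrm{av}})_n$. $\mathrm{co}$ denotes convex hull. For sequences $\mathcal{A}=(\mathcal{A}_n)_n,\mathcal{B}=(\mathcal{B}_n)_n$ with $\mathcal{A}_n,\mathcal{B}_n\subseteq\mathcal{D}(\mathcal{H}^{\otimes n})$, define $\beta_\varepsilon(\mathcal{A}_n\|\mathcal{B}_n):=\inf\{\sup_{\sigma_n\in\mathcal{B}_n}\mathrm{Tr}[\sigma_nE_n]:0\le E_n\le\mathbb{1},\ \sup_{\rho_n\in\mathcal{A}_n}\mathrm{Tr}[\rho_n(\mathbb{1}-E_n)]\le\varepsilon\}$ and the Stein exponent $\mathrm{Stein}(\mathcal{A}\|\mathcal{B}):=\lim_{\varepsilon\to0^+}\liminf_{n\to\infty}-\frac1n\log\beta_\varepsilon(\mathcal{A}_n\|\mathcal{B}_n)$.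 $D(\rho\|\sigma)=\mathrm{Tr}[\rho(\log\rho-\log\sigma)]$ is the Umegaki relative entropy ($+\infty$ if $\mathrm{supp}\,\rho\not\subseteq\mathrm{supp}\,\sigma$). $\mathcal{P}(\mathcal{C})$ is the set of regular Borel probability measures on a compact set $\mathcal{C}$; $\operatorname{min^*}_\mu$ means the minimum restricted to those $\mu$ for which the inner limit in $n$ exists. Depolarising map: for a state $\tau$ and $\delta\in[0,1]$, $\Delta^\delta_\tau(X):=(1-\delta)X+\delta\,\tau\,\mathrm{Tr}X$ on Hermitian operators (on states, $(1-\delta)X+\delta\tau$). Axiom Q.I: there is $\tau\in\mathcal{F}_1$ such that for all $m,k\in\mathbb{N}^+$ and all $\rho_{mk}\in\mathcal{F}_{mk}$: (a) $\mathrm{supp}(\rho_{mk})\subseteq\mathrm{supp}(\tau)^{\otimes mk}$; (b) $(\Delta^\delta_{\tau^{\otimes k}})^{\otimes m}(\rho_{mk})\in\mathcal{F}_{mk}$ for all $\delta\in[0,1]$. Axiom Q.II: $\rho_k^{\otimes m}\in\mathcal{F}_{mk}$ for all $m,k\in\mathbb{N}^+$ and $\rho_k\in\mathcal{F}_k$. Axiom Q.III: each $\mathcal{F}_n$ is closed under permutations: $U_\pi\rho_nU_\pi^\dagger\in\mathcal{F}_n$ for all $\rho_n\in\mathcal{F}_n$ and $\pi\in S_n$, where $U_\pi$ permutes the tensor factors of $\mathcal{H}^{\otimes n}$. Axiom Q.IV: for all $k\in\mathbb{N}^+$ there is a neighbourhood $\mathcal{V}$ of $\mathbb{1}^{\otimes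 k}$ (identity on $\mathcal{H}^{\otimes k}$) such that for all $F_k\in\mathcal{V}$, all $n\in\mathbb{N}^+$ and all $\rho_{n+k}\in\mathcal{F}_{n+k}$: $\mathrm{Tr}_{n+1,\dots,n+k}[\rho_{n+k}(\mathbb{1}^{\otimes n}\otimes F_k)]\in\mathrm{cone}(\mathcal{F}_n):=\{\lambda\omega:\lambda\ge0,\omega\in\mathcal{F}_n\}$, where the partial trace is over the last $k$ subsystems. *)

(* Defs.v *)
From HB Require Import structures.
From mathcomp Require Import all_boot all_order all_algebra.
From mathcomp Require Import fingroup perm complex.
From mathcomp Require Import all_classical all_reals all_analysis.

Set Implicit Arguments.
Unset Strict Implicit.
Unset Printing Implicit Defensive.

Import Order.TTheory GRing.Theory Num.Theory Num.Def.
Local Open Scope classical_set_scope.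
Local Open Scope ring_scope.

(* Hilbert space H = C^d (C = R[i]);  H^{\otimes n} has orthonormal     *)
(* basis indexed by n-tuples of basis indices of H.                     *)

Definition Idx (d n : nat) := {ffun 'I_n -> 'I_d}.

Definition Op (R : realType) (d n : nat) := 'M[R[i]]_#|Idx d n|.

HB.instance Definition _ (R : realType) (d n : nat) := Choice.on (Op R d n).
HB.instance Definition _ (R : realType) (d n : nat) :=
  isPointed.Build (Op R d n) (0 : 'M[R[i]]_#|Idx d n|).

Definition ent (R : realType) d n (A : Op R d n) (x y : Idx d n) : R[i] :=
  A (enum_rank x) (enum_rank y).

Definition mkop (R : realType) d n (f : Idx d n -> Idx d n -> R[i]) : Op R d n :=
  \matrix_(i, j) f (enum_val i) (enum_val j).

Definition adj (R : realType) p q (A : 'M[R[i]]_(p, q)) : 'M[R[i]]_(q, p) :=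
  (map_mx conjC A)^T.

Definition psd (R : realType) d n (A : Op R d n) : Prop :=
  forall v : 'rV[R[i]]_#|Idx d n|, 0 <= (v *m A *m adj v) 0 0.

Definition hermitian (R : realType) d n (A : Op R d n) : Prop := adj A = A.

Definition dens (R : realType) d n : set (Op R d n) :=
  [set A | psd A /\ \tr A = 1].

Definition trR (R : realType) d n (X Y : Op R d n) : R := complex.Re (\tr (X *m Y)).

Definition tprod (R : realType) d n (s : 'I_n -> Op R d 1) : Op R d n :=
  mkop (fun x y => \prod_(i < n) ent (s i) [ffun _ => x i] [ffun _ => y i]).

Definition ipow (R : realType) d n (s : Op R d 1) : Op R d n := tprod (fun _ : 'I_n => s).

(* i-th block of length k of an index of H^{\otimes (m k)} = (H^{\otimes k})^{\otimes m} *)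
Definition blk d m k (i : 'I_m) (x : Idx d (m * k)) : Idx d k :=
  [ffun j => x (mxvec_index i j)].

Definition tpow (R : realType) d m k (A : Op R d k) : Op R d (m * k) :=
  mkop (fun x y => \prod_(i < m) ent A (blk i x) (blk i y)).

Definition ijoin d n k (x : Idx d n) (z : Idx d k) : Idx d (n + k) :=
  [ffun i => match fintype.split i with inl a => x a | inr b => z b end].
Definition ilft d n k (x : Idx d (n + k)) : Idx d n := [ffun a => x (lshift k a)].
Definition irgt d n k (x : Idx d (n + k)) : Idx d k := [ffun b => x (rshift n b)].

Definition tens (R : realType) d n k (A : Op R d n) (B : Op R d k) : Op R d (n + k) :=
  mkop (fun x y => ent A (ilft x) (ilft y) * ent B (irgt x) (irgt y)).

Definition ptr (R : realType) d n k (M : Op R d (n + k)) : Op R d n :=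
  mkop (fun x y => \sum_(z : Idx d k) ent M (ijoin x z) (ijoin y z)).

(* U_pi rho U_pi^dagger : permutation of the tensor factors *)
Definition permop (R : realType) d n (p : 'S_n) (A : Op R d n) : Op R d n :=
  mkop (fun x y => ent A [ffun i => x (p i)] [ffun i => y (p i)]).

(* (Delta^delta_{tau^{\otimes k}})^{\otimes m} applied to X on H^{\otimes (m k)}:
   the tensor power of the linear map Delta, Delta(Y) = (1-delta) Y + delta tau^{(x)k} Tr Y,
   written through its matrix kernel  Delta(Y)_{ab} = sum_{a'b'} K(a,b,a',b') Y_{a'b'}. *)
Definition depol_ker (R : realType) d k (tau : Op R d 1) (delta : R)
  (a b a' b' : Idx d k) : R[i] :=
  ((1 - delta)%:C)%C * ((a == a')%:R * (b == b')%:R)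
  + (delta%:C)%C * ent (ipow k tau) a b * (a' == b')%:R.

Definition depol_pow (R : realType) d m k (tau : Op R d 1) (delta : R)
  (X : Op R d (m * k)) : Op R d (m * k) :=
  mkop (fun x y => \sum_(x' : Idx d (m * k)) \sum_(y' : Idx d (m * k))
     (\prod_(i < m) depol_ker tau delta (blk i x) (blk i y) (blk i x') (blk i y'))
       * ent X x' y').

(* supp A ⊆ supp B  (ranges; stated via the row spaces of the adjoints) *)
Definition supp_le (R : realType) d n (A B : Op R d n) : bool :=
  (adj A <= adj B)%MS.

Definition cone (R : realType) d n (F : set (Op R d n)) : set (Op R d n) :=
  [set X | exists2 lam : R, 0 <= lam & exists2 w, F w & X = (lam%:C)%C *: w].

Definition co (R : realType) d n (S : set (Op R d n)) : set (Op R d n) :=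
  [set X | exists m (w : 'I_m -> R) (s : 'I_m -> Op R d n),
     [/\ forall j, 0 <= w j, \sum_j w j = 1, forall j, S (s j)
       & X = \sum_j ((w j)%:C)%C *: s j]].

Definition convexS (R : realType) d n (S : set (Op R d n)) : Prop :=
  forall X Y t, S X -> S Y -> 0 <= t <= 1 ->
    S (((t%:C)%C *: X) + (((1 - t)%:C)%C *: Y)).

Definition closedS (R : realType) d n (S : set (Op R d n)) : Prop :=
  forall X : Op R d n, (forall e : R, 0 < e ->
     exists2 Y, S Y & forall i j, `|X i j - Y i j| < (e%:C)%C) -> S X.

Definition openS (R : realType) d n : set (set (Op R d n)) :=
  [set U : set (Op R d n) | forall X : Op R d n, U X -> exists2 e : R, 0 < e &
     forall Y : Op R d n, (forall i j, `|X i j - Y i j| < (e%:C)%C) -> U Y].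

Definition axQI (R : realType) d (F : forall n, set (Op R d n)) : Prop :=
  exists2 tau, F 1%N tau &
    forall m k, (0 < m)%N -> (0 < k)%N -> forall rho, F (m * k)%N rho ->
      supp_le rho (@ipow R d (m * k) tau) /\
      (forall delta : R, 0 <= delta <= 1 -> F (m * k)%N (@depol_pow R d m k tau delta rho)).

Definition axQII (R : realType) d (F : forall n, set (Op R d n)) : Prop :=
  forall m k, (0 < m)%N -> (0 < k)%N -> forall rho, F k rho -> F (m * k)%N (@tpow R d m k rho).

Definition axQIII (R : realType) d (F : forall n, set (Op R d n)) : Prop :=
  forall n, (0 < n)%N -> forall rho, F n rho -> forall p : 'S_n, F n (permop p rho).

Definition axQIV (R : realType) d (F : forall n, set (Op R d n)) : Prop :=
  forall k, (0 < k)%N -> exists2 e : R, 0 < e &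
    forall Fk : Op R d k, hermitian Fk ->
      (forall i j, `|Fk i j - (1%:M : Op R d k) i j| < (e%:C)%C) ->
      forall n, (0 < n)%N -> forall rho, F (n + k)%N rho ->
        cone (F n) (@ptr R d n k (rho *m @tens R d n k (1%:M : Op R d n) Fk)).

Local Open Scope ereal_scope.

Definition beta (R : realType) d n (A B : set (Op R d n)) (eps : R) : \bar R :=
  ereal_inf [set ereal_sup [set (trR s E)%:E | s in B] | E in
    [set E : Op R d n | [/\ psd E, psd (1%:M - E)%R &
        ereal_sup [set (trR r (1%:M - E)%R)%:E | r in A] <= eps%:E]]].

Definition mlog (R : realType) (b : \bar R) : \bar R :=
  match b with
  | r%:E => if (r <= 0)%R then +oo else (- ln r)%:E
  | +oo => -oo
  | -oo => +oo
  end.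

Definition stein_seq (R : realType) d (A B : forall n, set (Op R d n)) (eps : R)
  (n : nat) : \bar R :=
  (n%:R^-1)%:E * mlog (beta (A n) (B n) eps).

Definition SteinIs (R : realType) d (A B : forall n, set (Op R d n)) (l : \bar R) : Prop :=
  (fun eps : R => limn_einf (stein_seq A B eps)) x @[x --> 0^'+] --> l.

Definition iid (R : realType) d (S : set (Op R d 1)) (n : nat) : set (Op R d n) :=
  [set ipow n s | s in S].

Definition av (R : realType) d (S : set (Op R d 1)) (n : nat) : set (Op R d n) :=
  [set tprod s | s in [set s : 'I_n -> Op R d 1 | forall j, S (s j)]].

Local Close Scope ereal_scope.

Definition flog (R : realType) (x : R) : R := if 0 < x then ln x else 0.

(* matrix logarithm on the support (log 0 := 0), via the spectral theorem *)
Definition logmx (R : realType) d n (A : Op R d n) : Op R d n :=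
  invmx (spectralmx A)
    *m diag_mx (\row_j ((flog (complex.Re (spectral_diag A 0 j)))%:C)%C)
    *m spectralmx A.

Definition relent (R : realType) d n (rho sigma : Op R d n) : \bar R :=
  if supp_le rho sigma then
    (complex.Re (\tr (rho *m (logmx rho - logmx sigma))))%:E
  else +oo%E.

Definition BorelOp (R : realType) d := g_sigma_algebraType (@openS R d 1).

Definition mixpow (R : realType) d (mu : probability (BorelOp R d) R)
  (S : set (Op R d 1)) (n : nat) : Op R d n :=
  mkop (fun x y =>
    (Rintegral mu S (fun s : BorelOp R d => complex.Re (ent (ipow n s) x y)) +i*
     Rintegral mu S (fun s : BorelOp R d => complex.Im (ent (ipow n s) x y)))%C).

Local Open Scope ereal_scope.

Definition rate (R : realType) d (A : forall n, set (Op R d n))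
  (mu : probability (BorelOp R d) R) (S : set (Op R d 1)) (n : nat) : \bar R :=
  (n%:R^-1)%:E * ereal_inf [set relent r (mixpow mu S n) | r in A n].

Definition MinStarIs (R : realType) d (A : forall n, set (Op R d n))
  (S : set (Op R d 1)) (l : \bar R) : Prop :=
  (exists mu : probability (BorelOp R d) R,
      mu S = 1 /\ rate A mu S n @[n --> \oo] --> l) /\
  (forall (mu : probability (BorelOp R d) R) (l' : \bar R),
      mu S = 1 -> rate A mu S n @[n --> \oo] --> l' -> l <= l').

(* Main.v *)
Require Import Defs.
From HB Require Import structures.
From mathcomp Require Import all_boot all_order all_algebra.
From mathcomp Require Import fingroup perm complex.
From mathcomp Require Import all_classical all_reals all_analysis.
From mathcomp Require finmap.
From mathcomp Require Import measurable_realfun.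
From mathcomp Require Import ring lra zify.
Set Implicit Arguments.
Unset Strict Implicit.
Unset Printing Implicit Defensive.
Import Order.TTheory GRing.Theory Num.Theory Num.Def.
Import numFieldNormedType.Exports.
Local Open Scope classical_set_scope.
Local Open Scope ring_scope.

(** The score inequality is the variational form of the measured relative entropy: for outcome laws
    p and q, the supremum over f of sum f p - sum e^f q + 1 is D(p||q). For fixed scores it is
    affine in the pair of states, and the pairs (sum f M, sum e^f M) form a convex set; this is what
    makes duality available. The obstacle is that Axiom Q.IV only admits effects close to the
    identity, so a block cannot be filtered by an outcome of M itself. The filtered blocks therefore
    undergo an almost trivial measurement with effects (1 + eta G)/2 and (1 - eta G)/2 and scores
    1/eta and -1/eta, which is unbiased for G = sum f M. Its scores are large but bounded
    independently of n, so a fixed number J of such blocks suffices and does not affect the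
    exponent. States in A_n may correlate the blocks arbitrarily. Permutation symmetry only makes
    all pair correlations equal, but second moments are enough: the type I error merely has to fall
    below a fixed epsilon. All losses on the other side (the weights in mu, the number of
    eigenvalues, additive constants) are logarithmic in k before division by k. *)

(* Write S for B_1 or co(B_1). That no test beats the rate of a mixture follows from a weak converse
   in the style of Nussbaum and Szkola, applied to the mixture as alternative. Conversely fix k. By
   minimax duality either some measurement M on k systems with scores f satisfies
   Tr rho (sum f M) - Tr sigma^k (sum e^f M) + 1 >= c for all rho in A_k and sigma in S, or some pair
   rho_k in A_k and omega_k in the closed hull of the states sigma^k defeats all measurements at
   level c. In the first case one measures many blocks of size k: permutation symmetry and Axiom Q.IV
   let a few of the blocks be filtered away, which forces the empirical mean of f to concentrate
   above c, whereas Markov's inequality bounds the same event under sigma^n; so the Stein exponent is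
   at least c/k. Hence for c slightly above k times the exponent the second case occurs for every k.
   Finitely supported measures approximate the omega_k, and a weighted sum over k of these measures
   is a measure mu whose n-th mixture dominates omega_n up to a polynomial factor. Pinching with
   respect to this mixture, which has polynomially many eigenvalues, turns the measured bound into a
   bound on the relative entropy, so that the rate of mu is the exponent.

   For products of different states, multilinearity replaces B_1 by its hull C. Up to a factor
   (1 + eta)^n every product is dominated by one with factors in a finite subset of C, and for a
   permutation-invariant test the latter occurs with polynomial weight in the i.i.d. power of the
   average of its factors. *)

(** * Complex matrices and positive operators *)

Section Complex.
Variable R : realType.
Local Notation C := (R[i]).
Implicit Types z w : C.

Lemma ReD z w : complex.Re (z + w) = complex.Re z + complex.Re w.
Proof. by case: z; case: w. Qed.
Lemma ImD z w : complex.Im (z + w) = complex.Im z + complex.Im w.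
Proof. by case: z; case: w. Qed.
Lemma ReN z : complex.Re (- z) = - complex.Re z.
Proof. by case: z. Qed.
Lemma ImN z : complex.Im (- z) = - complex.Im z.
Proof. by case: z. Qed.
Lemma ReM z w : complex.Re (z * w) =
  complex.Re z * complex.Re w - complex.Im z * complex.Im w.
Proof. by case: z; case: w. Qed.
Lemma ImM z w : complex.Im (z * w) =
  complex.Re z * complex.Im w + complex.Im z * complex.Re w.
Proof. by case: z => a b; case: w => c e. Qed.
Lemma ReZ (a : R) z : complex.Re (a%:C%C * z) = a * complex.Re z.
Proof. by rewrite ReM /= mul0r subr0. Qed.
Lemma ImZ (a : R) z : complex.Im (a%:C%C * z) = a * complex.Im z.
Proof. by rewrite ImM /= mul0r addr0. Qed.
Lemma Re_conj z : complex.Re (conjC z) = complex.Re z.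
Proof. by case: z. Qed.
Lemma Im_conj z : complex.Im (conjC z) = - complex.Im z.
Proof. by case: z. Qed.

Lemma Re_sum I (r : seq I) (P : pred I) (F : I -> C) :
  complex.Re (\sum_(i <- r | P i) F i) = \sum_(i <- r | P i) complex.Re (F i).
Proof. exact: (big_morph (@complex.Re R) ReD). Qed.
Lemma Im_sum I (r : seq I) (P : pred I) (F : I -> C) :
  complex.Im (\sum_(i <- r | P i) F i) = \sum_(i <- r | P i) complex.Im (F i).
Proof. exact: (big_morph (@complex.Im R) ImD). Qed.

Lemma eqc z w : complex.Re z = complex.Re w -> complex.Im z = complex.Im w -> z = w.
Proof. by case: z => a b; case: w => c e /= -> ->. Qed.

Lemma ge0c z : (0 <= z) = (complex.Im z == 0) && (0 <= complex.Re z).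
Proof. by rewrite lecE. Qed.

Lemma ge0cP z : complex.Im z = 0 -> 0 <= complex.Re z -> 0 <= z.
Proof. by rewrite ge0c => -> ->; rewrite eqxx. Qed.

Definition nsq z : R := complex.Re z ^+ 2 + complex.Im z ^+ 2.

Lemma nsq_ge0 z : 0 <= nsq z. Proof. by rewrite addr_ge0 ?sqr_ge0. Qed.

Lemma mul_conj z : z * conjC z = (nsq z)%:C%C.
Proof. by apply: eqc; rewrite ?ReM ?ImM Re_conj Im_conj /nsq /=; ring. Qed.

Lemma nsq_eq0 z : nsq z = 0 -> z = 0.
Proof.
move=> h; have := nsq_ge0 z; rewrite /nsq in h.
have h1 := sqr_ge0 (complex.Re z); have h2 := sqr_ge0 (complex.Im z).
have /eqP : complex.Re z ^+ 2 = 0 by lra.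
have /eqP : complex.Im z ^+ 2 = 0 by lra.
by rewrite !sqrf_eq0 => /eqP h3 /eqP h4 _; apply: eqc.
Qed.

Lemma nsqD_le z w : nsq (z + w) <= 2 * (nsq z + nsq w).
Proof.
rewrite /nsq ReD ImD.
have := sqr_ge0 (complex.Re z - complex.Re w).
have := sqr_ge0 (complex.Im z - complex.Im w).
by rewrite !sqrrB !sqrrD; lra.
Qed.
Lemma nsq_real (a : R) : nsq a%:C%C = a ^+ 2.
Proof. by rewrite /nsq /= expr0n addr0. Qed.
Lemma nsqM z w : nsq (z * w) = nsq z * nsq w.
Proof. by rewrite /nsq ReM ImM; ring. Qed.
Lemma nsq_conj z : nsq (conjC z) = nsq z.
Proof. by rewrite /nsq Re_conj Im_conj sqrrN. Qed.

Lemma lt_norm_Re z (e : R) : `|z| < e%:C%C -> `|complex.Re z| < e.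
Proof. by move=> h; rewrite -ltcR; apply: le_lt_trans h; exact: normc_ge_Re. Qed.

Lemma lt_norm_Im z (e : R) : `|z| < e%:C%C -> `|complex.Im z| < e.
Proof.
move=> h; rewrite -ltcR; apply: le_lt_trans h.
have -> : complex.Im z = complex.Re (- 'i%C * z) by rewrite ReM /=; ring.
apply: le_trans (normc_ge_Re _) _.
by rewrite normrM normrN [`|_%C|]normc_def /= expr0n /= add0r expr1n sqrtr1 mul1r.
Qed.

Lemma norm_lt_ReIm z (e : R) : `|complex.Re z| + `|complex.Im z| < e -> `|z| < e%:C%C.
Proof.
move=> h; rewrite [z in `|z|]complexE; apply: le_lt_trans (ler_normD _ _) _.
rewrite normrM !normc_def /= !expr0n /= !addr0 add0r expr1n sqrtr1 mul1r !sqrtr_sqr.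
by rewrite -rmorphD /= ltcR.
Qed.
End Complex.

Section Adj.
Variable R : realType.
Local Notation C := (R[i]).

Lemma adjE m n (A : 'M[C]_(m, n)) i j : adj A i j = conjC (A j i).
Proof. by rewrite !mxE. Qed.

Lemma adjt m n (A : 'M[C]_(m, n)) : adj A = map_mx conjC (trmx A).
Proof. by apply/matrixP => i j; rewrite !mxE. Qed.

Lemma adjK m n (A : 'M[C]_(m, n)) : adj (adj A) = A.
Proof. by apply/matrixP => i j; rewrite !adjE conjCK. Qed.

Lemma adjM m n p (A : 'M[C]_(m, n)) (B : 'M[C]_(n, p)) : adj (A *m B) = adj B *m adj A.
Proof. by rewrite !adjt trmx_mul map_mxM. Qed.

Lemma adjD m n (A B : 'M[C]_(m, n)) : adj (A + B) = adj A + adj B.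
Proof. by apply/matrixP => i j; rewrite !mxE rmorphD. Qed.
Lemma adjN m n (A : 'M[C]_(m, n)) : adj (- A) = - adj A.
Proof. by apply/matrixP => i j; rewrite !mxE rmorphN. Qed.
Lemma adjZ m n (a : C) (A : 'M[C]_(m, n)) : adj (a *: A) = conjC a *: adj A.
Proof. by apply/matrixP => i j; rewrite !mxE rmorphM. Qed.
Lemma adj0 m n : adj (0 : 'M[C]_(m, n)) = 0.
Proof. by apply/matrixP => i j; rewrite !mxE rmorph0. Qed.
Lemma adj_sum m n I (r : seq I) (P : pred I) (F : I -> 'M[C]_(m, n)) :
  adj (\sum_(i <- r | P i) F i) = \sum_(i <- r | P i) adj (F i).
Proof. by apply: big_morph; [exact: adjD|exact: adj0]. Qed.
Lemma adj_1 n : adj (1%:M : 'M[C]_n) = 1%:M.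
Proof. by rewrite adjt trmx1 map_mx1. Qed.
Lemma conjC_real (a : R) : conjC (a%:C)%C = (a%:C)%C.
Proof. by apply: eqc; rewrite ?Re_conj ?Im_conj //= oppr0. Qed.
Lemma adjZr m n (a : R) (A : 'M[C]_(m, n)) : adj (a%:C%C *: A) = a%:C%C *: adj A.
Proof. by rewrite adjZ conjC_real. Qed.
Lemma adj_delta m n i j : adj (delta_mx i j : 'M[C]_(m, n)) = delta_mx j i.
Proof. by apply/matrixP => a b; rewrite !mxE rmorph_nat andbC. Qed.

Lemma tr_adj n (A : 'M[C]_n) : \tr (adj A) = conjC (\tr A).
Proof. by rewrite /mxtrace rmorph_sum; apply: eq_bigr => i _; rewrite adjE. Qed.
End Adj.

(** * Positive semidefinite matrices and the real trace pairing *)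

Section Psd.
Variable R : realType.
Local Notation C := (R[i]).

Definition psdm n (A : 'M[C]_n) : Prop := forall v : 'rV[C]_n, 0 <= (v *m A *m adj v) 0 0.

Lemma psd0 n : psdm (0 : 'M[C]_n).
Proof. by move=> v; rewrite mulmx0 mul0mx mxE. Qed.

Lemma psdD n (A B : 'M[C]_n) : psdm A -> psdm B -> psdm (A + B).
Proof. by move=> hA hB v; rewrite mulmxDr mulmxDl mxE addr_ge0. Qed.

Lemma psdZ n (a : R) (A : 'M[C]_n) : 0 <= a -> psdm A -> psdm (a%:C%C *: A).
Proof.
by move=> a0 hA v; rewrite -scalemxAr -scalemxAl mxE mulr_ge0 // ?ler0c.
Qed.

Lemma psd_sum n I (r : seq I) (P : pred I) (F : I -> 'M[C]_n) :
  (forall i, P i -> psdm (F i)) -> psdm (\sum_(i <- r | P i) F i).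
Proof. by move=> h; apply: big_ind => //; [exact: psd0|exact: psdD]. Qed.

Lemma psd_conj m n (A : 'M[C]_n) (B : 'M[C]_(m, n)) : psdm A -> psdm (B *m A *m adj B).
Proof. by move=> hA v; have := hA (v *m B); rewrite adjM !mulmxA. Qed.

Lemma row_adj_ge0 n (v : 'rV[C]_n) : (v *m adj v) 0 0 = (\sum_j nsq (v 0 j))%:C%C.
Proof.
rewrite mxE rmorph_sum /=; apply: eq_bigr => j _.
by rewrite adjE mul_conj.
Qed.

Lemma psd1 n : psdm (1%:M : 'M[C]_n).
Proof.
by move=> v; rewrite mulmx1 row_adj_ge0 ler0c sumr_ge0 // => j _; exact: nsq_ge0.
Qed.

Lemma psd_gram m n (B : 'M[C]_(m, n)) : psdm (B *m adj B).
Proof. by have := psd_conj B (@psd1 n); rewrite mulmx1. Qed.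

Lemma psd_gram' m n (B : 'M[C]_(m, n)) : psdm (adj B *m B).
Proof. by have := psd_gram (adj B); rewrite adjK. Qed.

Definition dg n (a : 'I_n -> R) : 'M[C]_n := diag_mx (\row_j (a j)%:C%C).

Lemma dgE n (a : 'I_n -> R) i j : dg a i j = (a i)%:C%C *+ (i == j).
Proof. by rewrite !mxE; case: eqP => [->|]. Qed.

Lemma adj_dg n (a : 'I_n -> R) : adj (dg a) = dg a.
Proof.
apply/matrixP => i j; rewrite adjE !dgE eq_sym.
by case: eqP => [->|]; rewrite /= ?mulr1n ?mulr0n ?conjC_real ?rmorph0.
Qed.

Lemma dgM n (a b : 'I_n -> R) : dg a *m dg b = dg (fun i => a i * b i).
Proof.
rewrite mulmx_diag; congr diag_mx; apply/rowP => j; by rewrite !mxE rmorphM.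
Qed.

Lemma dg1 n : dg (fun _ : 'I_n => 1) = 1%:M.
Proof. by apply/matrixP => i j; rewrite dgE mxE. Qed.

Lemma dgMl n m (a : 'I_n -> R) (A : 'M[C]_(n, m)) i j : (dg a *m A) i j = (a i)%:C%C * A i j.
Proof. by rewrite mul_diag_mx !mxE. Qed.
Lemma dgMr n m (a : 'I_n -> R) (A : 'M[C]_(m, n)) i j : (A *m dg a) i j = A i j * (a j)%:C%C.
Proof. by rewrite mul_mx_diag !mxE. Qed.

Definition unit2 n (U : 'M[C]_n) := U *m adj U = 1%:M /\ adj U *m U = 1%:M.

Lemma unit2_spectral n (A : 'M[C]_n) : unit2 (spectralmx A).
Proof.
have /unitarymxP h := spectral_unitarymx A.
rewrite -adjt in h; split => //.
exact: mulmx1C.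
Qed.

Lemma invmx_unit2 n (U : 'M[C]_n) : unit2 U -> invmx U = adj U.
Proof.
move=> [h1 h2]; have [uU _] := mulmx1_unit h1.
by rewrite -[RHS]mulmx1 -(mulmxV uU) mulmxA h2 mul1mx.
Qed.

Lemma spectral_normal n (A : 'M[C]_n) : A *m adj A = adj A *m A ->
  A = adj (spectralmx A) *m diag_mx (spectral_diag A) *m spectralmx A.
Proof.
move=> h; have /orthomx_spectralP : A \is normalmx.
  by apply/normalmxP; rewrite -adjt.
by rewrite invmx_unit2 //; exact: unit2_spectral.
Qed.

Lemma qf_row m n (U : 'M[C]_(m, n)) (B : 'M[C]_n) i :
  (row i U *m B *m adj (row i U)) 0 0 = (U *m B *m adj U) i i.
Proof.
rewrite -row_mul [LHS]mxE [RHS]mxE; apply: eq_bigr => k _.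
by rewrite !adjE; congr (_ * conjC _); rewrite [LHS]mxE.
Qed.

(* The skew-hermitian part A - adj A is normal and has vanishing quadratic form. *)
Lemma psd_herm n (A : 'M[C]_n) : psdm A -> adj A = A.
Proof.
move=> hA; set B := A - adj A.
have aB : adj B = - B by rewrite /B adjD adjN adjK opprB addrC.
have hB (v : 'rV[C]_n) : (v *m B *m adj v) 0 0 = 0.
  have -> : (v *m B *m adj v) 0 0 = (v *m A *m adj v) 0 0 - (v *m adj A *m adj v) 0 0.
    by rewrite /B mulmxBr mulmxBl [LHS]mxE [X in _ + X]mxE.
  have -> : (v *m adj A *m adj v) 0 0 = conjC ((v *m A *m adj v) 0 0).
    by rewrite -adjE !adjM adjK mulmxA.
  have := hA v; rewrite ge0c => /andP[/eqP h1 _].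
  by apply: eqc; rewrite !(ReD, ImD, ReN, ImN, Re_conj, Im_conj) /= ?h1; ring.
have := @spectral_normal n B; rewrite aB mulmxN mulNmx => /(_ erefl) eB.
have [u1 u2] := unit2_spectral B.
have d0 : diag_mx (spectral_diag B) = 0.
  have -> : diag_mx (spectral_diag B) = spectralmx B *m B *m adj (spectralmx B).
    by rewrite [B in X in _ = _ *m X *m _]eB !mulmxA u1 mul1mx -!mulmxA u1 mulmx1.
  apply/matrixP => i j; have [<-|ne] := eqVneq i j.
    by rewrite -qf_row hB [RHS]mxE.
  have -> : spectralmx B *m B *m adj (spectralmx B) = diag_mx (spectral_diag B).
    by rewrite [B in X in _ *m X *m _ = _]eB !mulmxA u1 mul1mx -!mulmxA u1 mulmx1.
  by rewrite !mxE (negbTE ne).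
apply/eqP; rewrite eq_sym -subr_eq0 -/B eB d0 mulmx0 mul0mx //.
Qed.

Definition evals n (A : 'M[C]_n) : 'I_n -> R := fun j => complex.Re (spectral_diag A 0 j).

Lemma psd_spec n (A : 'M[C]_n) : psdm A ->
  A = adj (spectralmx A) *m dg (evals A) *m spectralmx A /\ forall j, 0 <= evals A j.
Proof.
move=> hA; have aA := psd_herm hA.
have eA := @spectral_normal n A; rewrite aA in eA; have {}eA := eA erefl.
have [u1 u2] := unit2_spectral A.
have hj j : 0 <= spectral_diag A 0 j.
  have := hA (row j (spectralmx A)); rewrite qf_row.
  rewrite [A in X in _ *m X *m _]eA !mulmxA u1 mul1mx -!mulmxA u1 mulmx1.
  by rewrite mxE eqxx mulr1n.
split; last by move=> j; have := hj j; rewrite ge0c => /andP[_].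
rewrite {1}eA; congr (_ *m diag_mx _ *m _); apply/rowP => j; rewrite !mxE.
have := hj j; rewrite ge0c => /andP[/eqP h _].
by apply: eqc; rewrite //= h.
Qed.

Lemma psd_root n (A : 'M[C]_n) : psdm A -> exists B : 'M[C]_n, A = adj B *m B.
Proof.
move=> /psd_spec[eA h]; exists (dg (fun j => Num.sqrt (evals A j)) *m spectralmx A).
rewrite adjM adj_dg mulmxA -[X in _ = X *m _]mulmxA dgM {1}eA; congr (_ *m dg _ *m _).
by apply/funext => j; rewrite -expr2 sqr_sqrtr.
Qed.

Lemma Re_tr_adjdg n (U V : 'M[C]_n) (a b : 'I_n -> R) :
  complex.Re (\tr (adj U *m dg a *m U *m (adj V *m dg b *m V))) =
  \sum_i \sum_j a i * b j * nsq ((U *m adj V) i j).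
Proof.
have -> : adj U *m dg a *m U *m (adj V *m dg b *m V) =
  adj U *m (dg a *m (U *m adj V) *m dg b *m V) by rewrite !mulmxA.
rewrite mxtrace_mulC -[_ *m V *m adj U]mulmxA.
have -> : V *m adj U = adj (U *m adj V) by rewrite adjM adjK.
rewrite /mxtrace Re_sum; apply: eq_bigr => i _.
rewrite mxE Re_sum; apply: eq_bigr => j _.
rewrite dgMr dgMl adjE.
set z := (U *m adj V) i j.
have -> : (a i)%:C%C * z * (b j)%:C%C * conjC z = (a i * b j)%:C%C * (z * conjC z).
  rewrite rmorphM /=; ring.
by rewrite mul_conj ReZ.
Qed.

Definition trr n (X Y : 'M[C]_n) : R := complex.Re (\tr (X *m Y)).

Lemma trrC n (X Y : 'M[C]_n) : trr X Y = trr Y X.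
Proof. by rewrite /trr mxtrace_mulC. Qed.
Lemma trrDl n (X Y Z : 'M[C]_n) : trr (X + Y) Z = trr X Z + trr Y Z.
Proof. by rewrite /trr mulmxDl mxtraceD ReD. Qed.
Lemma trrDr n (X Y Z : 'M[C]_n) : trr Z (X + Y) = trr Z X + trr Z Y.
Proof. by rewrite !(trrC Z) trrDl. Qed.
Lemma trrNl n (X Z : 'M[C]_n) : trr (- X) Z = - trr X Z.
Proof. by rewrite /trr mulNmx raddfN ReN. Qed.
Lemma trrNr n (X Z : 'M[C]_n) : trr Z (- X) = - trr Z X.
Proof. by rewrite !(trrC Z) trrNl. Qed.
Lemma trrBl n (X Y Z : 'M[C]_n) : trr (X - Y) Z = trr X Z - trr Y Z.
Proof. by rewrite trrDl trrNl. Qed.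
Lemma trrBr n (X Y Z : 'M[C]_n) : trr Z (X - Y) = trr Z X - trr Z Y.
Proof. by rewrite trrDr trrNr. Qed.
Lemma trrZl n a (X Z : 'M[C]_n) : trr (a%:C%C *: X) Z = a * trr X Z.
Proof. by rewrite /trr -scalemxAl mxtraceZ ReZ. Qed.
Lemma trrZr n a (X Z : 'M[C]_n) : trr Z (a%:C%C *: X) = a * trr Z X.
Proof. by rewrite !(trrC Z) trrZl. Qed.
Lemma trr0l n (Z : 'M[C]_n) : trr 0 Z = 0.
Proof. by rewrite /trr mul0mx mxtrace0. Qed.
Lemma trr0r n (Z : 'M[C]_n) : trr Z 0 = 0.
Proof. by rewrite trrC trr0l. Qed.
Lemma trr_suml n I (r : seq I) (P : pred I) (F : I -> 'M[C]_n) (Z : 'M[C]_n) :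
  trr (\sum_(i <- r | P i) F i) Z = \sum_(i <- r | P i) trr (F i) Z.
Proof. by apply: (big_morph (fun X => trr X Z)) => [X Y|]; [exact: trrDl|exact: trr0l]. Qed.
Lemma trr_sumr n I (r : seq I) (P : pred I) (F : I -> 'M[C]_n) (Z : 'M[C]_n) :
  trr Z (\sum_(i <- r | P i) F i) = \sum_(i <- r | P i) trr Z (F i).
Proof. by rewrite trrC trr_suml; apply: eq_bigr => i _; rewrite trrC. Qed.
Lemma trr1 n (X : 'M[C]_n) : trr X 1%:M = complex.Re (\tr X).
Proof. by rewrite /trr mulmx1. Qed.

Lemma trr_ge0 n (X Y : 'M[C]_n) : psdm X -> psdm Y -> 0 <= trr X Y.
Proof.
move=> /psd_spec[eX hx] /psd_spec[eY hy]; rewrite /trr {1}eX {1}eY Re_tr_adjdg.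
apply: sumr_ge0 => i _; apply: sumr_ge0 => j _.
by rewrite !mulr_ge0 ?nsq_ge0.
Qed.

Lemma trr_le n (X Y Z : 'M[C]_n) : psdm X -> psdm (Z - Y) -> trr X Y <= trr X Z.
Proof. by move=> hX hY; have := trr_ge0 hX hY; rewrite trrBr subr_ge0. Qed.

Definition dens' n (X : 'M[C]_n) := psdm X /\ complex.Re (\tr X) = 1.
End Psd.

(** * Relative entropy and the weak converse *)

Section RelEnt.
Variable R : realType.
Local Notation C := (R[i]).

Lemma unit2M n (U V : 'M[C]_n) : unit2 U -> unit2 V -> unit2 (U *m adj V).
Proof.
move=> [u1 u2] [v1 v2]; split; rewrite adjM adjK mulmxA.
  by rewrite -[U *m adj V *m V]mulmxA v2 mulmx1.
by rewrite -[V *m adj U *m U]mulmxA u2 mulmx1.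
Qed.

Lemma unit2_rowsum n (U : 'M[C]_n) i : unit2 U -> \sum_j nsq (U i j) = 1.
Proof.
move=> [/matrixP/(_ i i) h _]; move: h; rewrite !mxE eqxx mulr1n => /(congr1 (@complex.Re R)).
rewrite Re_sum /= => <-; apply: eq_bigr => j _.
by rewrite adjE mul_conj.
Qed.

Lemma unit2_colsum n (U : 'M[C]_n) j : unit2 U -> \sum_i nsq (U i j) = 1.
Proof.
move=> [_ /matrixP/(_ j j) h]; move: h; rewrite !mxE eqxx mulr1n => /(congr1 (@complex.Re R)).
rewrite Re_sum /= => <-; apply: eq_bigr => i _.
by rewrite adjE mulrC mul_conj.
Qed.

Lemma tr_adjdg n (U : 'M[C]_n) (a : 'I_n -> R) : unit2 U ->
  complex.Re (\tr (adj U *m dg a *m U)) = \sum_i a i.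
Proof.
move=> [u1 u2]; rewrite mxtrace_mulC mulmxA u1 mul1mx /mxtrace Re_sum.
by apply: eq_bigr => i _; rewrite dgE eqxx mulr1n.
Qed.

(** Squared overlaps of the two eigenbases. For states, [evals A i * ovl A B i j] and
    [evals B j * ovl A B i j] are the Nussbaum-Szkola pair: two classical distributions on index
    pairs whose relative entropy is the quantum one. *)
Definition ovl n (A B : 'M[C]_n) i j : R := nsq ((spectralmx A *m adj (spectralmx B)) i j).

Lemma ovl_ge0 n (A B : 'M[C]_n) i j : 0 <= ovl A B i j.
Proof. exact: nsq_ge0. Qed.

Lemma ovl_row n (A B : 'M[C]_n) i : \sum_j ovl A B i j = 1.
Proof. by apply: unit2_rowsum; apply: unit2M; exact: unit2_spectral. Qed.
Lemma ovl_col n (A B : 'M[C]_n) j : \sum_i ovl A B i j = 1.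
Proof.
by apply: (@unit2_colsum _ (spectralmx A *m adj (spectralmx B))); apply: unit2M; exact: unit2_spectral.
Qed.

Lemma evals_sum n (A : 'M[C]_n) : psdm A -> \sum_i evals A i = complex.Re (\tr A).
Proof.
move=> /psd_spec[eA _]; rewrite [in RHS]eA tr_adjdg //; exact: unit2_spectral.
Qed.

Lemma logmxE d n (A : Op R d n) :
  logmx A = adj (spectralmx A) *m dg (fun j => flog (evals A j)) *m spectralmx A.
Proof. by rewrite /logmx invmx_unit2 //; exact: unit2_spectral. Qed.

Lemma ovl_id n (A : 'M[C]_n) i j : ovl A A i j = (i == j)%:R.
Proof.
rewrite /ovl; have [-> _] := unit2_spectral A.
by rewrite mxE; case: eqP => _; rewrite /= ?mulr1n ?mulr0n /nsq /=; ring.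
Qed.

Lemma relent_val d n (A B : Op R d n) : psd A -> psd B ->
  complex.Re (\tr (A *m (logmx A - logmx B))) =
  \sum_i \sum_j evals A i * ovl A B i j * (flog (evals A i) - flog (evals B j)).
Proof.
move=> /psd_spec[eA hA] /psd_spec[eB hB].
rewrite mulmxBr raddfB ReD ReN !logmxE {1 5}eA !Re_tr_adjdg.
rewrite -sumrB; apply: eq_bigr => i _.
rewrite (bigD1 i) //= big1 ?addr0; last first.
  by move=> j ne; rewrite -/(ovl A A i j) ovl_id eq_sym (negbTE ne) mulr0.
rewrite -/(ovl A A i i) ovl_id eqxx mulr1.
rewrite -[X in X - _]mulr1 -(ovl_row A B i) mulr_sumr -sumrB.
by apply: eq_bigr => j _; rewrite -/(ovl A B i j); ring.
Qed.

(** The support condition as absolute continuity of the Nussbaum-Szkola pair: A = X B annihilates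
    the eigenvectors of B with eigenvalue zero. *)
Lemma supp_le_evals n (A B X : 'M[C]_n) i j : psdm A -> psdm B -> A = X *m B ->
  evals B j = 0 -> evals A i * ovl A B i j = 0.
Proof.
move=> /psd_spec[eA hA] /psd_spec[eB hB] eX b0.
have [u1 u2] := unit2_spectral A; have [v1 v2] := unit2_spectral B.
have : (spectralmx A *m A *m adj (spectralmx B)) i j = 0.
  have -> : spectralmx A *m A *m adj (spectralmx B) =
     spectralmx A *m X *m adj (spectralmx B) *m dg (evals B).
    have eBS : B *m adj (spectralmx B) = adj (spectralmx B) *m dg (evals B).
      by rewrite {1}eB -!mulmxA v1 mulmx1.
    by rewrite {2}eX -!mulmxA eBS.
  by rewrite dgMr b0 mulr0.
rewrite {2}eA !mulmxA u1 mul1mx -mulmxA dgMl => h.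
have : nsq ((evals A i)%:C%C * (spectralmx A *m adj (spectralmx B)) i j) = 0.
  by rewrite h /nsq /= expr0n addr0.
rewrite nsqM nsq_real => /eqP; rewrite mulf_eq0 sqrf_eq0 => /orP[|] /eqP h0.
  by rewrite h0 mul0r.
by rewrite /ovl h0 mulr0.
Qed.

Lemma supp_leP d n (A B : Op R d n) : psd A -> psd B -> supp_le A B ->
  exists X : 'M[C]_#|Idx d n|, A = X *m B.
Proof.
move=> /psd_herm hA /psd_herm hB; rewrite /supp_le hA hB => /submxP[X ->].
by exists X.
Qed.

(** Holds because E - E^2 = E (1 - E) E + (1 - E) E (1 - E), a sum of two congruences of positive
    operators. *)
Lemma E_sq_psd n (E : 'M[C]_n) : psdm E -> psdm (1%:M - E) -> psdm (E - E *m E).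
Proof.
move=> hE hF.
have -> : E - E *m E = E *m (1%:M - E) *m adj E + (1%:M - E) *m E *m adj (1%:M - E).
  rewrite adjD adjN adj_1 (psd_herm hE) mulmxBr mulmx1 mulmxBl.
  rewrite [(1%:M - E) *m E]mulmxBl mul1mx [(E - E *m E) *m (1%:M - E)]mulmxBr mulmx1.
  rewrite [(E - E *m E) *m E]mulmxBl.
  by rewrite [RHS]addrC subrK.
by apply: psdD; apply: psd_conj.
Qed.

Lemma tr_sq n (U V F : 'M[C]_n) (a : 'I_n -> R) : unit2 U -> unit2 V -> adj F = F ->
  trr (adj U *m dg a *m U) (F *m F) = \sum_i \sum_j a i * nsq ((U *m F *m adj V) i j).
Proof.
move=> [u1 u2] [v1 v2] hF.
have -> : trr (adj U *m dg a *m U) (F *m F) = complex.Re (\tr (dg a *m ((U *m F *m adj V) *m adj (U *m F *m adj V)))).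
  rewrite /trr -!mulmxA mxtrace_mulC -!mulmxA; congr (complex.Re (\tr (_ *m _))).
  rewrite !adjM adjK hF -!mulmxA; congr (_ *m (_ *m _)).
  by rewrite (mulmxA (adj V)) v2 mul1mx.
rewrite /mxtrace Re_sum; apply: eq_bigr => i _.
rewrite dgMl ReZ -mulr_sumr; congr (_ * _).
rewrite mxE Re_sum; apply: eq_bigr => j _.
by rewrite adjE mul_conj.
Qed.

(* Nussbaum--Szkola: |x + y|^2 <= 2 (|x|^2 + |y|^2) applied to the matrix entries of
   1 = (1 - E) + E between the two eigenbases. *)
Lemma nussbaum_szkola n (A B E : 'M[C]_n) (t : R) : psdm A -> psdm B -> 0 <= t ->
  psdm E -> psdm (1%:M - E) ->
  \sum_i \sum_j Num.min (evals A i) (t * evals B j) * ovl A B i j <=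
  2 * (trr A (1%:M - E) + t * trr B E).
Proof.
move=> hA hB t0 hE hF.
have [eA pA] := psd_spec hA; have [eB pB] := psd_spec hB.
have uA := unit2_spectral A; have uB := unit2_spectral B.
set F := 1%:M - E in hF *.
have hF2 : psdm (F - F *m F).
  by apply: E_sq_psd; [exact: hF|rewrite /F opprB addrC subrK].
have h1 := trr_le hA hF2; have h2 := trr_le hB (E_sq_psd hE hF).
apply: (@le_trans _ _ (2 * (trr A (F *m F) + t * trr B (E *m E)))); last first.
  have h3 := ler_wpM2l t0 h2.
  by rewrite ler_pM2l //; apply: lerD; rewrite // -subr_ge0 -trrBr -?mulrBr ?mulr_ge0 // trr_ge0 // E_sq_psd.
have e1 := tr_sq (evals A) uA uB (psd_herm hF); rewrite -eA in e1.
have e2 := tr_sq (evals B) uB uA (psd_herm hE); rewrite -eB exchange_big /= in e2.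
rewrite e1 e2 mulr_sumr -big_split /=.
rewrite mulr_sumr ler_sum //= => i _.
rewrite mulr_sumr -big_split mulr_sumr ler_sum //= => j _.
set U := spectralmx A; set V := spectralmx B.
have -> : nsq ((V *m E *m adj U) j i) = nsq ((U *m E *m adj V) i j).
  by rewrite -[RHS]nsq_conj -adjE !adjM adjK (psd_herm hE) mulmxA.
have -> : ovl A B i j = nsq ((U *m F *m adj V) i j + (U *m E *m adj V) i j).
  have -> : (U *m F *m adj V) i j + (U *m E *m adj V) i j = (U *m F *m adj V + U *m E *m adj V) i j.
    by rewrite [RHS]mxE.
  by rewrite -mulmxDl -mulmxDr /F subrK mulmx1.
set x := _ i j; set y := _ i j.
have hxy := nsqD_le x y; have x0 := nsq_ge0 x; have y0 := nsq_ge0 y.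
set m := Num.min _ _.
have m0 : 0 <= m by rewrite le_min pA mulr_ge0 ?pB.
apply: le_trans (ler_wpM2l m0 hxy) _.
have m1 : m <= evals A i by rewrite ge_min lexx.
have m2 : m <= t * evals B j by rewrite ge_min lexx orbT.
have {m1}m1 := ler_wpM2r x0 m1; have {m2}m2 := ler_wpM2r y0 m2.
by clearbody m; rewrite mulrCA mulrDr ler_pM2l //; apply: lerD; rewrite // mulrA.
Qed.

Lemma ln_ge (x : R) : 0 < x -> 1 - x^-1 <= ln x.
Proof.
move=> x0; have xi : 0 < x^-1 by rewrite invr_gt0.
have := expR_ge1Dx (ln x^-1); rewrite lnK // lnV //; lra.
Qed.

(** From ln x >= 1 - 1/x at x = a/b. It is kept termwise because the nonnegative surplus also makes
    Markov's inequality applicable to a log-ratio of changing sign. *)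
Lemma klein_term (a b w : R) : 0 <= a -> 0 <= b -> 0 <= w -> (b = 0 -> a * w = 0) ->
  0 <= a * w * (flog a - flog b) - a * w + b * w.
Proof.
move=> a0 b0 w0 h; have [a00|ap] := leP a 0.
  have -> : a = 0 by apply/eqP; rewrite eq_le a00.
  by rewrite !mul0r subrr add0r mulr_ge0.
have [b00|bp] := leP b 0.
  have {}b0 : b = 0 by apply/eqP; rewrite eq_le b00.
  by rewrite (h b0) b0 !mul0r subrr addr0.
rewrite /flog ap bp -ln_div //.
have := @ln_ge (a / b) (divr_gt0 ap bp); rewrite invf_div => h1.
have h2 := ler_wpM2l (mulr_ge0 a0 w0) h1.
have h3 : a * w * (1 - b / a) = a * w - b * w by field; rewrite gt_eqF.
by lra.
Qed.

Definition renty n (A B : 'M[C]_n) : R :=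
  \sum_i \sum_j evals A i * ovl A B i j * (flog (evals A i) - flog (evals B j)).

Lemma trB_ovl n (A B : 'M[C]_n) : psdm B ->
  \sum_i \sum_j evals B j * ovl A B i j = complex.Re (\tr B).
Proof.
move=> hB; rewrite exchange_big /= -evals_sum //; apply: eq_bigr => j _.
by rewrite -mulr_sumr ovl_col mulr1.
Qed.

Lemma trA_ovl n (A B : 'M[C]_n) : psdm A ->
  \sum_i \sum_j evals A i * ovl A B i j = complex.Re (\tr A).
Proof.
move=> hA; rewrite -evals_sum //; apply: eq_bigr => i _.
by rewrite -mulr_sumr ovl_row mulr1.
Qed.

Lemma klein n (A B : 'M[C]_n) : dens' A -> dens' B ->
  (forall i j, evals B j = 0 -> evals A i * ovl A B i j = 0) -> 0 <= renty A B.
Proof.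
move=> [hA tA] [hB tB] h0.
have [_ pA] := psd_spec hA; have [_ pB] := psd_spec hB.
have h : 0 <= \sum_i \sum_j (evals A i * ovl A B i j * (flog (evals A i) - flog (evals B j))
   - evals A i * ovl A B i j + evals B j * ovl A B i j).
  apply: sumr_ge0 => i _; apply: sumr_ge0 => j _.
  by apply: klein_term => //; [exact: ovl_ge0|exact: h0].
move: h; under eq_bigr do rewrite big_split /= sumrB.
by rewrite big_split /= sumrB trB_ovl // trA_ovl // tA tB /renty; lra.
Qed.

(** Markov's inequality for the likelihood ratio of the Nussbaum-Szkola pair: it exceeds t = exp((1
    + del)(D + 1)) with probability at most 1/(1 + del). The remaining mass del/(1 + del) is four
    times the constant of the statement and at most 2 (type I + t type II) by [nussbaum_szkola]; the
    type I error accounts for at most half of it. *)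
Lemma weak_converse n (A B E : 'M[C]_n) (del : R) : dens' A -> dens' B ->
  (forall i j, evals B j = 0 -> evals A i * ovl A B i j = 0) ->
  psdm E -> psdm (1%:M - E) -> 0 < del ->
  trr A (1%:M - E) <= del / (4 * (1 + del)) ->
  del / (4 * (1 + del)) * expR (- ((1 + del) * (renty A B + 1))) <= trr B E.
Proof.
move=> dA dB h0 hE hF d0 heps.
have D0 := klein dA dB h0.
have [hA tA] := dA; have [hB tB] := dB.
have [_ pA] := psd_spec hA; have [_ pB] := psd_spec hB.
set D := renty A B in D0 *; set a := (1 + del) * (D + 1).
have a0 : 0 < a by rewrite mulr_gt0 //; lra.
set t := expR a.
have t0 : 0 < t by exact: expR_gt0.
have NS := nussbaum_szkola hA hB (ltW t0) hE hF.
pose bad i j := t * evals B j < evals A i.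
have h1 : \sum_i \sum_j evals A i * ovl A B i j * (a * (bad i j)%:R) <= D + 1.
  have -> : D + 1 = \sum_i \sum_j (evals A i * ovl A B i j * (flog (evals A i) - flog (evals B j))
     + evals B j * ovl A B i j).
    under [RHS]eq_bigr do rewrite big_split /=.
    by rewrite big_split /= trB_ovl // tB.
  apply: ler_sum => i _; apply: ler_sum => j _.
  have kt := klein_term (pA i) (pB j) (ovl_ge0 A B i j) (h0 i j).
  have aw : 0 <= evals A i * ovl A B i j by rewrite mulr_ge0 // ovl_ge0.
  have bw : 0 <= evals B j * ovl A B i j by rewrite mulr_ge0 // ovl_ge0.
  rewrite /bad; case: ltP => hb; last by rewrite !mulr0; lra.
  rewrite mulr1; have [a00|ap] := leP (evals A i) 0.
    have -> : evals A i = 0 by apply/eqP; rewrite eq_le a00 pA.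
    by rewrite !mul0r add0r.
  have [b00|bp] := leP (evals B j) 0.
    have b0 : evals B j = 0 by apply/eqP; rewrite eq_le b00 pB.
    by rewrite (h0 i j b0) !mul0r add0r.
  rewrite -[leLHS]addr0; apply: lerD => //; apply: ler_wpM2l => //.
  rewrite /flog ap bp -ln_div // -[a]expRK ler_ln ?posrE ?expR_gt0 ?divr_gt0 //.
  by rewrite ler_pdivlMr // ltW.
have h2 : \sum_i \sum_j (evals A i * ovl A B i j - evals A i * ovl A B i j * (bad i j)%:R) <=
   2 * (trr A (1%:M - E) + t * trr B E).
  apply: le_trans NS; apply: ler_sum => i _; apply: ler_sum => j _.
  rewrite /bad minElt; case: ltP => hb.
    rewrite ltNge (ltW hb) /= mulr1 subrr mulr_ge0 ?ovl_ge0 // mulr_ge0 // ltW //.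
  by case: ltP => hb2; rewrite mulr0 subr0 // ler_wpM2r ?ovl_ge0.
have h3 : \sum_i \sum_j evals A i * ovl A B i j * (bad i j)%:R <= (1 + del)^-1.
  have e3 : a * (\sum_i \sum_j evals A i * ovl A B i j * (bad i j)%:R) =
     \sum_i \sum_j evals A i * ovl A B i j * (a * (bad i j)%:R).
    rewrite mulr_sumr; apply: eq_bigr => i _; rewrite mulr_sumr; apply: eq_bigr => j _; ring.
  rewrite -(ler_pM2l a0) e3; apply: le_trans h1 _.
  by rewrite /a mulrAC divff ?mul1r // gt_eqF //; lra.
have h4 : 1 - (1 + del)^-1 <= 2 * (trr A (1%:M - E) + t * trr B E).
  apply: le_trans h2; under eq_bigr do rewrite sumrB.
  rewrite sumrB trA_ovl // tA; lra.
have e5 : 1 - (1 + del)^-1 = 4 * (del / (4 * (1 + del))).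
  by field; rewrite gt_eqF //; lra.
rewrite e5 in h4; set c := del / _ in h4 heps *.
rewrite expRN ler_pdivrMr ?expR_gt0 // -/t; lra.
Qed.
End RelEnt.

(** * Tensor products and permutations *)

Section Tensor.
Variables (R : realType) (d : nat).
Local Notation C := (R[i]).

Lemma entE n (f : Idx d n -> Idx d n -> C) x y : ent (mkop f) x y = f x y.
Proof. by rewrite /ent mxE !enum_rankK. Qed.

Lemma op_ext n (A B : Op R d n) : (forall x y, ent A x y = ent B x y) -> A = B.
Proof.
move=> h; apply/matrixP => i j.
by have := h (enum_val i) (enum_val j); rewrite /ent !enum_valK.
Qed.

Lemma sum_rank n (F : 'I_#|Idx d n| -> C) : \sum_i F i = \sum_(x : Idx d n) F (enum_rank x).
Proof. by rewrite (reindex _ (onW_bij _ (@enum_rank_bij _))). Qed.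

Lemma ent_mul n (A B : Op R d n) x y : ent (A *m B) x y = \sum_z ent A x z * ent B z y.
Proof. by rewrite /ent mxE sum_rank. Qed.

Lemma ent_tr n (A : Op R d n) : \tr A = \sum_x ent A x x.
Proof. by rewrite /mxtrace sum_rank. Qed.

Lemma ent_1 n x y : ent (1%:M : Op R d n) x y = (x == y)%:R.
Proof. by rewrite /ent mxE (inj_eq enum_rank_inj). Qed.

Lemma ent_adj n (A : Op R d n) x y : ent (adj A : Op R d n) x y = conjC (ent A y x).
Proof. by rewrite /ent adjE. Qed.

Lemma entD n (A B : Op R d n) x y : ent (A + B : Op R d n) x y = ent A x y + ent B x y.
Proof. by rewrite /ent mxE. Qed.

Lemma entZ n a (A : Op R d n) x y : ent (a *: A : Op R d n) x y = a * ent A x y.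
Proof. by rewrite /ent mxE. Qed.

Lemma ent_sum n I (r : seq I) (P : pred I) (F : I -> Op R d n) x y :
  ent (\sum_(i <- r | P i) F i : Op R d n) x y = \sum_(i <- r | P i) ent (F i) x y.
Proof. by rewrite /ent summxE. Qed.

Lemma trr_ent n (A B : Op R d n) :
  trr A B = complex.Re (\sum_x \sum_y ent A x y * ent B y x).
Proof. by rewrite /trr ent_tr; congr complex.Re; apply: eq_bigr => x _; rewrite ent_mul. Qed.

Section Blocks.
Variables (m n k : nat) (pr : 'I_m -> Idx d n -> Idx d k).
Hypothesis pack_bij : bijective (fun x => [ffun i => pr i x] : {ffun 'I_m -> Idx d k}).

(** [pr i] reads off the i-th block of an index. One definition thus covers single sites ([pr1]) and
    blocks of length k ([blk]); the product rules need only that an index is the same thing as the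
    family of its blocks. *)
Definition bt (F : 'I_m -> Op R d k) : Op R d n :=
  mkop (fun x y => \prod_i ent (F i) (pr i x) (pr i y)).

Lemma eq_bt F G : F =1 G -> bt F = bt G.
Proof. by move=> /funext ->. Qed.

Lemma sum_pack (g : 'I_m -> Idx d k -> C) :
  \sum_x \prod_i g i (pr i x) = \prod_i \sum_z g i z.
Proof.
rewrite bigA_distr_bigA (reindex _ (onW_bij _ pack_bij)) /=.
by apply: eq_bigr => x _; apply: eq_bigr => i _; rewrite ffunE.
Qed.

Lemma bt_mul F G : bt F *m bt G = bt (fun i => F i *m G i).
Proof.
apply: op_ext => x y; rewrite ent_mul entE.
under [RHS]eq_bigr do rewrite ent_mul.
rewrite -sum_pack; apply: eq_bigr => z _.
by rewrite !entE -big_split.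
Qed.

Lemma bt_adj F : adj (bt F) = bt (fun i => adj (F i)).
Proof.
apply: op_ext => x y; rewrite ent_adj !entE rmorph_prod.
by apply: eq_bigr => i _; rewrite ent_adj.
Qed.

Lemma bt_1 : bt (fun _ => 1%:M) = 1%:M.
Proof.
apply: op_ext => x y; rewrite entE ent_1.
under eq_bigr do rewrite ent_1.
have [<-|ne] := eqVneq x y; first by rewrite big1 // => i _; rewrite eqxx.
case: (boolP [forall i, pr i x == pr i y]) => [/forallP h|].
  case/eqP: ne; apply: (bij_inj pack_bij); apply/ffunP => i; rewrite !ffunE.
  exact/eqP.
by rewrite negb_forall => /existsP[i /negbTE h]; rewrite (bigD1 i) //= h mul0r.
Qed.

Lemma bt_tr F : \tr (bt F) = \prod_i \tr (F i).
Proof.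
rewrite ent_tr; under [RHS]eq_bigr do rewrite ent_tr.
by rewrite -sum_pack; apply: eq_bigr => x _; rewrite entE.
Qed.

Lemma psd_bt F : (forall i, psdm (F i)) -> psdm (bt F).
Proof.
move=> h; have {}h i : exists B : Op R d k, F i = adj B *m B by exact: (psd_root (h i)).
have [B hB] := choice h.
have -> : bt F = adj (bt B) *m bt B.
  by rewrite bt_adj bt_mul; apply: eq_bt => i; rewrite hB.
exact: psd_gram'.
Qed.

Lemma bt_scale (c : 'I_m -> C) F : bt (fun i => c i *: F i) = (\prod_i c i) *: bt F.
Proof.
apply: op_ext => x y; rewrite entZ !entE -big_split.
by apply: eq_bigr => i _; rewrite entZ.
Qed.

Lemma bt_sum (Z : finType) (P : 'I_m -> Z -> Op R d k) :
  bt (fun i => \sum_z P i z) = \sum_(f : {ffun 'I_m -> Z}) bt (fun i => P i (f i)).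
Proof.
apply: op_ext => x y; rewrite ent_sum entE.
under [LHS]eq_bigr do rewrite ent_sum.
by rewrite bigA_distr_bigA; apply: eq_bigr => f _; rewrite entE.
Qed.
End Blocks.

Lemma Re_prod_real I (r : seq I) (F : I -> C) : (forall i, complex.Im (F i) = 0) ->
  complex.Re (\prod_(i <- r) F i) = \prod_(i <- r) complex.Re (F i) /\
  complex.Im (\prod_(i <- r) F i) = 0.
Proof.
move=> h; elim: r => [|i r [ih1 ih2]]; first by rewrite !big_nil.
by rewrite !big_cons ReM ImM h ih1 ih2 !mulr0 !mul0r subr0 addr0.
Qed.

Lemma tr_psd_real n (X Y : 'M[C]_n) : psdm X -> psdm Y -> complex.Im (\tr (X *m Y)) = 0.
Proof.
move=> /psd_herm hX /psd_herm hY.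
have : \tr (adj (X *m Y)) = \tr (X *m Y) by rewrite adjM hX hY mxtrace_mulC.
rewrite tr_adj => /(congr1 (@complex.Im R)); rewrite Im_conj; lra.
Qed.

(** The real part is multiplicative here because the trace of a product of two positive operators is
    real. *)
Lemma trr_bt m n k (pr : 'I_m -> Idx d n -> Idx d k)
  (pb : bijective (fun x => [ffun i => pr i x] : {ffun 'I_m -> Idx d k}))
  (F G : 'I_m -> Op R d k) : (forall i, psdm (F i)) -> (forall i, psdm (G i)) ->
  trr (bt pr F) (bt pr G) = \prod_i trr (F i) (G i).
Proof.
move=> hF hG; rewrite /trr (bt_mul pb) (bt_tr pb).
by have [-> _] := Re_prod_real (index_enum _) (fun i => tr_psd_real (hF i) (hG i)).
Qed.

Definition pr1 n (i : 'I_n) (x : Idx d n) : Idx d 1 := [ffun _ => x i].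

Lemma pr1_bij n : bijective (fun x => [ffun i => pr1 i x] : {ffun 'I_n -> Idx d 1}).
Proof.
exists (fun z : {ffun 'I_n -> Idx d 1} => [ffun i => z i ord0]) => z.
  by apply/ffunP => i; rewrite !ffunE.
by apply/ffunP => i; rewrite !ffunE; apply/ffunP => j; rewrite !ffunE (ord1 j).
Qed.

Lemma tprodE n (s : 'I_n -> Op R d 1) : tprod s = bt (@pr1 n) s.
Proof. by []. Qed.

Lemma idx_bij m k : bijective (uncurry (@mxvec_index m k)).
Proof.
have [g h1 h2] := curry_mxvec_bij m k.
by exists g => x; [apply: h1|apply: h2].
Qed.

Lemma idx_inj m k (a a' : 'I_m) (b b' : 'I_k) :
  mxvec_index a b = mxvec_index a' b' -> a = a' /\ b = b'.
Proof.
have [g h _] := idx_bij m k.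
by move=> /(congr1 g); rewrite -[mxvec_index a b]/(uncurry _ (a, b)) -[mxvec_index a' b']/(uncurry _ (a', b')) !h => -[-> ->].
Qed.

Lemma blk_bij m k : bijective (fun x => [ffun i => blk i x] : {ffun 'I_m -> Idx d k}).
Proof.
have [g h1 h2] := idx_bij m k.
exists (fun z : {ffun 'I_m -> Idx d k} => [ffun i => z (g i).1 (g i).2]) => z.
  apply/ffunP => i; rewrite !ffunE; congr (z _).
  by have := h2 i; case: (g i).
apply/ffunP => i; apply/ffunP => j; rewrite !ffunE.
by rewrite -[mxvec_index i j]/(uncurry _ (i, j)) h1.
Qed.

Lemma prod_idx m k (F : 'I_(m * k) -> C) :
  \prod_i F i = \prod_i \prod_j F (mxvec_index i j).
Proof.
rewrite (reindex _ (curry_mxvec_bij m k)) /= pair_big /=.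
by apply: eq_bigr => -[].
Qed.

Lemma ent_ipow n (s : Op R d 1) (x y : Idx d n) :
  ent (ipow n s) x y = \prod_i ent s [ffun _ => x i] [ffun _ => y i].
Proof. exact: entE. Qed.

Lemma ipow_blk m k (s : Op R d 1) :
  ipow (m * k) s = bt (@blk d m k) (fun _ => ipow k s).
Proof.
apply: op_ext => x y; rewrite ent_ipow entE prod_idx; apply: eq_bigr => i _.
rewrite ent_ipow; apply: eq_bigr => j _.
by congr (ent s _ _); apply/ffunP => a; rewrite !ffunE.
Qed.

(** Source and target may have different lengths: numbers such as [m.+1 * k + k] and [m.+2 * k] are
    not convertible, and a bijection of positions replaces a cast. *)
Definition rx n n' (f : 'I_n -> 'I_n') (A : Op R d n) : Op R d n' :=
  mkop (fun x y => ent A [ffun i => x (f i)] [ffun i => y (f i)]).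

Lemma rx_bij n n' (f : 'I_n -> 'I_n') : bijective f ->
  bijective (fun x : Idx d n' => [ffun i => x (f i)] : Idx d n).
Proof.
move=> [g h1 h2]; exists (fun x : Idx d n => [ffun i => x (g i)] : Idx d n') => x;
  by apply/ffunP => i; rewrite !ffunE ?h1 ?h2.
Qed.

Lemma rx_mul n n' (f : 'I_n -> 'I_n') (A B : Op R d n) : bijective f ->
  rx f (A *m B) = rx f A *m rx f B.
Proof.
move=> hf; apply: op_ext => x y; rewrite entE !ent_mul.
rewrite (reindex _ (onW_bij _ (rx_bij hf))) /=.
by apply: eq_bigr => z _; rewrite !entE.
Qed.

Lemma rx_adj n n' (f : 'I_n -> 'I_n') (A : Op R d n) : rx f (adj A) = adj (rx f A).
Proof. by apply: op_ext => x y; rewrite !(entE, ent_adj). Qed.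

Lemma rx_tr n n' (f : 'I_n -> 'I_n') (A : Op R d n) : bijective f -> \tr (rx f A) = \tr A.
Proof.
move=> hf; rewrite !ent_tr [RHS](reindex _ (onW_bij _ (rx_bij hf))) /=.
by apply: eq_bigr => x _; rewrite entE.
Qed.

Lemma rx_1 n n' (f : 'I_n -> 'I_n') : bijective f -> rx f 1%:M = 1%:M.
Proof.
move=> hf; apply: op_ext => x y; rewrite entE !ent_1.
by rewrite (inj_eq (bij_inj (rx_bij hf))).
Qed.

Lemma rxD n n' (f : 'I_n -> 'I_n') (A B : Op R d n) : rx f (A + B) = rx f A + rx f B.
Proof. by apply: op_ext => x y; rewrite !(entE, entD). Qed.

Lemma rx_psd n n' (f : 'I_n -> 'I_n') (A : Op R d n) : bijective f -> psdm A -> psdm (rx f A).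
Proof.
move=> hf /psd_root[B ->]; rewrite rx_mul // rx_adj; exact: psd_gram'.
Qed.

Lemma rx_comp n n' n'' (f : 'I_n -> 'I_n') (g : 'I_n' -> 'I_n'') (A : Op R d n) :
  rx g (rx f A) = rx (g \o f) A.
Proof.
by apply: op_ext => x y; rewrite !entE; congr (ent A _ _); apply/ffunP => i; rewrite !ffunE.
Qed.

Lemma rx_id n (f : 'I_n -> 'I_n) (A : Op R d n) : f =1 id -> rx f A = A.
Proof.
move=> h; apply: op_ext => x y; rewrite entE.
by congr (ent A _ _); apply/ffunP => i; rewrite !ffunE h.
Qed.

Lemma trr_rx n n' (f : 'I_n -> 'I_n') (A B : Op R d n) : bijective f ->
  trr (rx f A) (rx f B) = trr A B.
Proof. by move=> hf; rewrite /trr -rx_mul // rx_tr. Qed.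

Lemma rx_bt m n n' k (pr : 'I_m -> Idx d n -> Idx d k) (pr' : 'I_m -> Idx d n' -> Idx d k)
  (f : 'I_n -> 'I_n') (F : 'I_m -> Op R d k) :
  (forall i (x : Idx d n'), pr i [ffun j => x (f j)] = pr' i x) -> rx f (bt pr F) = bt pr' F.
Proof.
by move=> h; apply: op_ext => x y; rewrite !entE; apply: eq_bigr => i _; rewrite !h.
Qed.

Definition perminv n (A : Op R d n) := forall p : 'S_n, rx p A = A.

Lemma bt_reindex m n k (pr : 'I_m -> Idx d n -> Idx d k) (s : 'S_m) (F : 'I_m -> Op R d k) :
  bt (fun i => pr (s i)) F = bt pr (fun i => F ((s^-1)%g i)).
Proof.
apply: op_ext => x y; rewrite !entE [RHS](reindex_inj (@perm_inj _ s)) /=.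
by apply: eq_bigr => i _; rewrite permK.
Qed.

Lemma rx_bt1 n (s : 'S_n) (F : 'I_n -> Op R d 1) :
  rx s (bt (@pr1 n) F) = bt (@pr1 n) (fun i => F ((s^-1)%g i)).
Proof.
rewrite -bt_reindex; apply: rx_bt => i x.
by apply/ffunP => j; rewrite !ffunE.
Qed.

Lemma blk_perm m k (s : 'S_m) : exists p : 'S_(m * k), forall i j,
  p (mxvec_index i j) = mxvec_index (s i) j.
Proof.
have [g h1 h2] := idx_bij m k.
pose f i := mxvec_index (s (g i).1) (g i).2.
have fi : injective f.
  move=> a b /idx_inj[/perm_inj e1 e2]; rewrite -(h2 a) -(h2 b).
  by rewrite [g a]surjective_pairing [g b]surjective_pairing e1 e2.
exists (perm fi) => i j; rewrite permE /f.
by rewrite -[X in g X]/(uncurry (@mxvec_index m k) (i, j)) h1.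
Qed.

Lemma rx_btblk m k (s : 'S_m) : exists p : 'S_(m * k), forall F : 'I_m -> Op R d k,
  rx p (bt (@blk d m k) F) = bt (@blk d m k) (fun i => F ((s^-1)%g i)).
Proof.
have [p hp] := blk_perm k s; exists p => F.
rewrite -bt_reindex; apply: rx_bt => i x.
by apply/ffunP => j; rewrite !ffunE hp.
Qed.

Lemma perminv_bt m k (X : Op R d (m * k)) (s : 'S_m) (F : 'I_m -> Op R d k) : perminv X ->
  trr X (bt (@blk d m k) (fun i => F (s i))) = trr X (bt (@blk d m k) F).
Proof.
move=> hX; have [p hp] := rx_btblk k (s^-1)%g.
have := hp F; rewrite invgK => <-; rewrite -{1}(hX p) trr_rx //.
by exists (p^-1)%g => i; rewrite ?permK ?permKV.
Qed.

Lemma ipow_perminv n (s : Op R d 1) : perminv (ipow n s).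
Proof. by move=> p; rewrite /ipow tprodE rx_bt1. Qed.

Lemma dens_psd n (A : Op R d n) : dens A -> psdm A. Proof. by case. Qed.
Lemma dens_dens' n (A : Op R d n) : dens A -> dens' A.
Proof. by case=> h1 h2; split=> //; rewrite h2. Qed.

Lemma dens_tprod n (s : 'I_n -> Op R d 1) : (forall i, dens (s i)) -> dens (tprod s).
Proof.
move=> h; rewrite tprodE; split; first by apply: (psd_bt (@pr1_bij n)) => i; case: (h i).
by rewrite (bt_tr (@pr1_bij n)) big1 // => i _; case: (h i).
Qed.

Lemma dens_ipow n (s : Op R d 1) : dens s -> dens (ipow n s).
Proof. by move=> h; apply: dens_tprod. Qed.

Lemma rx_closed (A : forall n, set (Op R d n)) n n' (f : 'I_n -> 'I_n') rho :
  axQIII A -> (0 < n)%N -> bijective f -> A n rho -> A n' (rx f rho).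
Proof.
move=> q3 n0 hf; have e : n = n' by have := bij_eq_card hf; rewrite !card_ord.
case: n' / e f hf => f hf hA.
have := q3 n n0 rho hA (perm (bij_inj hf)).
by congr (A n _); apply: op_ext => x y; rewrite !entE; congr (ent rho _ _);
   apply/ffunP => i; rewrite !ffunE permE.
Qed.
End Tensor.

(** * Filtering blocks by effects close to the identity *)

Section Filter.
Variables (R : realType) (d : nat).
Local Notation C := (R[i]).

Lemma ijoin_bij n k : bijective (fun z : Idx d n * Idx d k => ijoin z.1 z.2).
Proof.
exists (fun x => (ilft x, irgt x)) => [[x z]|x] /=.
  congr pair; apply/ffunP => i; rewrite !ffunE.
    by rewrite -[lshift k i]/(unsplit (inl i)) unsplitK.
  by rewrite -[rshift n i]/(unsplit (inr i)) unsplitK.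
by apply/ffunP => i; rewrite ffunE; case: splitP => j e; rewrite ffunE; congr (x _); apply/val_inj.
Qed.

Lemma ilft_join n k (x : Idx d n) (z : Idx d k) : ilft (ijoin x z) = x.
Proof. by apply/ffunP => i; rewrite !ffunE -[lshift k i]/(unsplit (inl i)) unsplitK. Qed.
Lemma irgt_join n k (x : Idx d n) (z : Idx d k) : irgt (ijoin x z) = z.
Proof. by apply/ffunP => i; rewrite !ffunE -[rshift n i]/(unsplit (inr i)) unsplitK. Qed.
Lemma join_split n k (x : Idx d (n + k)) : ijoin (ilft x) (irgt x) = x.
Proof.
by apply/ffunP => i; rewrite ffunE; case: splitP => j e; rewrite ffunE; congr (x _); apply/val_inj.
Qed.

Lemma sum_join n k (F : Idx d (n + k) -> C) :
  \sum_x F x = \sum_(x : Idx d n) \sum_(z : Idx d k) F (ijoin x z).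
Proof. by rewrite (reindex _ (onW_bij _ (@ijoin_bij n k))) /= pair_big. Qed.

Lemma tens_mul n k (A A' : Op R d n) (B B' : Op R d k) :
  tens A B *m tens A' B' = tens (A *m A') (B *m B').
Proof.
apply: op_ext => x y; rewrite ent_mul entE !ent_mul sum_join mulr_suml.
apply: eq_bigr => z _; rewrite mulr_sumr; apply: eq_bigr => w _.
by rewrite !entE !ilft_join !irgt_join; ring.
Qed.

Lemma tens_adj n k (A : Op R d n) (B : Op R d k) : adj (tens A B) = tens (adj A) (adj B).
Proof. by apply: op_ext => x y; rewrite ent_adj !entE rmorphM !ent_adj. Qed.

Lemma tens_tr n k (A : Op R d n) (B : Op R d k) : \tr (tens A B) = \tr A * \tr B.
Proof.
rewrite !ent_tr sum_join mulr_suml; apply: eq_bigr => x _; rewrite mulr_sumr.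
by apply: eq_bigr => z _; rewrite entE !ilft_join !irgt_join.
Qed.

Lemma tens_11 n k : tens (1%:M : Op R d n) (1%:M : Op R d k) = 1%:M.
Proof.
apply: op_ext => x y; rewrite entE !ent_1 -natrM mulnb; congr (nat_of_bool _)%:R.
apply/andP/eqP => [[/eqP e1 /eqP e2]|-> //].
by rewrite -(join_split x) -(join_split y) e1 e2.
Qed.

Lemma tens_psd n k (A : Op R d n) (B : Op R d k) : psdm A -> psdm B -> psdm (tens A B).
Proof.
move=> /psd_root[A' ->] /psd_root[B' ->].
rewrite -tens_mul -tens_adj; exact: psd_gram'.
Qed.

Lemma tensBl n k (A A' : Op R d n) (B : Op R d k) : tens (A - A') B = tens A B - tens A' B.
Proof.
apply: op_ext => x y; rewrite entE.
by rewrite -[X in tens A B + X]scaleN1r -[X in A + X]scaleN1r !(entD, entZ, entE) mulrDl mulrA.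
Qed.

Lemma tensZr n k a (A : Op R d n) (B : Op R d k) : tens A (a *: B) = a *: tens A B.
Proof. by apply: op_ext => x y; rewrite entE entZ !(entZ, entE); ring. Qed.

Lemma ipow_tens n k (s : Op R d 1) : ipow (n + k) s = tens (ipow n s) (ipow k s).
Proof.
apply: op_ext => x y; rewrite !entE big_split_ord /=; congr (_ * _);
  by apply: eq_bigr => i _; congr (ent s _ _); apply/ffunP => j; rewrite !ffunE.
Qed.

Lemma trr_tens n k (A X : Op R d n) (B Y : Op R d k) :
  psdm A -> psdm X -> trr (tens A B) (tens X Y) = trr A X * trr B Y.
Proof.
move=> hA hX; rewrite /trr tens_mul tens_tr ReM.
by rewrite (tr_psd_real hA hX) mul0r subr0.
Qed.

Lemma tr_ptr n k (M : Op R d (n + k)) (X : Op R d n) :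
  \tr (M *m tens X 1%:M) = \tr (ptr M *m X).
Proof.
rewrite !ent_tr; under eq_bigr do rewrite ent_mul.
under [RHS]eq_bigr do rewrite ent_mul.
rewrite sum_join; apply: eq_bigr => x _.
under eq_bigr do rewrite sum_join.
under [RHS]eq_bigr do rewrite entE mulr_suml.
rewrite exchange_big /=; apply: eq_bigr => y _.
apply: eq_bigr => z _; rewrite (bigD1 z) //= big1 ?addr0 => [|w ne].
  by rewrite entE !ilft_join !irgt_join ent_1 eqxx mulr1.
by rewrite [X in _ * X]entE !irgt_join ent_1 (negbTE ne) !mulr0.
Qed.

Lemma trr_ptr n k (M : Op R d (n + k)) (X : Op R d n) (F : Op R d k) :
  trr M (tens X F) = trr (ptr (M *m tens 1%:M F)) X.
Proof.
by rewrite /trr -tr_ptr -mulmxA tens_mul mul1mx mulmx1.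
Qed.

(** The neighbourhood of the identity in Axiom Q.IV, with radius e; [softcone] adds nonnegative
    multiples, zero included, so that it contains small effects as well. *)
Definition soft (e : R) k (F : Op R d k) := Defs.hermitian F /\
  (forall i j, `|F i j - (1%:M : Op R d k) i j| < (e%:C)%C).

Definition softcone (e : R) k (F : Op R d k) :=
  exists2 a : R, 0 <= a & exists2 F' : Op R d k, soft e F' & F = a%:C%C *: F'.

Lemma soft1 e k : 0 < e -> soft e (1%:M : Op R d k).
Proof.
move=> e0; split; first exact: adj_1.
by move=> i j; rewrite subrr normr0 ltcR.
Qed.

Unset Implicit Arguments.
Variable A : forall n, set (Op R d n).
Set Implicit Arguments.
Hypothesis dA : forall n, (0 < n)%N -> A n `<=` @dens R d n.
Hypothesis q3 : axQIII A.
Hypothesis q4 : axQIV A.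

(** Axiom Q.IV with the filter 1 places the partial trace in the cone, and the trace fixes the
    scalar to be 1. *)
Lemma ptr_mem n k rho : (0 < n)%N -> (0 < k)%N -> A (n + k) rho ->
  A n (ptr (rho *m tens 1%:M 1%:M)).
Proof.
move=> n0 k0 hr; have [e e0 h] := q4 k0.
have [h1 h2] := @soft1 e k e0.
have [a a0 [w hw ew]] := h _ h1 h2 n n0 rho hr.
have : \tr (ptr (rho *m tens (1%:M : Op R d n) (1%:M : Op R d k))) = 1.
  rewrite -[ptr _]mulmx1 -tr_ptr !tens_11 !mulmx1.
  by have [] := dA (ltn_addr k n0) hr.
rewrite ew mxtraceZ; have [_ ->] := dA n0 hw; rewrite mulr1 => /complexI ->.
by rewrite scale1r.
Qed.

(** Block j is moved to the end by a permutation (Axiom Q.III) and filtered there (Axiom Q.IV).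
    Starting from m + 2 blocks guarantees that at least one remains. The pair (a, w) depends on [F]
    but not on the operators on the other blocks. *)
Lemma peel k : (0 < k)%N -> exists2 e : R, 0 < e & forall m (j : 'I_m.+2) rho (F : Op R d k),
  A (m.+2 * k)%N rho -> softcone e F ->
  exists2 a : R, 0 <= a & exists2 w, A (m.+1 * k)%N w & forall G : 'I_m.+2 -> Op R d k,
   G j = F -> trr rho (bt (@blk d m.+2 k) G) = a * trr w (bt (@blk d m.+1 k) (fun i => G (lift j i))).
Proof.
move=> k0; have [e e0 he] := q4 k0; exists e => // m j rho F hr [b b0 [F' [hF1 hF2] eF]].
have [g g1 g2] := idx_bij m.+1 k.
(* [psi] sends the last k positions to block j and the preceding ones, block by block, to the blocks
   other than j. *)
pose psi (c : 'I_(m.+1 * k + k)) : 'I_(m.+2 * k) :=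
  match fintype.split c with
  | inl c' => mxvec_index (lift j (g c').1) (g c').2
  | inr b => mxvec_index j b end.
have psiL a b' : psi (lshift k (mxvec_index a b')) = mxvec_index (lift j a) b'.
  rewrite /psi -[lshift k _]/(unsplit (inl _)) unsplitK.
  by rewrite -[X in g X]/(uncurry (@mxvec_index _ _) (a, b')) g1.
have psiR b' : psi (rshift _ b') = mxvec_index j b'.
  by rewrite /psi -[rshift _ _]/(unsplit (inr _)) unsplitK.
have psi_inj : injective psi.
  move=> x y; rewrite /psi; case: splitP => a ea; case: splitP => a' ea'.
  - move=> /idx_inj[/lift_inj e1 e2]; apply: val_inj; rewrite /= ea ea'.
    by congr (nat_of_ord _); apply: (bij_inj (Bijective g2 g1)); apply/eqP; rewrite -pair_eqE /pair_eq e1 e2 !eqxx.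
  - by move=> /idx_inj[/eqP]; rewrite eq_sym (negbTE (neq_lift _ _)).
  - by move=> /idx_inj[/eqP]; rewrite (negbTE (neq_lift _ _)).
  - by move=> /idx_inj[_ e1]; apply: val_inj; rewrite /= ea ea' e1.
have psi_bij : bijective psi by apply: inj_card_bij => //; rewrite !card_ord mulSn addnC.
have [phi p1 p2] := psi_bij.
have phi_bij : bijective phi by exists psi.
have hr' : A (m.+1 * k + k) (rx phi rho).
  by apply: rx_closed hr => //; rewrite muln_gt0.
have mk0 : (0 < m.+1 * k)%N by rewrite muln_gt0.
have [a a0 [w hw ew]] := he _ hF1 hF2 _ mk0 _ hr'.
exists (b * a); first by rewrite mulr_ge0.
exists w => // G Gj.
rewrite -(trr_rx _ _ phi_bij).
have -> : rx phi (bt (@blk d m.+2 k) G) =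
    tens (bt (@blk d m.+1 k) (fun i => G (lift j i))) (b%:C%C *: F').
  apply: op_ext => x y; rewrite !entE (bigD1_ord j) //= mulrC; congr (_ * _).
    apply: eq_bigr => i _; congr (ent _ _ _); apply/ffunP => c; rewrite !ffunE;
    by rewrite -psiL p1.
  rewrite Gj eF; congr (ent _ _ _); apply/ffunP => c; rewrite !ffunE -psiR p1 //.
rewrite tensZr trrZr trr_ptr ew trrZl; ring.
Qed.

(** Peeling off every block except i: conditionally on soft effects elsewhere, block i is left in a
    state of [A k] that serves all observables X at once. *)
Lemma cond k : (0 < k)%N -> exists2 e : R, 0 < e & forall m (i : 'I_m.+1) rho (G : 'I_m.+1 -> Op R d k),
  A (m.+1 * k)%N rho -> (forall j, j != i -> softcone e (G j)) ->
  exists2 a : R, 0 <= a & exists2 w, A k w & forall X : Op R d k,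
   trr rho (bt (@blk d m.+1 k) (fun j => if j == i then X else G j)) = a * trr w X.
Proof.
move=> k0; have [e e0 he] := peel k0; exists e => //; elim => [|m ih] i rho G hr hG.
  exists 1 => //.
  pose psi (b : 'I_k) : 'I_(1 * k) := mxvec_index i b.
  have psi_bij : bijective psi.
    apply: inj_card_bij => [x y /idx_inj[]//|]; by rewrite !card_ord mul1n.
  have [phi p1 p2] := psi_bij; have phi_bij : bijective phi by exists psi.
  exists (rx phi rho); first by apply: rx_closed hr => //; rewrite mul1n.
  move=> X; rewrite mul1r -(trr_rx _ _ phi_bij); congr (trr _ _).
  apply: op_ext => x y; rewrite !entE big_ord1 ord1 (ord1 i) eqxx.
  congr (ent _ _ _); apply/ffunP => c; rewrite !ffunE -[mxvec_index _ _]/(mxvec_index 0 c) -(ord1 i) -/(psi c) p1 //.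
have [j ne] : exists j : 'I_m.+2, j != i by exists (lift i ord0); rewrite eq_sym neq_lift.
have [i' ei _] := unlift_some (h := j) (i := i) ne.
have hj : softcone e (G j) by exact: hG.
have [a a0 [w hw ew]] := he m j rho (G j) hr hj.
have hG' l : l != i' -> softcone e (G (lift j l)).
  by move=> hl; apply: hG; rewrite ei (inj_eq lift_inj).
have [b b0 [w' hw' ew']] := ih i' w (fun l => G (lift j l)) hw hG'.
exists (a * b); first by rewrite mulr_ge0.
exists w' => // X; rewrite -mulrA -ew' ew; last by rewrite (negbTE ne).
congr (_ * trr _ _); apply: eq_bt => l.
by rewrite ei (inj_eq lift_inj).
Qed.
End Filter.

(** * Concentration of block statistics *)

Section Concentration.
Variables (R : realType) (W : finType) (pr : W -> R) (m J : nat).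
Variables (val : 'I_(m + J) -> W -> R) (B g2 c : R).
Hypothesis pr0 : forall w, 0 <= pr w.
Hypothesis pr1 : \sum_w pr w = 1.
Hypotheses (m0 : (0 < m)%N) (J0 : (0 < J)%N).
Hypothesis valB : forall i w, `|val i w| <= B.
Hypothesis corr : forall i j, i != j -> \sum_w pr w * (val i w * val j w) = g2.

Definition xbar w := m%:R^-1 * \sum_a val (lshift J a) w.
Definition ybar w := J%:R^-1 * \sum_b val (rshift m b) w.

(** Each of the first m scores keeps mean at least c when reweighted by this nonnegative function of
    the last J outcomes. *)
Hypothesis filt : forall a, 0 <= \sum_w pr w * ((val (lshift J a) w - c) * Num.max (c - ybar w) 0).

Let E (f : W -> R) := \sum_w pr w * f w.

Let E_le f g : (forall w, f w <= g w) -> E f <= E g.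
Proof. by move=> h; apply: ler_sum => w _; apply: ler_wpM2l. Qed.
Let ED f g : E (fun w => f w + g w) = E f + E g.
Proof. by rewrite /E -big_split; apply: eq_bigr => w _; rewrite mulrDr. Qed.
Let EZ a f : E (fun w => a * f w) = a * E f.
Proof. by rewrite /E mulr_sumr; apply: eq_bigr => w _; rewrite mulrCA. Qed.
Let E1 : E (fun=> 1) = 1.
Proof. by rewrite -[RHS]pr1; apply: eq_bigr => w _; rewrite mulr1. Qed.
Let Esum (I : finType) (f : I -> W -> R) : E (fun w => \sum_i f i w) = \sum_i E (f i).
Proof. by rewrite /E exchange_big; apply: eq_bigr => w _; rewrite mulr_sumr. Qed.

Let val2B i j w : `|val i w * val j w| <= B ^+ 2.
Proof. by rewrite normrM expr2 ler_pM. Qed.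

Let coef (i : 'I_(m + J)) : R :=
  match fintype.split i with inl _ => m%:R^-1 | inr _ => - J%:R^-1 end.

Let sum_coef (F : 'I_(m + J) -> R) :
  \sum_i coef i * F i = m%:R^-1 * \sum_a F (lshift J a) - J%:R^-1 * \sum_b F (rshift m b).
Proof.
rewrite big_split_ord /= !mulr_sumr -sumrN; congr (_ + _); apply: eq_bigr => a _.
  by rewrite /coef -[lshift J a]/(unsplit (inl a)) unsplitK.
by rewrite /coef -[rshift m a]/(unsplit (inr a)) unsplitK mulNr.
Qed.

Let sum_coef2 : \sum_i coef i ^+ 2 = m%:R^-1 + J%:R^-1.
Proof.
under eq_bigr do rewrite expr2.
rewrite (sum_coef coef).
have -> : \sum_(a < m) coef (lshift J a) = 1.
  rewrite (eq_bigr (fun=> m%:R^-1)) => [|a _]; last first.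
    by rewrite /coef -[lshift J a]/(unsplit (inl a)) unsplitK.
  by rewrite sumr_const card_ord -[LHS]mulr_natl mulfV // pnatr_eq0 -lt0n.
have -> : \sum_(a < J) coef (rshift m a) = - 1.
  rewrite (eq_bigr (fun=> - J%:R^-1)) => [|a _]; last first.
    by rewrite /coef -[rshift m a]/(unsplit (inr a)) unsplitK.
  by rewrite sumr_const card_ord -[LHS]mulr_natl mulrN mulfV // pnatr_eq0 -lt0n.
by rewrite mulrN opprK !mulr1.
Qed.

Let sum_coef1 : \sum_i coef i = 0.
Proof.
have -> : \sum_i coef i = \sum_i coef i * 1 by apply: eq_bigr => i _; rewrite mulr1.
rewrite (sum_coef (fun=> 1)) !sumr_const !card_ord.
by rewrite !mulVf ?subrr // pnatr_eq0 -lt0n.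
Qed.

Let dif w := xbar w - ybar w.

(* Only second moments matter: the coefficients of the difference of the two sample means
   sum to zero, so that the common correlation g2 of distinct blocks cancels. *)
Lemma dif_sq : E (fun w => dif w ^+ 2) <= 2 * B ^+ 2 * (m%:R^-1 + J%:R^-1).
Proof.
have eD w : dif w = \sum_i coef i * val i w by rewrite (sum_coef (fun i => val i w)).
have -> : E (fun w => dif w ^+ 2) =
    \sum_i \sum_j coef i * coef j * E (fun w => val i w * val j w).
  rewrite (_ : (fun w => _) = (fun w => \sum_i \sum_j coef i * coef j * (val i w * val j w))).
    rewrite Esum; apply: eq_bigr => i _; rewrite Esum; apply: eq_bigr => j _; exact: EZ.
  apply/funext => w; rewrite eD expr2 mulr_suml; apply: eq_bigr => i _.
  by rewrite mulr_sumr; apply: eq_bigr => j _; ring.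
(* A lower bound on the common correlation makes each diagonal term, second moment minus [g2], at
   most 2 B^2. *)
have g2B : - B ^+ 2 <= g2.
  rewrite -(@corr (lshift J (Ordinal m0)) (rshift m (Ordinal J0))); last first.
    by rewrite -val_eqE /= addn0 eq_sym -lt0n.
  apply: (@le_trans _ _ (E (fun=> - B ^+ 2))).
    by rewrite -[X in fun=> X]mulr1 EZ E1 mulr1.
  by apply: E_le => w; have := val2B (lshift J (Ordinal m0)) (rshift m (Ordinal J0)) w; rewrite ler_norml => /andP[].
have -> : \sum_i \sum_j coef i * coef j * E (fun w => val i w * val j w) =
    \sum_i coef i ^+ 2 * (E (fun w => val i w * val i w) - g2).
  have -> : \sum_i coef i ^+ 2 * (E (fun w => val i w * val i w) - g2) =
     \sum_i (coef i ^+ 2 * (E (fun w => val i w * val i w) - g2) + coef i * g2 * (\sum_j coef j)).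
    by rewrite sum_coef1; apply: eq_bigr => i _; rewrite mulr0 addr0.
  apply: eq_bigr => i _; rewrite mulr_sumr (bigD1 i) //= [in RHS](bigD1 i) //= addrA.
  congr (_ + _); first by rewrite -/(E _); ring.
  by apply: eq_bigr => j ne; rewrite [E _]corr 1?eq_sym //; ring.
rewrite -sum_coef2 mulr_sumr; apply: ler_sum => i _.
rewrite mulrC; apply: ler_wpM2r; first exact: sqr_ge0.
have : E (fun w => val i w * val i w) <= B ^+ 2.
  apply: (@le_trans _ _ (E (fun=> B ^+ 2))).
    by apply: E_le => w; apply: le_trans (ler_norm _) (val2B _ _ _).
  by rewrite -[X in fun=> X]mulr1 EZ E1 mulr1.
lra.
Qed.

(** With U the positive part of c - ybar, averaging [filt] gives E (xbar - c) U >= 0. Adding U^2 =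
    (c - ybar) U yields E U^2 <= E dif U, hence E U^2 <= E dif^2. Where xbar < c - del one has del
    <= U + |dif|, so del^2 <= 2 (U^2 + dif^2), and [dif_sq] finishes. *)
Lemma concentration (del : R) : 0 < del ->
  del ^+ 2 * \sum_(w | xbar w < c - del) pr w <= 8 * B ^+ 2 * (m%:R^-1 + J%:R^-1).
Proof.
move=> d0; pose U w := Num.max (c - ybar w) 0.
have U0 w : 0 <= U w by rewrite /U le_max lexx orbT.
have hU w : U w ^+ 2 = (c - ybar w) * U w.
  by rewrite /U expr2 maxEle; case: ifP; rewrite ?mulr0.
have h1 : 0 <= E (fun w => (xbar w - c) * U w).
  have -> : E (fun w => (xbar w - c) * U w) =
     m%:R^-1 * \sum_a E (fun w => (val (lshift J a) w - c) * U w).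
    rewrite -Esum -EZ; apply: eq_bigr => w _; congr (_ * _).
    rewrite -mulr_suml mulrA; congr (_ * _).
    rewrite sumrB mulrBr /xbar; congr (_ - _).
    by rewrite sumr_const card_ord -[c *+ m]mulr_natl mulrA mulVf ?mul1r // pnatr_eq0 -lt0n.
  rewrite mulr_ge0 ?invr_ge0 ?ler0n // sumr_ge0 // => a _; exact: filt.
have h2 : E (fun w => U w ^+ 2) <= E (fun w => dif w ^+ 2).
  have e1 : E (fun w => U w ^+ 2) + E (fun w => (xbar w - c) * U w) = E (fun w => dif w * U w).
    by rewrite -ED; apply: eq_bigr => w _; rewrite hU /dif; ring.
  have : E (fun w => dif w * U w) <= E (fun w => 2^-1 * (dif w ^+ 2 + U w ^+ 2)).
    apply: E_le => w; have := sqr_ge0 (dif w - U w); rewrite sqrrB; lra.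
  rewrite EZ ED; lra.
apply: (@le_trans _ _ (4 * E (fun w => dif w ^+ 2))); last by have := dif_sq; lra.
apply: (@le_trans _ _ (E (fun w => 2 * (U w ^+ 2 + dif w ^+ 2)))); last by rewrite EZ ED; lra.
rewrite mulr_sumr big_mkcond /=; apply: ler_sum => w _; case: ifP => hw; last first.
  by rewrite mulr_ge0 // mulr_ge0 // addr_ge0 ?sqr_ge0.
rewrite mulrC; apply: ler_wpM2l => //.
have k1 : c - ybar w <= U w by rewrite /U le_max lexx.
have k2 : del <= U w + `|dif w|.
  have := ler_norm (- dif w); rewrite normrN /dif; move: k1; rewrite /dif; lra.
have k3 : del ^+ 2 <= (U w + `|dif w|) ^+ 2.
  by rewrite !expr2; apply: ler_pM => //; apply: ltW.
apply: le_trans k3 _; rewrite sqrrD -[dif w ^+ 2]real_normK ?num_real //.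
have := sqr_ge0 (U w - `|dif w|); rewrite sqrrB; lra.
Qed.
End Concentration.

(** * The block test and its two errors *)

Section BlockTest.
Variables (R : realType) (d : nat).
Local Notation C := (R[i]).
Unset Implicit Arguments.
Variable A : forall n, set (Op R d n).
Set Implicit Arguments.
Hypothesis dA : forall n, (0 < n)%N -> A n `<=` @dens R d n.
Hypothesis q3 : axQIII A.
Hypothesis q4 : axQIV A.

Lemma trr_btZ m k (rho : Op R d (m * k)) (c : 'I_m -> R) (F : 'I_m -> Op R d k) :
  trr rho (bt (@blk d m k) (fun i => (c i)%:C%C *: F i)) =
  (\prod_i c i) * trr rho (bt (@blk d m k) F).
Proof.
rewrite bt_scale -trrZr; congr (trr _ (_ *: _)).
by rewrite rmorph_prod.
Qed.

(** Translates between outcome statistics and operators: the mean of a product of functions of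
    single outcomes is the value of one product observable. *)
Lemma expect m k (rho : Op R d (m * k)) (Z : finType) (P : 'I_m -> Z -> Op R d k)
  (u : 'I_m -> Z -> R) :
  \sum_(z : {ffun 'I_m -> Z}) trr rho (bt (@blk d m k) (fun i => P i (z i))) * \prod_i u i (z i) =
  trr rho (bt (@blk d m k) (fun i => \sum_z (u i z)%:C%C *: P i z)).
Proof.
rewrite (bt_sum _ (fun i z => (u i z)%:C%C *: P i z)) trr_sumr; apply: eq_bigr => z _.
by rewrite trr_btZ mulrC.
Qed.

Lemma soft_pert e k (G : Op R d k) : 0 < e -> adj G = G ->
  exists2 eta : R, 0 < eta & forall t : R, `|t| <= eta -> soft e (1%:M + t%:C%C *: G : Op R d k).
Proof.
move=> e0 hG; pose g := \sum_i \sum_j (`|complex.Re (G i j)| + `|complex.Im (G i j)|).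
have g0 : 0 <= g by do 2!(apply: sumr_ge0 => ? _); rewrite addr_ge0.
exists (e / (g + 1)); first by rewrite divr_gt0 //; lra.
move=> t ht; split; first by rewrite /Defs.hermitian adjD adj_1 adjZr hG.
move=> i j; have -> : (1%:M + t%:C%C *: G) i j - (1%:M : Op R d k) i j = t%:C%C * G i j.
  by rewrite [X in X - _]mxE [(_ *: G) i j]mxE; ring.
apply: norm_lt_ReIm; rewrite ReZ ImZ !normrM -mulrDr.
set x := _ + _; have x0 : 0 <= x by rewrite addr_ge0.
have hx : x <= g.
  rewrite /g (bigD1 i) //= (bigD1 j) //= -/x -addrA lerDl addr_ge0 //.
    by apply: sumr_ge0 => l _; rewrite addr_ge0.
  by do 2!(apply: sumr_ge0 => ? _); rewrite addr_ge0.
apply: (@le_lt_trans _ _ (e / (g + 1) * g)); first by rewrite ler_pM.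
rewrite mulrAC ltr_pdivrMr; last lra.
by rewrite ltr_pM2l //; lra.
Qed.

(** Double transitivity of the symmetric group; for a permutation-invariant state it makes the
    correlations of all pairs of distinct blocks equal. *)
Lemma tperm2 (T : finType) (i j i0 j0 : T) : i != j -> i0 != j0 ->
  exists s : {perm T}, s i0 = i /\ s j0 = j.
Proof.
move=> ij ij0; exists (tperm i0 i * tperm (tperm i0 i j0) j)%g.
rewrite !permM tpermL; split; last by rewrite tpermL.
rewrite tpermD //; last by rewrite eq_sym.
by rewrite -[X in _ != X](tpermL i0 i) (inj_eq perm_inj) eq_sym.
Qed.

Lemma half_sum n (X : 'M[C]_n) (t : R) :
  (2^-1)%:C%C *: (1%:M + t%:C%C *: X) + (2^-1)%:C%C *: (1%:M + (- t)%:C%C *: X) = 1%:M.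
Proof.
rewrite !scalerDr !scalerA addrACA -!scalerDl -!rmorphM -!rmorphD /=.
have -> : 2^-1 + 2^-1 = 1 :> R by field.
by rewrite mulrN subrr scale1r scale0r addr0.
Qed.

(** The two-outcome measurement with effects (1 + t X)/2 and (1 - t X)/2 estimates X without bias
    when its outcomes are scored 1/t and -1/t. *)
Lemma half_dif n (X : 'M[C]_n) (t : R) : t != 0 ->
  (1 / t)%:C%C *: ((2^-1)%:C%C *: (1%:M + t%:C%C *: X)) +
  (-1 / t)%:C%C *: ((2^-1)%:C%C *: (1%:M + (- t)%:C%C *: X)) = X.
Proof.
move=> t0; rewrite !scalerDr !scalerA addrACA -!scalerDl -!rmorphM -!rmorphD /=.
have -> : 1 / t * 2^-1 + -1 / t * 2^-1 = 0 by field.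
have -> : 1 / t * 2^-1 * t + -1 / t * 2^-1 * - t = 1 by field.
by rewrite scale1r scale0r add0r.
Qed.

Section Povm.
Variables (k : nat) (X : finType) (M : X -> Op R d k) (f : X -> R) (c : R).
Hypothesis k0 : (0 < k)%N.
Hypothesis M0 : forall x, psdm (M x).
Hypothesis M1 : \sum_x M x = 1%:M.
Variables (G H : Op R d k).
Hypothesis defG : G = \sum_x (f x)%:C%C *: M x.
Hypothesis defH : H = \sum_x (expR (f x))%:C%C *: M x.
Hypothesis hc : forall rho, A k rho -> c <= trr rho G.

Let G_herm : adj G = G.
Proof.
rewrite defG adj_sum; apply: eq_bigr => x _.
by rewrite adjZr (psd_herm (M0 x)).
Qed.

Variable Bf : R.
Hypothesis Bf0 : 0 <= Bf.
Hypothesis fB : forall x, `|f x| <= Bf.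

Let pert_psd t : `|t| * Bf <= 1 -> psdm (1%:M + t%:C%C *: G).
Proof.
move=> ht; have -> : 1%:M + t%:C%C *: G = \sum_x (1 + t * f x)%:C%C *: M x.
  rewrite -M1 defG scaler_sumr -big_split; apply: eq_bigr => x _ /=.
  by rewrite scalerA rmorphD rmorphM /= scalerDl scale1r.
apply: psd_sum => x _; apply: psdZ => //.
have : `|t * f x| <= 1 by rewrite normrM; apply: le_trans ht; apply: ler_wpM2l.
rewrite ler_norml; lra.
Qed.

(** A common outcome type for both kinds of blocks; outcomes of the wrong kind get the effect 0. *)
Let Z : finType := (X + bool)%type.
Variables (m J : nat) (eta : R).
Hypothesis eta0 : 0 < eta.
Hypothesis etaB : eta * Bf <= 1.
Hypotheses (m0 : (0 < m)%N) (J0 : (0 < J)%N).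

Let sg (b : bool) : R := if b then eta else - eta.
Let sgE b : `|sg b| = eta.
Proof. by rewrite /sg; case: b; rewrite ?normrN gtr0_norm. Qed.
(* The last J blocks undergo a two-outcome measurement whose effects are close to multiples
   of the identity; its outcomes are weighted so as to have the same mean observable G. *)
Let N (b : bool) : Op R d k := (2^-1)%:C%C *: (1%:M + (sg b)%:C%C *: G).
Let isX (i : 'I_(m + J)) := (i < m)%N.
Definition effects (i : 'I_(m + J)) (z : Z) : Op R d k :=
  match z with
  | inl x => if isX i then M x else 0
  | inr b => if isX i then 0 else N b
  end.
Definition score (z : Z) : R := match z with inl x => f x | inr b => if b then 1 / eta else -1 / eta end.

Let sumZ (F : Z -> Op R d k) : \sum_z F z = \sum_x F (inl x) + \sum_b F (inr b).
Proof. exact: big_sumType. Qed.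

Let sumP (u : Z -> R) i : \sum_z (u z)%:C%C *: effects i z =
  if isX i then \sum_x (u (inl x))%:C%C *: M x else \sum_b (u (inr b))%:C%C *: N b.
Proof.
rewrite sumZ /effects; case: (isX i).
  by rewrite [X in _ + X]big1 ?addr0 // => b _; rewrite scaler0.
by rewrite [X in X + _]big1 ?add0r // => b _; rewrite scaler0.
Qed.

Let sumb (F : bool -> Op R d k) : \sum_b F b = F true + F false.
Proof. by rewrite big_bool. Qed.

Let sumP1 i : \sum_z (1 : R)%:C%C *: effects i z = 1%:M.
Proof.
rewrite (sumP (fun=> 1)); case: ifP => _; first by rewrite -M1; apply: eq_bigr => x _; rewrite scale1r.
rewrite sumb; apply: etrans (half_sum G eta); congr (_ + _); exact: scale1r.
Qed.

Let sumPv i : \sum_z (score z)%:C%C *: effects i z = G.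
Proof.
rewrite (sumP score); case: ifP => _; first by rewrite defG.
by rewrite sumb /N /score /sg /= half_dif // gt_eqF.
Qed.

Let effects0 i z : psdm (effects i z).
Proof.
rewrite /effects; case: z => [x|b]; case: (isX i); [exact: M0|exact: psd0|exact: psd0|].
apply: psdZ; first by rewrite invr_ge0.
by apply: pert_psd; rewrite sgE.
Qed.

Let Bv := Bf + eta^-1.
Let scoreB z : `|score z| <= Bv.
Proof.
have i0 : 0 < eta^-1 by rewrite invr_gt0.
case: z => [x|b] /=; first by rewrite /Bv; have := fB x; lra.
have -> : `|if b then 1 / eta else -1 / eta| = eta^-1.
  by case: b; rewrite normrM ?normrN normr1 mul1r gtr0_norm.
by rewrite lerDr.
Qed.

Let pz (rho : Op R d ((m + J) * k)) (z : {ffun 'I_(m + J) -> Z}) : R :=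
  trr rho (bt (@blk d (m + J) k) (fun i => effects i (z i))).
Let vz (i : 'I_(m + J)) (z : {ffun 'I_(m + J) -> Z}) := score (z i).

(** Acceptance depends on the first m outcomes alone. The last J blocks are measured only so that
    the joint distribution used in the type I estimate exists. *)
Definition passes (del : R) (z : {ffun 'I_(m + J) -> Z}) := c - del <= xbar vz z.
Definition block_test (del : R) : Op R d ((m + J) * k) :=
  \sum_(z | passes del z) bt (@blk d (m + J) k) (fun i => effects i (z i)).

Let sum_all : \sum_(z : {ffun 'I_(m + J) -> Z}) bt (@blk d (m + J) k) (fun i => effects i (z i)) = 1%:M.
Proof.
rewrite -(bt_sum _ effects) -(bt_1 R (@blk_bij d (m + J) k)); apply: eq_bt => i.
by rewrite -(sumP1 i); apply: eq_bigr => z _; rewrite scale1r.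
Qed.

Lemma block_test_psd del : psdm (block_test del).
Proof. by apply: psd_sum => z _; apply: (psd_bt (@blk_bij d (m + J) k)). Qed.

Lemma block_test_compl del : 1%:M - block_test del =
  \sum_(z | ~~ passes del z) bt (@blk d (m + J) k) (fun i => effects i (z i)).
Proof. by rewrite -sum_all (bigID (passes del)) /= addrAC -/(block_test del) subrr add0r. Qed.

Lemma block_test_psdC del : psdm (1%:M - block_test del).
Proof.
by rewrite block_test_compl; apply: psd_sum => z _; apply: (psd_bt (@blk_bij d (m + J) k)).
Qed.

Variable e : R.
Hypothesis e0 : 0 < e.
Hypothesis he : forall m (i : 'I_m.+1) rho (G : 'I_m.+1 -> Op R d k),
  A (m.+1 * k)%N rho -> (forall j, j != i -> softcone e (G j)) ->
  exists2 a : R, 0 <= a & exists2 w, A k w & forall X : Op R d k,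
   trr rho (bt (@blk d m.+1 k) (fun j => if j == i then X else G j)) = a * trr w X.
Hypothesis soft_eta : forall t, `|t| <= eta -> soft e (1%:M + t%:C%C *: G : Op R d k).

Let soft_N b : softcone e (N b).
Proof.
exists 2^-1; first by rewrite invr_ge0.
exists (1%:M + (sg b)%:C%C *: G) => //; apply: soft_eta.
by rewrite sgE.
Qed.

Let he' (i : 'I_(m + J)) rho (F : 'I_(m + J) -> Op R d k) :
  A ((m + J) * k)%N rho -> (forall j, j != i -> softcone e (F j)) ->
  exists2 a : R, 0 <= a & exists2 w, A k w & forall X : Op R d k,
   trr rho (bt (@blk d (m + J) k) (fun j => if j == i then X else F j)) = a * trr w X.
Proof. by case: m m0 i rho F => // m' _ i rho F; exact: he. Qed.

Section State.
Variable rho : Op R d ((m + J) * k).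
Hypotheses (Arho : A ((m + J) * k) rho) (irho : perminv rho).

Let mk0 : (0 < (m + J) * k)%N. Proof. by rewrite muln_gt0 addn_gt0 m0. Qed.
Let rho0 : psdm rho. Proof. exact: dens_psd (dA mk0 Arho). Qed.
Let pz0 z : 0 <= pz rho z.
Proof. by apply: trr_ge0 => //; apply: (psd_bt (@blk_bij d (m + J) k)). Qed.
Let pz1 : \sum_z pz rho z = 1.
Proof. by rewrite /pz -trr_sumr sum_all trr1; have [_ ->] := dA mk0 Arho. Qed.

Let GG (i j l : 'I_(m + J)) : Op R d k := if (l == i) || (l == j) then G else 1%:M.

Let corr2 i j : i != j ->
  \sum_z pz rho z * (vz i z * vz j z) = trr rho (bt (@blk d (m + J) k) (GG i j)).
Proof.
move=> ij; pose u l z := (if l == i then score z else 1) * (if l == j then score z else 1).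
transitivity (\sum_z pz rho z * \prod_l u l (z l)).
  apply: eq_bigr => z _; congr (_ * _); rewrite /u big_split /=; congr (_ * _).
    by rewrite (bigD1 i) //= eqxx big1 ?mulr1 // => l /negbTE ->.
  by rewrite (bigD1 j) //= eqxx big1 ?mulr1 // => l /negbTE ->.
rewrite expect; congr (trr _ _); apply: eq_bt => l; rewrite /GG /u.
have [->|ne] := eqVneq l i; first by rewrite (negbTE ij) /= -(sumPv i); apply: eq_bigr => z _; rewrite mulr1.
have [->|ne'] := eqVneq l j; first by rewrite -(sumPv j); apply: eq_bigr => z _; rewrite mul1r.
by rewrite -(sumP1 l); apply: eq_bigr => z _; rewrite mulr1.
Qed.

Let i0 : 'I_(m + J) := lshift J (Ordinal m0).
Let j0 : 'I_(m + J) := rshift m (Ordinal J0).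

Let corr i j : i != j ->
  \sum_z pz rho z * (vz i z * vz j z) = trr rho (bt (@blk d (m + J) k) (GG i0 j0)).
Proof.
move=> ij; rewrite corr2 //.
have ij0 : i0 != j0 by rewrite -val_eqE /= addn0 eq_sym -lt0n.
have [s [s1 s2]] := tperm2 ij ij0.
rewrite -(perminv_bt s _ irho); congr (trr _ _); apply: eq_bt => l.
by rewrite /GG -s1 -s2 !(inj_eq perm_inj).
Qed.

Let filt a : 0 <= \sum_z pz rho z *
  ((vz (lshift J a) z - c) * Num.max (c - ybar vz z) 0).
Proof.
set i := lshift J a; pose phi z := Num.max (c - ybar vz z) 0.
pose z0 : Z := inr true.
(* The weight is a function of the last J outcomes jointly, whereas [expect] needs products. It is
   therefore expanded over outcome patterns w of these blocks with product indicators [ind]; [adm]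
   pins the other coordinates to [z0] so that each pattern occurs once. *)
pose adm (w : {ffun 'I_(m + J) -> Z}) := [forall l, isX l ==> (w l == z0)].
pose ind (w z : {ffun 'I_(m + J) -> Z}) : R := \prod_l (if isX l then 1 else (w l == z l)%:R).
have phi_ind z : phi z = \sum_(w | adm w) phi w * ind w z.
  pose ws := [ffun l => if isX l then z0 else z l].
  rewrite (bigD1 ws) /=; last by apply/forallP => l; apply/implyP => hl; rewrite ffunE hl.
  rewrite big1 ?addr0; last first.
    move=> w /andP[/forallP hw ne]; have [l hl] : exists l, w l != ws l.
      apply/existsP; rewrite -negb_forall; apply: contra ne => /forallP h.
      by apply/eqP/ffunP => l; apply/eqP.
    rewrite /ind (bigD1 l) //=; have := hw l; rewrite ffunE in hl; move: hl.
    by case: (isX l) => /=; [move=> /negP h /h|move=> /negbTE -> _; rewrite mul0r mulr0].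
  rewrite /ind big1 ?mulr1 => [|l _]; last by case: ifP => // hl; rewrite ffunE hl eqxx.
  congr (Num.max (c - _) 0); rewrite /ybar; congr (_ * _); apply: eq_bigr => b _.
  by rewrite /vz ffunE /isX /= -ltn_subRL subnn ltn0.
pose u w l z := if l == i then score z - c else if isX l then 1 else (w l == z)%:R : R.
have -> : \sum_z pz rho z * ((vz i z - c) * Num.max (c - ybar vz z) 0) =
    \sum_(w | adm w) phi w * (\sum_z pz rho z * \prod_l u w l (z l)).
  transitivity (\sum_z \sum_(w | adm w) phi w * (pz rho z * \prod_l u w l (z l))).
    apply: eq_bigr => z _; rewrite -/(phi z) phi_ind mulr_sumr mulr_sumr; apply: eq_bigr => w _.
    have -> : \prod_l u w l (z l) = (vz i z - c) * ind w z.
      rewrite /ind (bigD1 i) //= [in RHS](bigD1 i) //= /u eqxx /isX /= ltn_ord mul1r.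
      congr (_ * _); apply: eq_bigr => l /negbTE -> //.
    by ring.
  by rewrite exchange_big /=; apply: eq_bigr => w _; rewrite mulr_sumr.
apply: sumr_ge0 => w _; apply: mulr_ge0; first by rewrite /phi le_max lexx orbT.
rewrite expect.
(* A fixed pattern puts [N b] on each last block (or 0, for an outcome in X), the identity on the
   other first blocks and G - c on block i. By [he'] the term is then a nonnegative multiple of tr
   om (G - c) for some om in [A k]. *)
pose F l : Op R d k := if isX l then 1%:M else effects l (w l).
have hF l : l != i -> softcone e (F l).
  move=> _; rewrite /F; case: ifP => hl.
    by exists 1 => //; exists 1%:M; [exact: soft1|rewrite scale1r].
  rewrite /effects hl; case: (w l) => [x|b]; last exact: soft_N.
  by exists 0 => //; exists 1%:M; [exact: soft1|rewrite scale0r].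
have [al al0 [om hom eom]] := he' Arho hF.
have -> : trr rho (bt (@blk d (m + J) k) (fun l => \sum_z (u w l z)%:C%C *: effects l z)) =
    al * trr om (G - c%:C%C *: 1%:M).
  rewrite -eom; congr (trr _ _); apply: eq_bt => l; rewrite /u.
  case: eqP => [->|_].
    rewrite -(sumPv i) -(sumP1 i) scaler_sumr -sumrB; apply: eq_bigr => z _.
    by rewrite scalerA mulr1 -scalerBl rmorphB.
  rewrite /F; case: ifP => hl; first exact: sumP1.
  rewrite (bigD1 (w l)) //= eqxx scale1r big1 ?addr0 // => z ne.
  by rewrite eq_sym (negbTE ne) scale0r.
apply: mulr_ge0 => //; rewrite trrBr trrZr trr1.
by have [_ ->] := dA k0 hom; rewrite mulr1 subr_ge0; exact: hc.
Qed.

Lemma block_test_typeI del : 0 < del ->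
  del ^+ 2 * trr rho (1%:M - block_test del) <= 8 * Bv ^+ 2 * (m%:R^-1 + J%:R^-1).
Proof.
move=> d0; rewrite block_test_compl trr_sumr.
have := concentration pz0 pz1 m0 J0 (fun i z => scoreB (z i)) corr filt d0.
apply: le_trans; rewrite ler_pM2l ?exprn_gt0 //.
by under eq_bigl do rewrite /passes -ltNge.
Qed.
End State.

(** Exponential Markov inequality: the indicator of acceptance is at most exp(m (xbar - (c - del))),
    and exp(m xbar) is a product function whose mean under independent blocks is the m-th power of
    tr s^k H. *)
Lemma block_test_typeII del (s : Op R d 1) : dens s ->
  trr (ipow ((m + J) * k) s) (block_test del) <=
  expR (- (m%:R * (c - del))) * trr (ipow k s) H ^+ m.
Proof.
move=> ds; have sk0 := dens_psd (dens_ipow k ds).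
pose u (l : 'I_(m + J)) z := if isX l then expR (score z) else 1.
have q0 z : 0 <= pz (ipow ((m + J) * k) s) z.
  apply: trr_ge0; first exact: dens_psd (dens_ipow _ ds).
  exact: (psd_bt (@blk_bij d (m + J) k)).
have -> : trr (ipow k s) H ^+ m = \sum_z pz (ipow ((m + J) * k) s) z * \prod_l u l (z l).
  rewrite expect ipow_blk trr_bt //; [|exact: blk_bij|]; last first.
    move=> i; apply: psd_sum => z _; apply: psdZ => //.
    by rewrite /u; case: ifP => _ //; exact: expR_ge0.
  rewrite big_split_ord /= [X in _ * X]big1 ?mulr1 => [|b _].
    rewrite (eq_bigr (fun=> trr (ipow k s) H)) ?prodr_const ?card_ord // => a _.
    by rewrite (sumP (u (lshift J a))) /u /isX /= ltn_ord defH.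
  rewrite (eq_bigr (fun z => (1 : R)%:C%C *: effects (rshift m b) z)).
    by rewrite sumP1 trr1; have [_ ->] := dens_ipow k ds.
  by move=> z _; rewrite /u /isX /= -ltn_subRL subnn ltn0.
rewrite /block_test trr_sumr mulr_sumr big_mkcond /=; apply: ler_sum => z _.
have h : \prod_l u l (z l) = expR (m%:R * xbar vz z).
  rewrite big_split_ord /= [X in _ * X]big1 ?mulr1 => [|b _]; last first.
    by rewrite /u /isX /= -ltn_subRL subnn ltn0.
  rewrite /xbar mulrA divff ?mul1r ?pnatr_eq0 -?lt0n // expR_sum.
  by apply: eq_bigr => a _; rewrite /u /isX /= ltn_ord.
case: ifP => hz; last by rewrite mulr_ge0 ?expR_ge0 // mulr_ge0 // h expR_ge0.
rewrite mulrCA -[leLHS]mulr1; apply: ler_wpM2l; first exact: q0.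
rewrite h -expRD; have := expR_ge1Dx (- (m%:R * (c - del)) + m%:R * xbar vz z).
by apply: le_trans; rewrite lerDl addrC -mulrBr mulr_ge0 ?ler0n // subr_ge0; exact: hz.
Qed.
End Povm.
End BlockTest.

(** * Type II errors *)

Section Twirl.
Variables (R : realType) (d : nat).
Local Notation C := (R[i]).

Lemma conv_seq n (S : set (Op R d n)) (I : Type) (r : seq I) (w : I -> R) (s : I -> Op R d n) :
  convexS S -> (forall i, 0 <= w i) -> (forall i, S (s i)) ->
  0 < \sum_(i <- r) w i ->
  exists2 y, S y & \sum_(i <- r) (w i)%:C%C *: s i = (\sum_(i <- r) w i)%:C%C *: y.
Proof.
move=> cS w0 sS; elim: r => [|i r ih]; rewrite ?big_nil ?ltxx // !big_cons => hp.
have W0 : 0 <= \sum_(j <- r) w j by exact: sumr_ge0.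
have [h0|hpos] := leP (\sum_(j <- r) w j) 0; last first.
  have [y Sy ey] := ih hpos; set W := \sum_(j <- r) w j in hp W0 hpos ey *.
  exists ((w i / (w i + W))%:C%C *: s i + (1 - w i / (w i + W))%:C%C *: y).
    apply: cS => //; rewrite divr_ge0 ?(ltW hp) //= ler_pdivrMr // mul1r lerDl //.
  have ne : w i + W != 0 by rewrite gt_eqF.
  rewrite ey scalerDr !scalerA -!rmorphM /=; congr (_%:C%C *: _ + _%:C%C *: _).
    by field.
  by field.
have e0 : \sum_(j <- r) w j = 0 by apply/eqP; rewrite eq_le h0.
exists (s i) => //; rewrite e0 addr0.
have -> : \sum_(j <- r) (w j)%:C%C *: s j = 0.
  clear -w0 e0; elim: r e0 => [|j r ih]; rewrite ?big_nil // !big_cons => e0.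
  have W0 : 0 <= \sum_(j <- r) w j by exact: sumr_ge0.
  have := w0 j => wj; have -> : w j = 0 by lra.
  by rewrite ih ?scale0r ?addr0 //; lra.
by rewrite addr0.
Qed.

Lemma conv_sum n (S : set (Op R d n)) (I : finType) (w : I -> R) (s : I -> Op R d n) :
  convexS S -> (forall i, 0 <= w i) -> (forall i, S (s i)) -> \sum_i w i = 1 ->
  S (\sum_i (w i)%:C%C *: s i).
Proof.
move=> cS w0 sS w1; have := @conv_seq n S I (index_enum I) w s cS w0 sS.
by rewrite w1 => /(_ ltr01)[y Sy ->]; rewrite scale1r.
Qed.

(** Symmetrisation. It is self-adjoint for the trace pairing, so twirling a test amounts to twirling
    the states: those of [A n] stay there by Axiom Q.III and convexity, and i.i.d. states do not
    change. *)
Definition twirl n (X : Op R d n) : Op R d n :=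
  \sum_(p : 'S_n) (#|{: 'S_n}|%:R^-1)%:C%C *: rx p X.

Lemma permb n (p : 'S_n) : bijective p.
Proof. by exists (p^-1)%g => x; rewrite ?permK ?permKV. Qed.

Lemma cardS_gt0 n : (0 < #|{: 'S_n}|)%N.
Proof. by apply/card_gt0P; exists 1%g. Qed.

Lemma twirl_perminv n (X : Op R d n) : perminv (twirl X).
Proof.
move=> q; rewrite /twirl.
have -> : rx q (\sum_(p : 'S_n) (#|{: 'S_n}|%:R^-1)%:C%C *: rx p X) =
    \sum_(p : 'S_n) (#|{: 'S_n}|%:R^-1)%:C%C *: rx (p * q)%g X.
  apply: op_ext => x y; rewrite entE !ent_sum; apply: eq_bigr => p _.
  rewrite !entZ; congr (_ * _); rewrite -(entE (fun x y => ent (rx p X) [ffun i => x (q i)] [ffun i => y (q i)])).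
  rewrite -/(rx q (rx p X)) rx_comp; congr (ent _ _ _).
  by apply: op_ext => a b; rewrite !entE; congr (ent X _ _); apply/ffunP => i; rewrite !ffunE /= permM.
by rewrite [RHS](reindex_inj (mulIg q)).
Qed.

Lemma twirl_id n (X : Op R d n) : perminv X -> twirl X = X.
Proof.
move=> h; rewrite /twirl; under eq_bigr do rewrite h.
rewrite -scaler_suml sumr_const -rmorphMn -mulr_natl mulfV ?scale1r //.
by rewrite pnatr_eq0 -lt0n cardS_gt0.
Qed.

Lemma trr_twirl n (X Y : Op R d n) : trr (twirl X) Y = trr X (twirl Y).
Proof.
rewrite /twirl trr_suml trr_sumr (reindex_inj (@invg_inj _)) /=.
apply: eq_bigr => p _; rewrite trrZl trrZr; congr (_ * _).
rewrite -(trr_rx _ _ (permb p)) rx_comp rx_id // => i /=.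
by rewrite permKV.
Qed.

Lemma twirl_psd n (X : Op R d n) : psdm X -> psdm (twirl X).
Proof.
move=> hX; apply: psd_sum => p _; apply: psdZ; first by rewrite invr_ge0 ler0n.
by apply: rx_psd => //; exact: permb.
Qed.

Lemma twirlD n (X Y : Op R d n) : twirl (X + Y) = twirl X + twirl Y.
Proof. by rewrite /twirl -big_split; apply: eq_bigr => p _ /=; rewrite rxD scalerDr. Qed.

Lemma twirlB n (X Y : Op R d n) : twirl (X - Y) = twirl X - twirl Y.
Proof. by apply/eqP; rewrite eq_sym subr_eq -twirlD subrK. Qed.

Lemma twirl_1 n : twirl (1%:M : Op R d n) = 1%:M.
Proof. by apply: twirl_id => p; rewrite rx_1 //; exact: permb. Qed.

Lemma twirl_mem (A : forall n, set (Op R d n)) n X : axQIII A -> convexS (A n) -> (0 < n)%N ->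
  A n X -> A n (twirl X).
Proof.
move=> q3 cA n0 hX.
have := @conv_sum n (A n) _ (fun=> #|{: 'S_n}|%:R^-1) (fun p : 'S_n => rx p X) cA; apply.
- by move=> _; rewrite invr_ge0 ler0n.
- by move=> p; exact: q3.
rewrite sumr_const -[LHS]mulr_natl mulfV // pnatr_eq0 -lt0n; exact: cardS_gt0.
Qed.
End Twirl.

(** * Bounds on optimal errors, their logarithms and lower limits *)

Section Beta.
Variables (R : realType) (d : nat).
Local Notation C := (R[i]).
Local Open Scope ereal_scope.

Lemma beta_le n (A B : set (Op R d n)) (eps b : R) (E : Op R d n) :
  psdm E -> psdm (1%:M - E)%R -> (forall r, A r -> (trr r (1%:M - E)%R <= eps)%R) ->
  (forall s, B s -> (trr s E <= b)%R) -> Defs.beta A B eps <= b%:E.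
Proof.
move=> h1 h2 h3 h4; apply: (@le_trans _ _ (ereal_sup [set (trR s E)%:E | s in B])).
  apply: ereal_inf_lbound; exists E => //; split => //.
  by apply: ge_ereal_sup => _ [r Ar <-]; rewrite lee_fin; exact: h3.
by apply: ge_ereal_sup => _ [s Bs <-]; rewrite lee_fin; exact: h4.
Qed.

Lemma beta_ge n (A B : set (Op R d n)) (eps b : R) :
  (forall E : Op R d n, psdm E -> psdm (1%:M - E)%R ->
     (forall r, A r -> (trr r (1%:M - E)%R <= eps)%R) ->
     forall t : R, (forall s, B s -> (trr s E <= t)%R) -> (b <= t)%R) ->
  (exists s, B s) -> b%:E <= Defs.beta A B eps.
Proof.
move=> h [s0 hs0]; apply: le_ereal_inf_tmp => _ [E [h1 h2 h3] <-].
case hs : (ereal_sup [set (trR s E)%:E | s in B]) => [t| |]; last 2 first.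
- by rewrite leey.
- have : (trR s0 E)%:E <= -oo by rewrite -hs; apply: ereal_sup_ubound; exists s0.
  by rewrite leeNy_eq.
rewrite lee_fin; apply: (h E) => // [r Ar|s Bs].
  rewrite -lee_fin; apply: le_trans h3; apply: ereal_sup_ubound; by exists r.
by rewrite -lee_fin -hs; apply: ereal_sup_ubound; exists s.
Qed.

Lemma mlog_ge (b : \bar R) (x : R) : b <= (expR (- x))%:E -> x%:E <= mlog b.
Proof.
case: b => [r| |] //=; last by rewrite leey.
rewrite lee_fin => h; case: ifPn => [_|]; first by rewrite leey.
rewrite -ltNge => r0; rewrite lee_fin lerNr -[leRHS]expRK ler_ln ?posrE ?expR_gt0 //.
Qed.

Lemma mlog_le (b : \bar R) (x : R) : (expR (- x))%:E <= b -> mlog b <= x%:E.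
Proof.
case: b => [r| |] /=; last 2 first.
- by rewrite leNye.
- by rewrite leeNy_eq.
rewrite lee_fin => h; have r0 : (0 < r)%R by apply: lt_le_trans h; exact: expR_gt0.
by rewrite (lt_geF r0) lee_fin lerNl -[leLHS]expRK ler_ln ?posrE ?expR_gt0.
Qed.

Lemma einf_ge (u : (\bar R)^nat) (l : \bar R) : (\forall n \near \oo, l <= u n) -> l <= limn_einf u.
Proof.
move=> [N _ hN]; rewrite limn_einf_lim; apply: lime_ge; first exact: is_cvg_einfs.
exists N => // n /= Nn; apply: le_ereal_inf_tmp => _ [k /= nk <-].
by apply: hN => /=; exact: leq_trans nk.
Qed.

Lemma einf_le (u : (\bar R)^nat) (l : \bar R) : (\forall n \near \oo, u n <= l) -> limn_einf u <= l.
Proof.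
move=> [N _ hN]; rewrite limn_einf_lim; apply: lime_le; first exact: is_cvg_einfs.
exists N => // n /= Nn; apply: le_trans (hN n Nn); apply: ereal_inf_lbound; by exists n => /=.
Qed.

Lemma einf_lt (u : (\bar R)^nat) (l : \bar R) : l < limn_einf u -> \forall n \near \oo, l <= u n.
Proof.
rewrite limn_einf_lim => h.
have [N hN] : exists N, l < einfs u N.
  apply: contrapT => /forallNP hn; move: h; rewrite ltNge => /negP; apply.
  apply: lime_le; first exact: is_cvg_einfs.
  by exists 0%N => // n _ /=; rewrite leNgt; apply/negP; exact: hn.
exists N => // n Nn; apply: le_trans (ltW hN) _.
by apply: ereal_inf_lbound; exists n => /=.
Qed.
End Beta.

(** * One good measurement on k systems bounds the Stein exponent from below *)

Section SteinLower.
Variables (R : realType) (d : nat).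
Local Notation C := (R[i]).
Unset Implicit Arguments.
Variable A : forall n, set (Op R d n).
Set Implicit Arguments.
Hypothesis dA : forall n, (0 < n)%N -> A n `<=` @dens R d n.
Hypothesis cA : forall n, (0 < n)%N -> convexS (A n).
Hypothesis q3 : axQIII A.
Hypothesis q4 : axQIV A.

Lemma nat_above (x : R) : exists N : nat, forall n, (N <= n)%N -> x <= n%:R.
Proof.
exists (Num.bound `|x|) => n hn; apply: le_trans (ler_norm x) _.
by apply: le_trans (ltW (archi_boundP (normr_ge0 x))) _; rewrite ler_nat.
Qed.

(** Division of n - 1 rather than n keeps the remainder r between 1 and k: the leftover systems are
    traced out by Axiom Q.IV, which needs at least one. *)
Lemma nat_blocks n k J : (0 < k)%N -> ((J + J + 2) * k + 2 <= n)%N ->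
  exists m r, [/\ n = ((m + J) * k + r)%N, (J <= m)%N, (0 < m)%N, (0 < r)%N &
                  (n <= m * k + J.+1 * k)%N].
Proof.
move=> k0 hn; pose q := (n.-1 %/ k)%N; pose r := (n.-1 %% k).+1.
have n0 : (0 < n)%N by apply: leq_trans hn; rewrite addnS.
have en : n = (q * k + r)%N by rewrite /r addnS -divn_eq prednK.
have rk : (r <= k)%N by rewrite /r ltn_mod.
have hq : (J + J + 1 <= q)%N.
  rewrite /q leq_divRL // -ltnS prednK //; apply: leq_trans hn.
  by rewrite !mulnDl mul1n; lia.
have Jq : (J <= q)%N by apply: leq_trans hq; rewrite -addnA leq_addr.
exists (q - J)%N, r; rewrite subnK //; split => //; [lia|lia|].
rewrite [leqLHS]en -{1}(subnK Jq) mulnDl mulSn -addnA leq_add2l addnC leq_add2r //.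
Qed.

Lemma half_margin (n c del z y : R) :
  2 * y <= n * del -> n * (c - del / 2) <= z + y -> (c - del) * n <= z.
Proof.
move=> h1 h2; have e : n * (c - del / 2) = (c - del) * n + (n * del) / 2 by field.
rewrite e in h2; lra.
Qed.

Section Setup.
Variables (S : set (Op R d 1)) (k : nat) (X : finType) (M : X -> Op R d k) (f : X -> R) (c : R).
Hypothesis k0 : (0 < k)%N.
Hypothesis M0 : forall x, psdm (M x).
Hypothesis M1 : \sum_x M x = 1%:M.
Variables (G H : Op R d k).
Hypothesis defG : G = \sum_x (f x)%:C%C *: M x.
Hypothesis defH : H = \sum_x (expR (f x))%:C%C *: M x.
Hypothesis dS : S `<=` @dens R d 1.
Hypothesis Sne : S !=set0.
Hypothesis Ane : A k !=set0.
Hypothesis c0 : 0 < c.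
Hypothesis hc : forall rho s, A k rho -> S s -> c <= trr rho G - trr (ipow k s) H + 1.

Let h : R := sup [set trr (ipow k s) H | s in S].

Let sup_ok : has_sup [set trr (ipow k s) H | s in S].
Proof.
have [s0 hs0] := Sne; have [r0 hr0] := Ane; split; first by exists (trr (ipow k s0) H), s0.
exists (trr r0 G + 1 - c) => _ [s hs <-]; have := hc hr0 hs; lra.
Qed.

Let le_h s : S s -> trr (ipow k s) H <= h.
Proof. by move=> hs; apply: sup_ubound; [exact: sup_ok.2|exists s]. Qed.

Let G_ge rho : A k rho -> c - 1 + h <= trr rho G.
Proof.
move=> hr; rewrite -lerBrDl; apply: sup_le_ub; first exact: sup_ok.1.
by move=> _ [s hs <-]; have := hc hr hs; lra.
Qed.

Let Bf := \sum_x `|f x|.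
Let Bf0 : 0 <= Bf. Proof. exact: sumr_ge0. Qed.
Let fB x : `|f x| <= Bf.
Proof. by rewrite /Bf (bigD1 x) //= lerDl sumr_ge0. Qed.

Let H_pos s : S s -> 0 < trr (ipow k s) H.
Proof.
move=> hs; have ds := dens_ipow k (dS hs); apply: (@lt_le_trans _ _ (expR (- Bf))); first exact: expR_gt0.
have -> : expR (- Bf) = trr (ipow k s) (\sum_x (expR (- Bf))%:C%C *: M x).
  by rewrite -scaler_sumr M1 trrZr trr1; have [_ ->] := ds; rewrite mulr1.
rewrite defH !trr_sumr; apply: ler_sum => x _; rewrite !trrZr ler_wpM2r //.
  by apply: trr_ge0 => //; exact: dens_psd ds.
by rewrite ler_expR; have := fB x; rewrite ler_norml => /andP[].
Qed.

Let h0 : 0 < h.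
Proof. by have [s hs] := Sne; apply: lt_le_trans (H_pos hs) (le_h hs). Qed.

Let G_herm : adj G = G.
Proof. by rewrite defG adj_sum; apply: eq_bigr => x _; rewrite adjZr (psd_herm (M0 x)). Qed.

(** The threshold is c - 1 + h, where h is the largest value of tr s^k H. The type II bound exp(-m
    (c - 1 + h - del)) h^m is at most exp(-m (c - del)) since ln h <= h - 1. The type I bound is of
    order 1/m + 1/J <= 2/J, so J depends on eps and del but not on m. *)
Lemma block_bound (eps del : R) : 0 < eps -> 0 < del -> exists J : nat, forall m r,
  (J <= m)%N -> (0 < m)%N -> (0 < r)%N ->
  (Defs.beta (A ((m + J) * k + r)%N) (@iid R d S ((m + J) * k + r)%N) eps <=
   (expR (- (m%:R * (c - del))))%:E)%E.
Proof.
move=> eps0 del0.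
have [B [B0 fB']] : exists B, 0 <= B /\ forall x, `|f x| <= B by exists Bf.
have [e e0 he] := cond q3 q4 k0.
have [eta1 eta10 heta1] := soft_pert e0 G_herm.
(* The first bound keeps 1 + t G inside the neighbourhood of Axiom Q.IV for |t| <= eta, the second
   keeps it positive. *)
pose eta := Num.min eta1 (B + 1)^-1.
have eta0 : 0 < eta by rewrite lt_min eta10 invr_gt0 /=; lra.
have etaB : eta * B <= 1.
  apply: (@le_trans _ _ ((B + 1)^-1 * B)).
    by apply: ler_wpM2r => //; rewrite /eta ge_min lexx orbT.
  by rewrite mulrC ler_pdivrMr ?mul1r; lra.
have soft_eta t : `|t| <= eta -> soft e (1%:M + t%:C%C *: G : Op R d k).
  by move=> ht; apply: heta1; apply: le_trans ht _; rewrite /eta ge_min lexx.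
pose V := 8 * (B + eta^-1) ^+ 2.
have V0 : 0 <= V by rewrite mulr_ge0 ?sqr_ge0.
have [N hN] := nat_above (2 * V / (eps * del ^+ 2)).
exists N.+1 => m r Jm m0 r0.
have mJk0 : (0 < (m + N.+1) * k)%N by rewrite muln_gt0 k0 addnS.
set T := @block_test R d k X M f (c - 1 + h) G m N.+1 eta del.
have T0 : psdm T by apply: (block_test_psd (c - 1 + h) M0 M1 defG fB' eta0 etaB del).
have T1 : psdm (1%:M - T) by apply: (block_test_psdC (c - 1 + h) M0 M1 defG fB' eta0 etaB del).
apply: (@beta_le _ _ _ _ _ _ _ (tens (twirl T) 1%:M)).
- by apply: tens_psd; [exact: twirl_psd|exact: psd1].
- rewrite -tens_11 -tensBl -(@twirl_1 _ _ ((m + N.+1) * k)) -twirlB.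
  by apply: tens_psd; [exact: twirl_psd|exact: psd1].
- move=> rho hr.
  have Ar := ptr_mem dA q4 mJk0 r0 hr.
  rewrite -tens_11 -tensBl -(@twirl_1 _ _ ((m + N.+1) * k)) -twirlB trr_ptr -trr_twirl.
  set rho' := twirl _.
  have Ar' : A ((m + N.+1) * k)%N rho' by apply: twirl_mem => //; exact: cA.
  have := block_test_typeI dA k0 M0 M1 defG G_ge B0 fB' eta0 etaB m0 (ltn0Sn N) e0 he soft_eta Ar'
    (@twirl_perminv _ _ _ _) del0.
  rewrite -/T -/V => h1.
  have d2 : 0 < del ^+ 2 by rewrite exprn_gt0.
  rewrite -(ler_pM2l d2); apply: le_trans h1 _.
  have mN : m%:R^-1 <= (N.+1)%:R^-1 :> R by rewrite lef_pV2 ?posrE ?ltr0n // ler_nat.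
  have hN1 : 2 * V / (eps * del ^+ 2) <= N.+1%:R by apply: hN; exact: leqnSn.
  apply: (@le_trans _ _ (V * (2 * N.+1%:R^-1))); first by apply: ler_wpM2l => //; rewrite mulr_natl mulr2n lerD2r.
  rewrite mulrA ler_pdivrMr ?ltr0n //.
  by move: hN1; rewrite ler_pdivrMr ?mulr_gt0 //; lra.
- move=> _ [s hs <-]; have ds := dS hs.
  rewrite ipow_tens trr_tens; [|exact: dens_psd (dens_ipow _ ds)|exact: twirl_psd].
  rewrite trr1; have [_ ->] := dens_ipow r ds; rewrite mulr1.
  rewrite -trr_twirl twirl_id; last exact: ipow_perminv.
  apply: le_trans (block_test_typeII (c - 1 + h) M0 M1 defG defH fB' N.+1 eta0 etaB m0 del ds) _.
  have hh : trr (ipow k s) H ^+ m <= expR (m%:R * ln h).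
    rewrite expRM_natl lnK ?posrE // lerXn2r ?nnegrE ?(ltW h0) //; last exact: le_h.
    exact/ltW/H_pos.
  apply: le_trans (ler_wpM2l (expR_ge0 _) hh) _.
  rewrite -expRD ler_expR -mulrN -mulrDr -mulrN; apply: ler_wpM2l; first exact: ler0n.
  have := ln_ge (x := h^-1); rewrite invr_gt0 invrK lnV // => /(_ h0); lra.
Qed.

(** Half of del is spent in the block test, the other half pays for the at most J + 1 blocks of
    systems that do not contribute to the exponent. *)
Lemma stein_lower (eps del : R) : 0 < eps -> 0 < del -> del < c ->
  (\forall n \near \oo, ((c - del) / k%:R)%:E <= stein_seq A (iid S) eps n)%E.
Proof.
move=> eps0 del0 delc; have d20 : 0 < del / 2 by lra.
have [J hJ] := block_bound eps0 d20.
have [N hN] := nat_above (2 * ((J.+1)%:R * k%:R * (c - del / 2)) / del).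
exists (maxn N ((J + J + 2) * k + 2)) => // n /= hn.
have hn1 : (N <= n)%N by apply: leq_trans hn; exact: leq_maxl.
have hn2 : ((J + J + 2) * k + 2 <= n)%N by apply: leq_trans hn; exact: leq_maxr.
have [m [r [en Jm m0 r0 nle]]] := nat_blocks k0 hn2.
have n0 : (0 < n)%N by rewrite en addn_gt0 r0 orbT.
have hb := hJ m r Jm m0 r0; rewrite -en in hb.
have := mlog_ge hb; rewrite /stein_seq => hm.
apply: (@le_trans _ _ ((n%:R^-1)%:E * (m%:R * (c - del / 2))%:E)%E); last first.
  by apply: lee_wpmul2l => //; rewrite lee_fin invr_ge0 ler0n.
rewrite -EFinM lee_fin.
have kR : 0 < k%:R :> R by rewrite ltr0n.
have nR : 0 < n%:R :> R by rewrite ltr0n.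
rewrite [leRHS]mulrC ler_pdivlMr // mulrAC ler_pdivrMr //.
have h1 : n%:R <= m%:R * k%:R + (J.+1)%:R * k%:R :> R.
  by rewrite -!natrM -natrD ler_nat.
have h2 := hN n hn1; rewrite ler_pdivrMr // in h2.
have cd : 0 <= c - del / 2 by lra.
have h3 := ler_wpM2r cd h1.
set mk := m%:R * k%:R in h1 h3; rewrite mulrAC -/mk.
by rewrite mulrDl in h3; exact: half_margin h2 h3.
Qed.
End Setup.
End SteinLower.

Lemma sum_continuous (R : realType) (T : topologicalType) I (r : seq I) (F : I -> T -> R) :
  (forall i, continuous (F i)) -> continuous (fun x => \sum_(i <- r) F i x).
Proof.
move=> cF; elim: r => [|i r ih].
  by have -> : (fun x => \sum_(i <- [::]) F i x) = (fun=> 0); [apply/funext => x; rewrite big_nil|move=> x; exact: cvg_cst].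
have -> : (fun x => \sum_(j <- i :: r) F j x) = F i + (fun x => \sum_(j <- r) F j x).
  by apply/funext => x; rewrite big_cons.
by move=> x; apply: (@continuousD R R^o); [exact: cF|exact: ih].
Qed.

(** * Minimax duality *)

Section Minimax.
Variables (R : realType) (D : nat).
Local Notation V := 'rV[R]_D.

Definition aff (b : R) (y : 'cV[R]_D) (v : V) : R := b + (v *m y) 0 0.

Lemma aff_continuous b y : continuous (aff b y).
Proof.
have -> : aff b y = (fun v => b + \sum_q v ord0 q * y q 0).
  by apply/funext => v; rewrite /aff mxE.
have cs : continuous (fun v : V => \sum_q v ord0 q * y q 0).
  apply: sum_continuous => q v.
  apply: (@continuous_comp _ _ _ (fun v : V => v ord0 q) ( *%R^~ (y q 0))).
    exact: coord_continuous.
  exact: mulrr_continuous.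
move=> v; apply: (@continuousD R R^o _ (fun=> b) (fun v : V => \sum_q v ord0 q * y q 0)).
  exact: cst_continuous.
exact: cs.
Qed.

Lemma aff_seg b y (v v' : V) (t : R) :
  aff b y (v + t *: (v' - v)) = aff b y v + t * (aff b y v' - aff b y v).
Proof.
rewrite /aff mulmxDl -scalemxAl mulmxBl.
have -> : (v *m y + t *: (v' *m y - v *m y)) 0 0 =
  (v *m y) 0 0 + t * ((v' *m y) 0 0 - (v *m y) 0 0) by rewrite !mxE.
ring.
Qed.

Variable X : set V.
Hypothesis Xc : compact X.
Hypothesis X0 : X !=set0.
Hypothesis Xconv : forall v v' t, X v -> X v' -> 0 <= t <= 1 -> X (v + t *: (v' - v)).

(* The weights are the positive parts at a minimiser of the sum of their squares; the claimed
   inequality is the first-order optimality condition there. *)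
Lemma minimax_fin (N : nat) (b : 'I_N -> R) (y : 'I_N -> 'cV[R]_D) (c : R) :
  (forall v, X v -> exists i, c < aff (b i) (y i) v) ->
  exists w : 'I_N -> R, [/\ forall i, 0 <= w i, \sum_i w i = 1 &
    forall v, X v -> c <= \sum_i w i * aff (b i) (y i) v].
Proof.
move=> hX; pose z i v := aff (b i) (y i) v.
pose p i v := Num.max (z i v - c) 0.
pose psi v := \sum_i p i v * p i v.
have cpsi : continuous psi.
  apply: sum_continuous => i v.
  have cp : {for v, continuous (p i)}.
    apply: (@continuous_max _ _ (fun v => z i v - c) (fun=> 0)); last exact: cst_continuous.
    by apply: (@continuousB R R^o _ (z i) (fun=> c)); [exact: aff_continuous|exact: cst_continuous].
  exact: (continuousM cp cp).
have [v0 v0X hmin] := compact_EVT_min X0 Xc (continuous_subspaceT cpsi).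
rewrite inE in v0X.
have p0 i v : 0 <= p i v by rewrite /p le_max lexx orbT.
have pz i v : z i v - c <= p i v by rewrite /p le_max lexx.
have key v : X v -> 0 <= \sum_i p i v0 * (z i v - z i v0).
  move=> vX; set A1 := \sum_i _; pose A2 := \sum_i (z i v - z i v0) ^+ 2.
  have A20 : 0 <= A2 by apply: sumr_ge0 => i _; exact: sqr_ge0.
  have ht t : 0 < t <= 1 -> 0 <= 2 * A1 + t * A2.
    move=> /andP[t0 t1]; have vt := Xconv v0X vX (t := t).
    have {}vt : X (v0 + t *: (v - v0)) by apply: vt; rewrite (ltW t0).
    have h1 := hmin _ (mem_set vt).
    (* No derivative is taken: since z - c <= p, the positive part at the moved point is bounded in
       absolute value by p + t (z(v) - z(v0)), whose square is quadratic in t. *)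
    have h2 : psi (v0 + t *: (v - v0)) <= psi v0 + t * (2 * A1 + t * A2).
      have -> : psi v0 + t * (2 * A1 + t * A2) = \sum_i (p i v0 + t * (z i v - z i v0)) ^+ 2.
        rewrite /psi /A1 /A2 !mulr_sumr -big_split mulr_sumr -big_split /=.
        by apply: eq_bigr => i _; ring.
      apply: ler_sum => i _; rewrite -expr2 {1}/p {1}/z aff_seg -/(z i v) -/(z i v0).
      have := pz i v0; set d := z i v - z i v0; set e := p i v0 => hp.
      rewrite maxEle; case: ifP => hc; first by rewrite expr0n sqr_ge0.
      move/negbT: hc; rewrite -ltNge => hc.
      rewrite !expr2; apply: ler_pM; lra.
    have := le_trans h1 h2; rewrite lerDl pmulr_rge0 //.
  rewrite leNgt; apply/negP => An.
  (* If A1 were negative, this step length would give t A2 <= - A1 and thus 2 A1 + t A2 <= A1 <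
     0. *)
  pose t := Num.min 1 (- A1 / (A2 + 1)).
  have tpos : 0 < t by rewrite lt_min ltr01 divr_gt0 //; lra.
  have t1 : t <= 1 by rewrite ge_min lexx.
  have t2 : t * A2 <= - A1.
    apply: (@le_trans _ _ (- A1 / (A2 + 1) * A2)).
      by apply: ler_wpM2r => //; rewrite ge_min lexx orbT.
    rewrite mulrAC ler_pdivrMr; last lra.
    by apply: ler_wpM2l; lra.
  have := ht t; rewrite tpos t1 => /(_ isT); lra.
pose S := \sum_i p i v0.
have S0 : 0 < S.
  have [i hi] := hX _ v0X.
  rewrite /S (bigD1 i) //= ltr_pwDl ?sumr_ge0 //.
  by rewrite /p lt_max subr_gt0 hi.
exists (fun i => p i v0 / S); split.
- by move=> i; rewrite divr_ge0 // ltW.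
- by rewrite -mulr_suml divff // gt_eqF.
- move=> v vX; have hk := key v vX.
  have -> : \sum_i p i v0 / S * aff (b i) (y i) v = (\sum_i p i v0 * z i v) / S.
    by rewrite mulr_suml; apply: eq_bigr => i _; rewrite mulrAC.
  rewrite ler_pdivlMr //.
  (* At the minimiser only indices with z >= c carry weight, so p (z - c) >= 0 there; optimality
     ([key]) carries the bound over to v. *)
  apply: (@le_trans _ _ (\sum_i p i v0 * z i v0)).
    rewrite /S mulr_sumr; apply: ler_sum => i _; rewrite mulrC.
    have : 0 <= p i v0 * (z i v0 - c).
      by rewrite /p maxEle; case: ifP => h; rewrite ?mul0r // -expr2 sqr_ge0.
    by rewrite mulrBr subr_ge0.
  move: hk; under eq_bigr do rewrite mulrBr.
  by rewrite sumrB subr_ge0.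
Qed.

(** The open sets on which the individual functions exceed c cover the compact set X; a finite
    subcover reduces the claim to [minimax_fin]. *)
Lemma minimax (T : choiceType) (K : set T) (b : T -> R) (y : T -> 'cV[R]_D) (c : R) :
  (forall v, X v -> exists2 k, K k & c < aff (b k) (y k) v) ->
  exists N (s : 'I_N -> T) (w : 'I_N -> R),
    [/\ forall i, K (s i), forall i, 0 <= w i, \sum_i w i = 1 &
    forall v, X v -> c <= \sum_i w i * aff (b (s i)) (y (s i)) v].
Proof.
move=> h; move: Xc; rewrite compact_cover => cov.
have op k : K k -> open (aff (b k) (y k) @^-1` [set r | c < r]).
  move=> _; apply: open_comp; last exact: open_gt.
  by move=> v _; exact: aff_continuous.
have [F FK hF] := cov T K _ op (fun v vX => let: ex_intro2 k Kk ck := h v vX in ex_intro2 _ _ k Kk ck).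
pose r := finmap.enum_fset F.
have kr v : X v -> exists i : 'I_(size r), c < aff (b (tnth (in_tuple r) i)) (y (tnth (in_tuple r) i)) v.
  move=> /hF[k /= kF ck]; have : k \in r by [].
  move=> /(nth_index k) ek; have ki : (index k r < size r)%N by rewrite index_mem.
  by exists (Ordinal ki); rewrite (tnth_nth k) /= ek.
have [w [w0 w1 hw]] := minimax_fin kr.
exists (size r), (tnth (in_tuple r)), w; split => // i.
by have := FK (tnth (in_tuple r) i); rewrite inE; apply; exact: mem_tnth.
Qed.
End Minimax.

(** * Operators as real vectors *)

Section Encoding.
Variables (R : realType) (N : nat).
Local Notation C := (R[i]).
Local Notation M := 'M[C]_N.

Definition cidx : finType := (bool * ('I_N * 'I_N))%type.
Definition cdim := #|cidx|.

Definition part (X : M) (p : cidx) : R :=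
  if p.1 then complex.Im (X p.2.1 p.2.2) else complex.Re (X p.2.1 p.2.2).
Definition enc (X : M) : 'rV[R]_cdim := \row_q part X (enum_val q).
Definition dec (v : 'rV[R]_cdim) : M :=
  \matrix_(i, j) (v 0 (enum_rank (false, (i, j)) : 'I_cdim) +i* v 0 (enum_rank (true, (i, j)) : 'I_cdim))%C.

Lemma encK : cancel enc dec.
Proof.
move=> X; apply/matrixP => i j; rewrite !mxE !enum_rankK /part /=.
by case: (X i j).
Qed.

Lemma decK : cancel dec enc.
Proof.
move=> v; apply/rowP => q; rewrite !mxE.
by rewrite -[in RHS](enum_valK q); case: (enum_val q) => [[] [i j]]; rewrite /part /= ?mxE.
Qed.

Lemma encD X Y : enc (X + Y) = enc X + enc Y.
Proof. by apply/rowP => q; rewrite !mxE /part !mxE; case: ifP; rewrite ?ReD ?ImD. Qed.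
Lemma encZ (a : R) X : enc (a%:C%C *: X) = a *: enc X.
Proof. by apply/rowP => q; rewrite !mxE /part !mxE; case: ifP; rewrite ?ReZ ?ImZ. Qed.
Lemma decD u v : dec (u + v) = dec u + dec v.
Proof. by apply: (can_inj encK); rewrite encD !decK. Qed.
Lemma decZ (a : R) v : dec (a *: v) = a%:C%C *: dec v.
Proof. by apply: (can_inj encK); rewrite encZ !decK. Qed.
Lemma encB X Y : enc (X - Y) = enc X - enc Y.
Proof.
have -> : X - Y = X + (-1)%:C%C *: Y by rewrite rmorphN rmorph1 scaleN1r.
by rewrite encD encZ scaleN1r.
Qed.
Lemma enc_sum I (r : seq I) (F : I -> M) : enc (\sum_(i <- r) F i) = \sum_(i <- r) enc (F i).
Proof.
apply: (big_morph enc encD); by apply/rowP => q; rewrite !mxE /part !mxE; case: ifP.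
Qed.

Lemma enc_close (X Y : M) (e : R) : (forall i j, `|X i j - Y i j| < e%:C%C) ->
  forall q, `|enc X 0 q - enc Y 0 q| < e.
Proof.
move=> h q; rewrite !mxE /part; set p := enum_val q; have hp := h p.2.1 p.2.2.
case: p.1; first by have := lt_norm_Im hp; rewrite ImD ImN.
by have := lt_norm_Re hp; rewrite ReD ReN.
Qed.

Lemma dec_close (u v : 'rV[R]_cdim) (e : R) : (forall q, `|u 0 q - v 0 q| < e / 2) ->
  forall i j, `|dec u i j - dec v i j| < e%:C%C.
Proof.
move=> h i j; apply: norm_lt_ReIm; rewrite !mxE !(ReD, ImD, ReN, ImN) /=.
have := h (enum_rank (false, (i, j))); have := h (enum_rank (true, (i, j))); lra.
Qed.

Lemma entry_delta (X : M) i j :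
  ((delta_mx 0 i : 'rV[C]_N) *m X *m adj (delta_mx 0 j : 'rV[C]_N)) 0 0 = X i j.
Proof. by rewrite adj_delta -rowE -colE !mxE. Qed.

(** Positivity on e_i + a e_j with a = 1, -1, i, -i bounds both parts of X_ij by (X_ii + X_jj)/2. *)
Lemma dens_entry (X : M) : dens' X -> forall i j, `|complex.Re (X i j)| <= 1 /\ `|complex.Im (X i j)| <= 1.
Proof.
move=> [hX tX] i j.
have qf (a : C) : 0 <= complex.Re (X i i) + nsq a * complex.Re (X j j)
     + complex.Re (conjC a * X i j) + complex.Re (a * X j i).
  have := hX (delta_mx 0 i + a *: delta_mx 0 j); rewrite ge0c => /andP[_].
  rewrite adjD adjZ !(mulmxDl, mulmxDr) -!scalemxAl -!scalemxAr.
  have addE (P Q : 'M[C]_1) : (P + Q) 0 0 = P 0 0 + Q 0 0 by rewrite mxE.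
  have scaleE b (P : 'M[C]_1) : (b *: P) 0 0 = b * P 0 0 by rewrite mxE.
  rewrite !(addE, scaleE) !entry_delta !ReD mulrA mul_conj ReZ.
  by move=> h; apply: le_trans h _; rewrite le_eqVlt; apply/orP; left; apply/eqP; ring.
have hh := psd_herm hX.
have eji : X j i = conjC (X i j) by rewrite -adjE hh.
have dg0 l : 0 <= complex.Re (X l l).
  by have := hX (delta_mx 0 l); rewrite entry_delta ge0c => /andP[_].
have dg1 l : complex.Re (X l l) <= 1.
  by rewrite -tX /mxtrace Re_sum (bigD1 l) //= lerDl sumr_ge0.
have := qf 1; have := qf (-1); have := qf 'i%C; have := qf (- 'i%C).
rewrite eji !(ReM, ImM, ReN, ImN, Re_conj, Im_conj) /nsq /=.
have := dg1 i; have := dg1 j; have := dg0 i; have := dg0 j.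
rewrite !ler_norml => *; split; lra.
Qed.
End Encoding.

(** * Entrywise closures and compactness *)

Section Closure.
Variables (R : realType) (d n : nat).
Local Notation C := (R[i]).
Local Notation N := #|Idx d n|.

Definition clS (S : set (Op R d n)) : set (Op R d n) :=
  [set X | forall e : R, 0 < e -> exists2 Y, S Y & forall i j, `|X i j - Y i j| < (e%:C)%C].

Lemma clS_sub S : S `<=` clS S.
Proof. by move=> X SX e e0; exists X => // i j; rewrite subrr normr0 ltcR. Qed.

Lemma clS_closed S : closedS (clS S).
Proof.
move=> X hX e e0; have e2 : 0 < e / 2 by lra.
have [Y hY h1] := hX _ e2; have [Z SZ h2] := hY _ e2.
exists Z => // i j; have -> : X i j - Z i j = (X i j - Y i j) + (Y i j - Z i j) by rewrite addrA subrK.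
apply: le_lt_trans (ler_normD _ _) _.
have -> : e%:C%C = (e / 2)%:C%C + (e / 2)%:C%C :> C by rewrite -rmorphD -splitr.
exact: ltrD.
Qed.

Lemma clS_conv S : convexS S -> convexS (clS S).
Proof.
move=> cS X Y t hX hY t01 e e0.
have [X' SX h1] := hX _ e0; have [Y' SY h2] := hY _ e0.
exists (t%:C%C *: X' + (1 - t)%:C%C *: Y'); first exact: cS.
have /andP[t0 t1] := t01.
have t1' : 0 <= 1 - t by lra.
move=> i j.
have -> : (t%:C%C *: X + (1 - t)%:C%C *: Y) i j - (t%:C%C *: X' + (1 - t)%:C%C *: Y') i j =
   t%:C%C * (X i j - X' i j) + (1 - t)%:C%C * (Y i j - Y' i j).
  rewrite [X in X - _]mxE [X in _ - X]mxE !mxE; ring.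
apply: le_lt_trans (ler_normD _ _) _; rewrite !normrM.
have nt (s : R) : 0 <= s -> `|s%:C%C| = s%:C%C :> C by move=> s0; rewrite ger0_norm // ler0c.
rewrite !nt //.
have [->|tn] := eqVneq t 0.
  by rewrite mul0r add0r subr0 mul1r.
have tpos : 0 < t by rewrite lt_neqAle eq_sym tn.
have -> : e%:C%C = t%:C%C * e%:C%C + (1 - t)%:C%C * e%:C%C :> C.
  by rewrite -mulrDl -rmorphD addrC subrK rmorph1 mul1r.
apply: ltr_leD; first by rewrite ltr_pM2l // ltcR.
by apply: ler_wpM2l; [rewrite ler0c|apply: ltW].
Qed.

Definition pairset (S1 S2 : set (Op R d n)) : set 'rV[R]_(cdim N + cdim N) :=
  [set v | S1 (dec (lsubmx v)) /\ S2 (dec (rsubmx v))].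

(** Entries of states are bounded by 1; the bound 2 leaves a margin that a point of a closure
    obtains from any state within distance 1. *)
Lemma pairset_compact S1 S2 : closedS S1 -> closedS S2 ->
  (forall X q, S1 X -> `|enc X 0 q| <= 2) -> (forall X q, S2 X -> `|enc X 0 q| <= 2) ->
  compact (pairset S1 S2).
Proof.
move=> c1 c2 b1 b2.
apply: (@subclosed_compact _ _ [set v : 'rV[R]_(cdim N + cdim N) | forall q, `[- 2, 2]%classic (v ord0 q)]).
- rewrite closure_id; apply/seteqP; split; first exact: subset_closure.
  move=> v hv.
  have near e : 0 < e -> exists2 u, pairset S1 S2 u & forall q, `|v 0 q - u 0 q| < e.
    move=> e0; have := hv _ (nbhsx_ballx v e e0) => -[u [hu [_ bu]]].
    by exists u => // q; exact: bu.
  split.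
    apply: c1 => e e0; have e2 : 0 < e / 2 by lra.
    have [u [h1 h2] h] := near _ e2; exists (dec (lsubmx u)) => //.
    by apply: dec_close => q; rewrite !mxE; exact: h.
  apply: c2 => e e0; have e2 : 0 < e / 2 by lra.
  have [u [h1 h2] h] := near _ e2; exists (dec (rsubmx u)) => //.
  by apply: dec_close => q; rewrite !mxE; exact: h.
- have := @rV_compact R (cdim N + cdim N) (fun=> `[- 2, 2]%classic); apply => _.
  exact: segment_compact.
- move=> v [h1 h2] q /=; rewrite in_itv /= -ler_norml.
  case: (splitP q) => [a ea|a ea].
    have -> : v ord0 q = enc (dec (lsubmx v)) 0 a.
      by rewrite decK mxE; congr (v _ _); apply: val_inj.
    exact: b1.
  have -> : v ord0 q = enc (dec (rsubmx v)) 0 a.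
    by rewrite decK mxE; congr (v _ _); apply: val_inj.
  exact: b2.
Qed.
End Closure.

(** * Duality between measurements with scores and pairs of states *)

Section Achievable.
Variables (R : realType) (d k : nat).
Local Notation C := (R[i]).
Local Notation op := (Op R d k).

(* Triples (a I, G, H) with G = sum f M, H = sum e^f M over positive operators M with sum a I;
   they form a convex cone. *)
Definition achv (a : R) (G H : op) := exists (n : nat) (M : 'I_n -> op) (f : 'I_n -> R),
  [/\ forall x, psdm (M x), \sum_x M x = a%:C%C *: 1%:M,
      G = \sum_x (f x)%:C%C *: M x & H = \sum_x (expR (f x))%:C%C *: M x].

Lemma achv0 : achv 0 0 0.
Proof.
exists 0%N, (fun=> 0), (fun=> 0); split; rewrite ?big_ord0 ?scale0r //.
by move=> x; exact: psd0.
Qed.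

(** The outcome sets are juxtaposed. Since the exponential acts on each outcome separately, G and H
    are both additive, although H is not a function of G. *)
Lemma achvD a b G H G' H' : achv a G H -> achv b G' H' -> achv (a + b) (G + G') (H + H').
Proof.
move=> [n [M [f [h1 h2 -> ->]]]] [n' [M' [f' [h1' h2' -> ->]]]].
exists (n + n')%N, (fun i => match fintype.split i with inl x => M x | inr x => M' x end),
  (fun i => match fintype.split i with inl x => f x | inr x => f' x end).
have sL (x : 'I_n) : fintype.split (lshift n' x) = inl x by rewrite -[lshift _ _]/(unsplit (inl _)) unsplitK.
have sR (x : 'I_n') : fintype.split (rshift n x) = inr x by rewrite -[rshift _ _]/(unsplit (inr _)) unsplitK.
split.
- by move=> x; case: (fintype.split x).
- rewrite big_split_ord /= rmorphD scalerDl -h2 -h2'; congr (_ + _); apply: eq_bigr => i _;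
    by rewrite ?sL ?sR.
- by rewrite big_split_ord /=; congr (_ + _); apply: eq_bigr => i _; rewrite ?sL ?sR.
- by rewrite big_split_ord /=; congr (_ + _); apply: eq_bigr => i _; rewrite ?sL ?sR.
Qed.

Lemma achvZ w a G H : 0 <= w -> achv a G H -> achv (w * a) (w%:C%C *: G) (w%:C%C *: H).
Proof.
move=> w0 [n [M [f [h1 h2 -> ->]]]]; exists n, (fun i => w%:C%C *: M i), f; split.
- by move=> x; exact: psdZ.
- by rewrite -scaler_sumr h2 scalerA rmorphM.
- by rewrite scaler_sumr; apply: eq_bigr => i _; rewrite !scalerA mulrC.
- by rewrite scaler_sumr; apply: eq_bigr => i _; rewrite !scalerA mulrC.
Qed.

Lemma achv_sum (I : finType) (w : I -> R) (G H : I -> op) :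
  (forall i, 0 <= w i) -> (forall i, achv 1 (G i) (H i)) ->
  achv (\sum_i w i) (\sum_i (w i)%:C%C *: G i) (\sum_i (w i)%:C%C *: H i).
Proof.
move=> w0 h.
elim: (index_enum I) => [|i r ih]; first by rewrite !big_nil; exact: achv0.
rewrite !big_cons; apply: achvD => //.
by have := achvZ (w0 i) (h i); rewrite mulr1.
Qed.

(** [minimax] returns weights on finitely many pairs (G, H). Performing one of the measurements at
    random with these weights is again a single measurement with scores, so the weighted pair is
    achievable. *)
Lemma povm_minimax (S1 S2 : set op) (c : R) :
  closedS S1 -> closedS S2 -> convexS S1 -> convexS S2 -> S1 !=set0 -> S2 !=set0 ->
  (forall X q, S1 X -> `|enc X 0 q| <= 2) -> (forall X q, S2 X -> `|enc X 0 q| <= 2) ->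
  (forall r w, S1 r -> S2 w -> exists G H, achv 1 G H /\ c < trr r G - trr w H + 1) ->
  exists G H, achv 1 G H /\ forall r w, S1 r -> S2 w -> c <= trr r G - trr w H + 1.
Proof.
move=> cl1 cl2 cv1 cv2 [r0 hr0] [w0 hw0] b1 b2 h.
pose P := pairset S1 S2.
pose lin (GH : op * op) (v : 'rV[R]_(cdim #|Idx d k| + cdim #|Idx d k|)) : R :=
  trr (dec (lsubmx v)) GH.1 - trr (dec (rsubmx v)) GH.2.
have linD GH u v : lin GH (u + v) = lin GH u + lin GH v.
  rewrite /lin (linearD lsubmx) (linearD rsubmx) !decD !trrDl.
  by rewrite opprD addrACA.
have linZ GH a v : lin GH (a *: v) = a * lin GH v.
  by rewrite /lin !linearZ /= !decZ !trrZl; ring.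
pose y GH : 'cV[R]_(cdim #|Idx d k| + cdim #|Idx d k|) := \col_q lin GH (delta_mx 0 q).
have yE GH v : (v *m y GH) 0 0 = lin GH v.
  rewrite [in RHS](row_sum_delta v) mxE.
  rewrite (big_morph (lin GH) (linD GH) (id1 := 0)); last first.
    by rewrite -[X in lin GH X](scale0r (0 : 'rV[R]_(cdim #|Idx d k| + cdim #|Idx d k|))) linZ mul0r.
  by apply: eq_bigr => q _; rewrite linZ mxE.
have affE GH v : aff 1 (y GH) v = trr (dec (lsubmx v)) GH.1 - trr (dec (rsubmx v)) GH.2 + 1.
  by rewrite /aff yE addrC.
have Pc : compact P by exact: pairset_compact.
have P0 : P !=set0.
  by exists (row_mx (enc r0) (enc w0)); rewrite /P /pairset /= row_mxKl row_mxKr !encK.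
have seg (S : set op) u v t : convexS S -> S (dec u) -> S (dec v) -> 0 <= t <= 1 -> S (dec (u + t *: (v - u))).
  move=> cS hu hv t01; have := cS _ _ _ hv hu t01; congr (S _).
  apply: (can_inj (@encK _ _)); rewrite encD !encZ !decK scalerBl scale1r scalerBr addrC -!addrA.
  by congr (_ + _); rewrite addrC.
have Pcv v v' t : P v -> P v' -> 0 <= t <= 1 -> P (v + t *: (v' - v)).
  move=> [h1 h2] [h1' h2'] t01; split; rewrite linearD linearZ linearB /=; exact: seg.
have [v hv|n [s [w [sK w0' w1 hw]]]] :=
  @minimax _ _ P Pc P0 Pcv (op * op)%type [set GH | achv 1 GH.1 GH.2] (fun=> 1) y c.
  have [h1 h2] := hv; have [G [H [aGH hc]]] := h _ _ h1 h2.
  by exists (G, H) => //; rewrite affE.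
exists (\sum_i (w i)%:C%C *: (s i).1), (\sum_i (w i)%:C%C *: (s i).2); split.
  by rewrite -w1; apply: achv_sum => // i; exact: sK.
move=> r om hr hom; pose v := row_mx (enc r) (enc om).
have Pv : P v by rewrite /P /pairset /= row_mxKl row_mxKr !encK.
apply: le_trans (hw v Pv) _; rewrite le_eqVlt; apply/orP; left; apply/eqP.
under eq_bigr do rewrite affE /v row_mxKl row_mxKr !encK mulrDr mulrBr mulr1.
rewrite big_split sumrB /= w1 !trr_sumr; congr (_ - _ + _); apply: eq_bigr => i _; by rewrite trrZr.
Qed.
End Achievable.

(** * Domination up to a small multiple of a fixed state *)

Section Domination.
Variables (R : realType) (d n : nat).
Local Notation C := (R[i]).
Local Notation N := #|Idx d n|.
Variable Q : set (Op R d n).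
Hypothesis Q0 : Q !=set0.
Hypothesis Qpsd : forall X, Q X -> psdm X.
Hypothesis Qconv : convexS Q.

Let bas r (s : 'I_r -> Op R d n) : 'M[R]_(r, cdim N) := \matrix_i enc (s i).

(** A longest linearly independent family in [Q]; its length is bounded by the real dimension. *)
Lemma spanning_family : exists r (s : 'I_r -> Op R d n), (forall i, Q (s i)) /\
  forall X, Q X -> (enc X <= bas s)%MS.
Proof.
pose P r := `[< exists s : 'I_r -> Op R d n, (forall i, Q (s i)) /\ row_free (bas s) >].
have P0 : exists r, P r.
  exists 0%N; apply/asboolP; have [q0 _] := Q0; exists (fun=> q0); split; first by case.
  by rewrite /row_free flatmx0 mxrank0.
have Pb r : P r -> (r <= cdim N)%N.
  by move=> /asboolP[s [_ /eqP <-]]; exact: rank_leq_col.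
have [r /asboolP[s [sQ /eqP sfree]] rmax] := ex_maxnP P0 Pb.
exists r, s; split => // X QX; apply/negPn/negP => nX.
have : P (1 + r)%N.
  apply/asboolP; pose s' (i : 'I_(1 + r)) := match fintype.split i with inl _ => X | inr j => s j end.
  exists s'; split; first by move=> i; rewrite /s'; case: (fintype.split i).
  have -> : bas s' = col_mx (enc X) (bas s).
    apply/matrixP => i j; rewrite [LHS]mxE /s' [RHS]mxE; case: (fintype.split i) => a.
      by rewrite (ord1 a).
    by rewrite [RHS]mxE.
  have lt_rank : (\rank (bas s) < \rank (col_mx (enc X) (bas s)))%N.
    by apply: rank_ltmx; rewrite ltmxE col_mx_sub (negbTE nX) andbT -addsmxE addsmxSr.
  rewrite /row_free eqn_leq rank_leq_row /=.
  by rewrite sfree in lt_rank.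
by move=> /rmax; rewrite add1n ltnn.
Qed.

Lemma enc_mul_bound (v : 'rV[R]_(cdim N)) m (K : 'M[R]_(cdim N, m)) (e : R) j :
  (forall q, `|v 0 q| < e) -> `|(v *m K) 0 j| <= e * \sum_q \sum_l `|K q l|.
Proof.
move=> h; rewrite mxE; apply: le_trans (ler_norm_sum _ _ _) _.
rewrite mulr_sumr; apply: ler_sum => q _; rewrite normrM.
apply: ler_pM => //; first exact: ltW.
by rewrite (bigD1 j) //= lerDl sumr_ge0.
Qed.

(** Closeness in norm does not give an operator inequality when supports are deficient. Here X - Y
    lies in the span of a family from [Q] with small coefficients, and t is the uniform average of
    that family and one extra member [q0], so eta t outweighs every coefficient. *)
Lemma domination : exists2 t, Q t & forall eta : R, 0 < eta -> exists2 del : R, 0 < del &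
  forall X Y, clS Q X -> Q Y -> (forall i j, `|X i j - Y i j| < del%:C%C) ->
  psdm (Y + eta%:C%C *: t - X).
Proof.
have [r [s [sQ sspan]]] := spanning_family.
have [q0 hq0] := Q0.
set B := bas s in sspan.
have clspan X : clS Q X -> (enc X <= B)%MS.
  move=> hX; rewrite submxE; apply/eqP/rowP => j; rewrite [RHS]mxE.
  apply/eqP; rewrite -normr_eq0 eq_le normr_ge0 andbT; apply/ler_addgt0Pl => e e0.
  rewrite addr0; set K := cokermx B; pose L := \sum_q \sum_l `|K q l|.
  have L0 : 0 <= L by do 2!(apply: sumr_ge0 => ? _).
  have e1 : 0 < e / (L + 1) by rewrite divr_gt0 //; lra.
  have [Y QY hY] := hX _ e1.
  have -> : (enc X *m K) 0 j = ((enc X - enc Y) *m K) 0 j.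
    have /eqP : enc Y *m K == 0 by rewrite -submxE; exact: sspan.
    by rewrite mulmxBl => ->; rewrite subr0.
  have hq q : `|(enc X - enc Y) 0 q| < e / (L + 1).
    have := enc_close hY q; congr (`|_| < _); by rewrite !mxE.
  apply: le_trans (enc_mul_bound K j hq) _; rewrite -/L mulrAC ler_pdivrMr; last lra.
  by apply: ler_wpM2l; lra.
pose t : Op R d n := \sum_(i < r.+1) (r.+1%:R^-1)%:C%C *: (if unlift ord0 i is Some j then s j else q0).
exists t.
  have := @conv_sum _ _ _ Q _ (fun=> r.+1%:R^-1) (fun i : 'I_r.+1 => if unlift ord0 i is Some j then s j else q0) Qconv.
  apply; first by move=> _; rewrite invr_ge0 ler0n.
    by move=> i; case: unliftP.
  by rewrite sumr_const card_ord -[LHS]mulr_natl mulfV // pnatr_eq0.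
move=> eta eta0; pose K := pinvmx B; pose L := \sum_q \sum_l `|K q l|.
have L0 : 0 <= L by do 2!(apply: sumr_ge0 => ? _).
have r0 : 0 < r.+1%:R :> R by rewrite ltr0n.
exists (eta / r.+1%:R / (L + 1)); first by rewrite !divr_gt0 //; lra.
move=> X Y hX hY hXY; pose c := (enc X - enc Y) *m K.
have hq q : `|(enc X - enc Y) 0 q| < eta / r.+1%:R / (L + 1).
  have := enc_close hXY q; congr (`|_| < _); by rewrite !mxE.
have cb j : `|c 0 j| <= eta / r.+1%:R.
  apply: le_trans (enc_mul_bound K j hq) _; rewrite -/L mulrAC ler_pdivrMr; last lra.
  by apply: ler_wpM2l; [rewrite divr_ge0 // ltW|lra].
have eXY : X - Y = \sum_j (c 0 j)%:C%C *: s j.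
  apply: (can_inj (@encK _ _)); rewrite encB enc_sum.
  have sub : (enc X - enc Y <= B)%MS by rewrite addmx_sub ?clspan // eqmx_opp sspan.
  rewrite -(mulmxKpV sub) -/K -/c mulmx_sum_row; apply: eq_bigr => j _.
  by rewrite encZ rowK.
have -> : Y + eta%:C%C *: t - X = (eta / r.+1%:R)%:C%C *: q0 +
    \sum_j (eta / r.+1%:R - c 0 j)%:C%C *: s j.
  have -> : Y + eta%:C%C *: t - X = eta%:C%C *: t - (X - Y) by rewrite opprB [RHS]addrCA [RHS]addrA.
  rewrite eXY /t scaler_sumr big_ord_recl unlift_none scalerA -rmorphM -addrA; congr (_ + _).
  rewrite -sumrB; apply: eq_bigr => j _.
  by rewrite liftK scalerA -rmorphM -scalerBl -rmorphB.
apply: psdD; first by apply: psdZ; [rewrite divr_ge0 // ltW|exact: Qpsd].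
apply: psd_sum => j _; apply: psdZ; last exact: Qpsd.
by rewrite subr_ge0; apply: le_trans (ler_norm _) (cb j).
Qed.
End Domination.

(** * Pinching *)

Section Pinching.
Variable R : realType.
Local Notation C := (R[i]).

(** W = V adj(U) intertwines the two diagonals: (b_i - a_j) W_ij = 0, hence also h(b_i) W_ij = W_ij
    h(a_j). It lets functions of B be computed in any eigenbasis, not just [spectralmx B]. *)
Lemma spectral_calculus n (U V : 'M[C]_n) (a b : 'I_n -> R) (h : R -> R) : unit2 U -> unit2 V ->
  adj U *m dg a *m U = adj V *m dg b *m V ->
  adj U *m dg (h \o a) *m U = adj V *m dg (h \o b) *m V.
Proof.
move=> [u1 u2] [v1 v2] e; pose W := V *m adj U.
have eV : V = W *m U by rewrite /W -mulmxA u2 mulmx1.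
have eU : adj U = adj V *m W by rewrite /W mulmxA v2 mul1mx.
have comm : dg b *m W = W *m dg a.
  have : V *m (adj U *m dg a *m U) *m adj U = V *m (adj V *m dg b *m V) *m adj U by rewrite e.
  by rewrite !mulmxA v1 mul1mx -[_ *m U *m adj U]mulmxA u1 mulmx1 -[_ *m V *m adj U]mulmxA => ->.
have comm' : dg (h \o b) *m W = W *m dg (h \o a).
  apply/matrixP => i j; rewrite dgMl dgMr.
  have /matrixP/(_ i j) := comm; rewrite dgMl dgMr [in RHS]mulrC => /eqP.
  rewrite -subr_eq0 -mulrBl mulf_eq0 => /orP[|/eqP ->]; last by rewrite mulr0 mul0r.
  by rewrite subr_eq0 => /eqP/complexI /= ->; rewrite mulrC.
by rewrite [in X in _ = _ *m X]eV mulmxA -[_ *m dg _ *m W]mulmxA comm' mulmxA -eU.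
Qed.

Lemma dgZ n (a : R) (f : 'I_n -> R) : a%:C%C *: dg f = dg (fun j => a * f j).
Proof.
apply/matrixP => i j; rewrite [LHS]mxE !dgE.
by case: eqP => _; rewrite ?mulr0n ?mulr0 // !mulr1n rmorphM.
Qed.

Lemma conj_dg n (V : 'M[C]_n) (r : 'rV[C]_n) (q p : 'I_n -> R) : unit2 V ->
  (r *m dg q *m V) *m (adj V *m dg p *m V) *m adj (r *m dg q *m V) =
  r *m dg (fun j => q j * p j * q j) *m adj r.
Proof.
move=> [v1 _].
have e1 (X : 'rV[C]_n) (D : 'M[C]_n) : X *m V *m (adj V *m D *m V) = X *m D *m V.
  by rewrite !mulmxA -[X *m V *m adj V]mulmxA v1 mulmx1.
have e2 (X : 'rV[C]_n) Y : X *m V *m (adj V *m Y) = X *m Y :> 'M[C]_1.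
  by rewrite mulmxA -[X *m V *m adj V]mulmxA v1 mulmx1.
rewrite e1 adjM e2 adjM adj_dg mulmxA -[r *m dg q *m dg p]mulmxA dgM.
by rewrite -[r *m _ *m dg q]mulmxA dgM.
Qed.

Lemma cauchy_sum (I : finType) (x : I -> R) :
  (\sum_i x i) ^+ 2 <= #|I|%:R * \sum_i x i ^+ 2.
Proof.
set S := \sum_i x i; set n : R := #|I|%:R.
have [I0|Ipos] := posnP #|I|.
  have em (F : I -> R) : \sum_i F i = 0 by apply: big_pred0 => i; exact: (card0_eq I0 i).
  by rewrite /S !em expr0n mulr0.
have n0 : 0 < n by rewrite ltr0n.
have : 0 <= \sum_i (n * x i - S) ^+ 2 by apply: sumr_ge0 => i _; exact: sqr_ge0.
have -> : \sum_i (n * x i - S) ^+ 2 = n * (n * (\sum_i x i ^+ 2) - S ^+ 2).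
  have -> : \sum_i (n * x i - S) ^+ 2 =
     \sum_i (n ^+ 2 * x i ^+ 2 - 2 * n * S * x i + S ^+ 2) by apply: eq_bigr => i _; ring.
  rewrite big_split sumrB /= sumr_const -mulr_sumr -mulr_sumr -/S -[S ^+ 2 *+ _]mulr_natl -/n; ring.
by rewrite pmulr_rge0 // subr_ge0.
Qed.

Lemma nsq_sum (I : finType) (x : I -> C) : nsq (\sum_i x i) <= #|I|%:R * \sum_i nsq (x i).
Proof.
rewrite /nsq Re_sum Im_sum big_split mulrDr; apply: lerD; exact: cauchy_sum.
Qed.

Definition qf n (A : 'M[C]_n) (v : 'rV[C]_n) : R := complex.Re ((v *m A *m adj v) 0 0).

Lemma qf_spec n (W : 'M[C]_n) (a : 'I_n -> R) (v : 'rV[C]_n) :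
  qf (adj W *m dg a *m W) v = \sum_l a l * nsq ((v *m adj W) 0 l).
Proof.
have -> : qf (adj W *m dg a *m W) v = complex.Re (((v *m adj W) *m dg a *m adj (v *m adj W)) 0 0).
  by rewrite /qf adjM adjK !mulmxA.
rewrite mxE Re_sum; apply: eq_bigr => l _.
by rewrite dgMr adjE mulrAC mul_conj -rmorphM /= mulrC.
Qed.

Lemma qf_gram n m (B : 'M[C]_(m, n)) (v : 'rV[C]_n) : qf (adj B *m B) v = \sum_l nsq ((v *m adj B) 0 l).
Proof.
have -> : qf (adj B *m B) v = complex.Re (((v *m adj B) *m adj (v *m adj B)) 0 0).
  by rewrite /qf adjM adjK !mulmxA.
by rewrite row_adj_ge0.
Qed.

Lemma qf_sum_le (I : finType) n (A : 'M[C]_n) (x : I -> 'rV[C]_n) : psdm A ->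
  qf A (\sum_i x i) <= #|I|%:R * \sum_i qf A (x i).
Proof.
move=> /psd_root[B ->]; rewrite qf_gram.
have -> : \sum_i qf (adj B *m B) (x i) = \sum_i \sum_l nsq ((x i *m adj B) 0 l).
  by apply: eq_bigr => i _; exact: qf_gram.
rewrite exchange_big /= mulr_sumr; apply: ler_sum => l _.
rewrite mulmx_suml summxE; exact: nsq_sum.
Qed.

Section Pinch.
Variables (n : nat) (A B : 'M[C]_n) (T : nat) (kap c : R).
Hypotheses (dA : dens' A) (dB : dens' B).
Let L : seq R := undup [seq evals B i | i : 'I_n].
Hypothesis LT : (size L <= T)%N.
Hypothesis kap0 : 0 < kap.
(** The measured relative entropy of A with respect to B is at most c - ln kap, in variational form:
    for one measurement with laws p and q, the supremum over f of the left side is D(p||q) + ln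
    kap. *)
Hypothesis var : forall (M : 'I_n -> 'M[C]_n) (f : 'I_n -> R), (forall x, psdm (M x)) ->
  \sum_x M x = 1%:M ->
  trr A (\sum_x (f x)%:C%C *: M x) - kap^-1 * trr B (\sum_x (expR (f x))%:C%C *: M x) + 1 <= c.

Let A0 : psdm A. Proof. by case: dA. Qed.
Let B0 : psdm B. Proof. by case: dB. Qed.
Let U := spectralmx B.
Let uU : unit2 U. Proof. exact: unit2_spectral. Qed.
Let eB : B = adj U *m dg (evals B) *m U. Proof. by have [] := psd_spec B0. Qed.

Let lam (l : 'I_(size L)) : R := L`_l.
Definition eproj (l : 'I_(size L)) : 'M[C]_n := adj U *m dg (fun j => (evals B j == lam l)%:R) *m U.

Let proj_herm l : adj (eproj l) = eproj l.
Proof. by rewrite /eproj !adjM adjK adj_dg mulmxA. Qed.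

Let sum_ind (x : R) : x \in L -> \sum_l (x == lam l)%:R = 1 :> R.
Proof.
move=> xL; have ix : (index x L < size L)%N by rewrite index_mem.
rewrite (bigD1 (Ordinal ix)) //= /lam /= nth_index // eqxx big1 ?addr0 // => l ne.
case: eqP => // e; case/eqP: ne; apply: val_inj => /=.
by rewrite e index_uniq // /L undup_uniq.
Qed.

Let evals_L i : evals B i \in L.
Proof. by rewrite mem_undup; apply/mapP; exists i => //; rewrite mem_enum. Qed.

Let dg_sum (I : finType) (a : I -> 'I_n -> R) : \sum_i dg (a i) = dg (fun j => \sum_i a i j).
Proof.
apply/matrixP => i j; rewrite summxE dgE; under eq_bigr do rewrite dgE.
case: eqP => [->|_]; last by rewrite big1.
by rewrite mulr1n rmorph_sum; apply: eq_bigr => l _; rewrite mulr1n.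
Qed.

Let sum_proj : \sum_l eproj l = 1%:M.
Proof.
rewrite /eproj -mulmx_suml -mulmx_sumr dg_sum.
have -> : (fun j => \sum_l (evals B j == lam l)%:R) = (fun=> 1 : R).
  by apply/funext => j; exact: sum_ind.
by rewrite dg1 mulmx1; have [] := uU.
Qed.

Let projB l : eproj l *m B = (lam l)%:C%C *: eproj l.
Proof.
rewrite [in LHS]eB /eproj !mulmxA -[_ *m U *m adj U]mulmxA; have [-> _] := uU.
rewrite mulmx1 -[_ *m dg _ *m dg _]mulmxA dgM -/U scalemxAl scalemxAr dgZ; congr (_ *m dg _ *m _).
by apply/funext => i; case: eqP => [->|_]; rewrite ?mul1r ?mulr1 ?mul0r ?mulr0.
Qed.

Let Bproj l : B *m eproj l = (lam l)%:C%C *: eproj l.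
Proof.
have := congr1 (@adj R n n) (projB l).
by rewrite adjM adjZr proj_herm (psd_herm B0).
Qed.

Let P := \sum_l eproj l *m A *m eproj l.

Let P0 : psdm P.
Proof. by apply: psd_sum => l _; have := psd_conj (eproj l) A0; rewrite proj_herm. Qed.

Let PB : P *m B = B *m P.
Proof.
rewrite /P mulmx_suml mulmx_sumr; apply: eq_bigr => l _.
have gen (E : 'M[C]_n) (a : C) : E *m B = a *: E -> B *m E = a *: E ->
    E *m A *m E *m B = B *m (E *m A *m E).
  by move=> h1 h2; rewrite -mulmxA h1 !mulmxA h2 -!scalemxAl -scalemxAr.
exact: gen (projB l) (Bproj l).
Qed.

(* One normal matrix whose real and imaginary parts are the commuting pair P, B:
   its eigenbasis diagonalises both. *)
Let Nm := P + 'i%C *: B.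
Let V := spectralmx Nm.
Let p j := complex.Re (spectral_diag Nm 0 j).
Let s j := complex.Im (spectral_diag Nm 0 j).
Let uV : unit2 V. Proof. exact: unit2_spectral. Qed.

Let conji : conjC ('i%C : C) = - 'i%C.
Proof. by apply: eqc; rewrite ?Re_conj ?Im_conj /= ?oppr0. Qed.

Let adjN : adj Nm = P - 'i%C *: B.
Proof. by rewrite /Nm adjD adjZ (psd_herm P0) (psd_herm B0) conji scaleNr. Qed.

Let eN : Nm = adj V *m diag_mx (spectral_diag Nm) *m V.
Proof.
apply: spectral_normal; rewrite adjN /Nm !(mulmxDl, mulmxDr, mulmxN, mulNmx).
rewrite -!scalemxAl -!scalemxAr PB.
by rewrite -!addrA; congr (_ + _); rewrite addrCA; congr (_ + _); rewrite addrC.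
Qed.

Let diagN : diag_mx (spectral_diag Nm) = dg p + 'i%C *: dg s.
Proof.
apply/matrixP => i j.
have -> : (dg p + 'i%C *: dg s) i j = dg p i j + 'i%C * dg s i j by rewrite [LHS]mxE [X in _ + X]mxE.
rewrite [LHS]mxE !dgE.
case: eqP => [_|_]; last by rewrite !mulr0n mulr0 addr0.
by rewrite !mulr1n; apply: eqc; rewrite ?ReD ?ImD ?ReM ?ImM /= /p /s; ring.
Qed.

Let half (X Y : 'M[C]_n) : (2^-1)%:C%C *: ((X + 'i%C *: Y) + (X - 'i%C *: Y)) = X.
Proof.
rewrite addrACA subrr addr0 -[X + X]mulr2n -[X *+ 2]scaler_nat scalerA.
have -> : (2^-1)%:C%C * 2%:R = 1 :> C.
  by rewrite mulr2n; apply: eqc; rewrite !(ReM, ImM, ReD, ImD) /=; field.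
by rewrite scale1r.
Qed.

Let eNV : Nm = (adj V *m dg p *m V) + 'i%C *: (adj V *m dg s *m V).
Proof. by rewrite {1}eN diagN mulmxDr mulmxDl -scalemxAr -scalemxAl. Qed.

Let eP : P = adj V *m dg p *m V.
Proof.
have e1 : adj Nm = (adj V *m dg p *m V) - 'i%C *: (adj V *m dg s *m V).
  by rewrite {1}eNV adjD adjZ !adjM !adjK !adj_dg conji scaleNr !mulmxA.
by rewrite -[LHS](half P B) -/Nm -adjN e1 eNV half.
Qed.

Let eBV : B = adj V *m dg s *m V.
Proof.
have : Nm = P + 'i%C *: (adj V *m dg s *m V) by rewrite {1}eNV -eP.
rewrite /Nm => /addrI /(congr1 (fun X => (- 'i%C) *: X)); rewrite !scalerA mulNr -expr2 sqr_i opprK.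
by rewrite !scale1r.
Qed.

Let eprojV l : eproj l = adj V *m dg (fun j => (s j == lam l)%:R) *m V.
Proof.
have e : adj U *m dg (evals B) *m U = adj V *m dg s *m V := etrans (esym eB) eBV.
exact: (spectral_calculus (fun x => (x == lam l)%:R) uU uV e).
Qed.

Let s_L j : \sum_l (s j == lam l)%:R = 1 :> R.
Proof.
have : \sum_l (V *m eproj l *m adj V) = 1%:M.
  by rewrite -mulmx_suml -mulmx_sumr sum_proj mulmx1; have [] := uV.
move=> /matrixP/(_ j j); rewrite summxE mxE eqxx.
have [v1 v2] := uV.
under eq_bigr => l _.
  rewrite eprojV !mulmxA v1 mul1mx -mulmxA v1 mulmx1 dgE eqxx mulr1n.
  over.
by rewrite -rmorph_sum mulr1n => /(congr1 (@complex.Re R)).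
Qed.

Let AV := V *m A *m adj V.

(** Pinching leaves the diagonal in the joint eigenbasis unchanged, so p is the outcome law of A
    itself and [var] applies to it. *)
Let pE j : p j = complex.Re (AV j j).
Proof.
have [v1 v2] := uV.
have -> : p j = complex.Re ((V *m P *m adj V) j j).
  by rewrite eP !mulmxA v1 mul1mx -mulmxA v1 mulmx1 dgE eqxx mulr1n.
have -> : V *m P *m adj V = \sum_l dg (fun j => (s j == lam l)%:R) *m AV *m dg (fun j => (s j == lam l)%:R).
  rewrite /P mulmx_sumr mulmx_suml; apply: eq_bigr => l _.
  by rewrite eprojV /AV !mulmxA v1 mul1mx -[X in X = _]mulmxA v1 mulmx1.
rewrite summxE Re_sum.
under eq_bigr do rewrite dgMr dgMl mulrAC -rmorphM ReZ.
rewrite -mulr_suml -[RHS]mul1r; congr (_ * _); rewrite -[RHS](s_L j); apply: eq_bigr => l _.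
by case: eqP => _; rewrite /= ?mulr1 ?mulr0.
Qed.

Let p0 j : 0 <= p j.
Proof.
rewrite pE; have := A0 (row j V); rewrite qf_row ge0c => /andP[] //.
Qed.

Let sE j : s j = complex.Re ((V *m B *m adj V) j j).
Proof.
have [v1 v2] := uV.
by rewrite eBV !mulmxA v1 mul1mx -mulmxA v1 mulmx1 dgE eqxx mulr1n.
Qed.

Let s0 j : 0 <= s j.
Proof.
rewrite sE; have := B0 (row j V); rewrite qf_row ge0c => /andP[] //.
Qed.

Let sump : \sum_j p j = 1.
Proof.
have [v1 v2] := uV.
have [_ <-] := dA; have -> : \tr A = \tr AV by rewrite /AV mxtrace_mulC mulmxA v2 mul1mx.
by rewrite /mxtrace Re_sum; apply: eq_bigr => j _; exact: pE.
Qed.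

Let sums : \sum_j s j = 1.
Proof. by have [_ <-] := dB; rewrite eBV tr_adjdg. Qed.

Let M j : 'M[C]_n := adj (row j V) *m row j V.

Let trrM X j : trr X (M j) = complex.Re ((V *m X *m adj V) j j).
Proof.
rewrite /trr /M mulmxA mxtrace_mulC mulmxA -qf_row /mxtrace big_ord1 //.
Qed.

Let sumM : \sum_j M j = 1%:M.
Proof.
have [v1 v2] := uV; rewrite -v2; apply/matrixP => a b; rewrite summxE [RHS]mxE.
by apply: eq_bigr => j _; rewrite mxE big_ord1 !mxE.
Qed.

Let varp (f : 'I_n -> R) : \sum_j f j * p j - kap^-1 * (\sum_j expR (f j) * s j) + 1 <= c.
Proof.
have := var f (fun j => psd_gram' (row j V)) sumM; apply: le_trans.
rewrite le_eqVlt; apply/orP; left; apply/eqP; rewrite !trr_sumr; congr (_ - _ * _ + _).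
  by apply: eq_bigr => j _; rewrite trrZr trrM pE.
by apply: eq_bigr => j _; rewrite trrZr trrM sE.
Qed.

(** Otherwise a large score at j would raise the linear term of [var] at no exponential cost; F is
    large enough to exceed c. *)
Let p_s j : s j = 0 -> p j = 0.
Proof.
move=> sj; apply/eqP; rewrite eq_le p0 andbT leNgt; apply/negP => pj.
pose F := (`|c| + kap^-1 + 1) / p j.
have := varp (fun i => if i == j then F else 0).
rewrite (bigD1 j) //= eqxx big1 ?addr0; last by move=> i /negbTE ->; rewrite mul0r.
rewrite (bigD1 j) //= sj mulr0 add0r.
have h : \sum_(i | i != j) expR (if i == j then F else 0) * s i <= 1.
  rewrite -sums [leRHS](bigD1 j) //= sj add0r; apply: ler_sum => i /negbTE ->.
  by rewrite expR0 mul1r.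
have k0 : 0 < kap^-1 by rewrite invr_gt0.
have h' := ler_wpM2l (ltW k0) h.
have -> : F * p j = `|c| + kap^-1 + 1 by rewrite /F mulfVK // gt_eqF.
have := ler_norm c; lra.
Qed.

(** The scores are the optimal log-ratios where p_j > 0. Elsewhere the optimum would be minus
    infinity; the finite value ln kap used instead adds at most sum s_j = 1, which is the 1 in the
    bound. *)
Let cl_bound : \sum_j p j * (flog (p j) - flog (s j)) <= c + 1 - ln kap.
Proof.
pose f j := ln kap + (flog (p j) - if 0 < p j then flog (s j) else 0).
have := varp f.
have -> : \sum_j f j * p j = ln kap + \sum_j p j * (flog (p j) - flog (s j)).
  have -> : ln kap + \sum_j p j * (flog (p j) - flog (s j)) =
     \sum_j (p j * ln kap + p j * (flog (p j) - flog (s j))).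
    by rewrite big_split /= -mulr_suml sump mul1r.
  apply: eq_bigr => j _ /=.
  rewrite /f; case: ltP => hp; first by ring.
  have -> : p j = 0 by apply/eqP; rewrite eq_le hp p0.
  by rewrite !mulr0 !mul0r addr0.
have h : kap^-1 * (\sum_j expR (f j) * s j) <= 2.
  have -> : 2 = \sum_j (p j + s j) by rewrite big_split /= sump sums.
  rewrite mulr_sumr; apply: ler_sum => j _.
  rewrite /f; case: ltP => hp; last first.
    have -> : p j = 0 by apply/eqP; rewrite eq_le hp p0.
    rewrite /flog ltxx subrr addr0 lnK ?posrE // mulKf ?gt_eqF // add0r //.
  have sj : 0 < s j.
    rewrite lt_neqAle s0 andbT eq_sym; apply/eqP => h; move: hp; rewrite (p_s h) ltxx //.
  rewrite /flog hp sj expRD lnK ?posrE // expRB !lnK ?posrE // -mulrA mulKf ?gt_eqF //.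
  by rewrite mulfVK ?gt_eqF // lerDl.
lra.
Qed.

Let W := spectralmx A.
Let uW : unit2 W. Proof. exact: unit2_spectral. Qed.
Let eA : A = adj W *m dg (evals A) *m W. Proof. by have [] := psd_spec A0. Qed.
Let a0 i : 0 <= evals A i. Proof. by have [_] := psd_spec A0; apply. Qed.
Let w i j := nsq ((W *m adj V) i j).
Let w0 i j : 0 <= w i j. Proof. exact: nsq_ge0. Qed.
Let w_row i : \sum_j w i j = 1. Proof. by apply: unit2_rowsum; exact: unit2M. Qed.

Let p_w j : p j = \sum_i evals A i * w i j.
Proof.
rewrite pE /AV {1}eA.
have -> : V *m (adj W *m dg (evals A) *m W) *m adj V = adj (W *m adj V) *m dg (evals A) *m (W *m adj V).
  by rewrite adjM adjK !mulmxA.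
rewrite mxE Re_sum; apply: eq_bigr => i _.
by rewrite dgMr adjE mulrAC [conjC _ * _]mulrC mul_conj -rmorphM /= mulrC.
Qed.

Let pw0 i j : p j = 0 -> evals A i * w i j = 0.
Proof.
move=> pj; apply/eqP; rewrite eq_le mulr_ge0 // andbT -pj p_w.
by rewrite (bigD1 i) //= lerDl sumr_ge0 // => l _; rewrite mulr_ge0.
Qed.

(** The pinching inequality A <= T P, from the Cauchy-Schwarz inequality over the at most T
    eigenprojections of B. *)
Let pinch_ineq u : qf A u <= T%:R * qf P u.
Proof.
have {1}-> : u = \sum_l u *m eproj l by rewrite -mulmx_sumr sum_proj mulmx1.
apply: le_trans (qf_sum_le _ A0) _; rewrite card_ord.
have -> : qf P u = \sum_l qf A (u *m eproj l).
  rewrite /qf /P mulmx_sumr mulmx_suml summxE Re_sum; apply: eq_bigr => l _.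
  by rewrite adjM proj_herm !mulmxA.
apply: ler_wpM2r; last by rewrite ler_nat.
by apply: sumr_ge0 => l _; have := A0 (u *m eproj l); rewrite ge0c => /andP[].
Qed.

(** The sum is K = <w_i, P^-1 w_i> for the i-th eigenvector of A, with the pseudo-inverse because
    1/0 = 0. Testing the pinching inequality on u = P^-1 w_i gives a_i K^2 <= T K. *)
Let row_bound i : evals A i * \sum_j w i j / p j <= T%:R.
Proof.
have [v1 v2] := uV; have [w1 w2] := uW.
set K := \sum_j _.
have K0 : 0 <= K by apply: sumr_ge0 => j _; rewrite divr_ge0.
pose u := row i (W *m adj V) *m dg (fun j => (p j)^-1) *m V.
have uP : qf P u = K.
  have -> : qf P u = complex.Re ((row i (W *m adj V) *m dg (fun j => (p j)^-1 * p j * (p j)^-1) *m adj (row i (W *m adj V))) 0 0).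
    by rewrite /qf eP (conj_dg _ _ _ uV).
  rewrite mxE Re_sum /K; apply: eq_bigr => j _.
  rewrite dgMr adjE [row _ _ _ _]mxE mulrAC mul_conj -rmorphM /= -/(w i j).
  have [->|pn] := eqVneq (p j) 0; first by rewrite invr0 !mulr0.
  by rewrite mulVf // mul1r.
have uA : evals A i * K ^+ 2 <= qf A u.
  have -> : qf A u = \sum_l evals A l * nsq ((u *m adj W) 0 l).
    by rewrite {1}eA qf_spec.
  have -> : K ^+ 2 = nsq ((u *m adj W) 0 i).
    have -> : (u *m adj W) 0 i = K%:C%C.
      have -> : (u *m adj W) 0 i = (row i (W *m adj V) *m dg (fun j => (p j)^-1) *m adj (row i (W *m adj V))) 0 0.
        have eW : V *m adj W = adj (W *m adj V) by rewrite [RHS]adjM adjK.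
        by rewrite qf_row -eW /u -!row_mul [LHS]mxE !mulmxA.
      rewrite mxE /K rmorph_sum; apply: eq_bigr => j _.
      by rewrite dgMr adjE [row _ _ _ _]mxE mulrAC mul_conj -rmorphM.
    by rewrite nsq_real.
  rewrite [leRHS](bigD1 i) //= lerDl sumr_ge0 // => l _.
  by rewrite mulr_ge0 ?nsq_ge0.
have := le_trans uA (pinch_ineq u); rewrite uP => h.
have [K00|Kp] := leP K 0.
  have -> : K = 0 by apply/eqP; rewrite eq_le K00.
  by rewrite mulr0 ler0n.
by rewrite -(ler_pM2r Kp) -mulrA -expr2.
Qed.

Let Tpos : 0 < T%:R :> R.
Proof.
rewrite ltr0n lt0n; apply/negP => /eqP T0; move: LT; rewrite T0 leqn0 => /nilP L0.
have := sump; rewrite big1 => [/eqP|i _]; first by rewrite eq_sym oner_eq0.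
by have := evals_L i; rewrite L0.
Qed.

(** Pinching raises the von Neumann entropy by at most ln T. With ln x <= x - 1 at x = a_i / (p_j
    T), the average over j is controlled by [row_bound]; no operator monotonicity of the logarithm
    is involved. *)
Let entropy_gain : \sum_i evals A i * flog (evals A i) <= \sum_j p j * flog (p j) + ln T%:R.
Proof.
have e1 : \sum_i evals A i * flog (evals A i) = \sum_i \sum_j evals A i * w i j * flog (evals A i).
  by apply: eq_bigr => i _; rewrite -mulr_suml -mulr_sumr w_row mulr1.
have e2 : \sum_j p j * flog (p j) = \sum_i \sum_j evals A i * w i j * flog (p j).
  by rewrite exchange_big /=; apply: eq_bigr => j _; rewrite p_w mulr_suml.
rewrite e1 e2 -lerBlDl -sumrB.
have tr1 : \sum_i evals A i = 1 by rewrite evals_sum //; have [] := dA.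
have e3 : ln T%:R = \sum_i evals A i * (1 - 1 + ln T%:R).
  by rewrite -mulr_suml tr1 mul1r subrr add0r.
rewrite e3; apply: ler_sum => i _; rewrite -sumrB.
have h1 : \sum_j (evals A i * w i j * flog (evals A i) - evals A i * w i j * flog (p j)) <=
   \sum_j evals A i * w i j * (evals A i / (p j * T%:R) - 1 + ln T%:R).
  apply: ler_sum => j _; rewrite -mulrBr.
  have [a00|ap] := leP (evals A i) 0.
    have -> : evals A i = 0 by apply/eqP; rewrite eq_le a00 a0.
    by rewrite !mul0r.
  have [p00|pp] := leP (p j) 0.
    have pj : p j = 0 by apply/eqP; rewrite eq_le p00 p0.
    by rewrite (pw0 i pj) !mul0r.
  apply: ler_wpM2l; first by rewrite mulr_ge0.
  rewrite /flog ap pp; have x0 : 0 < p j * T%:R / evals A i by rewrite !(divr_gt0, mulr_gt0).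
  have := ln_ge x0; rewrite invf_div lnM ?posrE ?mulr_gt0 ?invr_gt0 // lnM ?posrE // lnV ?posrE //.
  lra.
apply: le_trans h1 _.
have -> : \sum_j evals A i * w i j * (evals A i / (p j * T%:R) - 1 + ln T%:R) =
  evals A i * (T%:R^-1 * (evals A i * \sum_j w i j / p j) - 1 + ln T%:R).
  rewrite mulr_sumr mulr_sumr.
  have -> : \sum_j T%:R^-1 * (evals A i * (w i j / p j)) - 1 + ln T%:R =
     \sum_j w i j * (evals A i / (p j * T%:R) - 1 + ln T%:R).
    under [RHS]eq_bigr do rewrite mulrDr mulrBr mulr1.
    rewrite big_split sumrB /= -[X in _ = _ + X]mulr_suml w_row mul1r; congr (_ - _ + _).
    by apply: eq_bigr => j _; rewrite invfM; ring.
  by rewrite mulr_sumr; apply: eq_bigr => j _; rewrite mulrA.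
apply: ler_wpM2l => //; rewrite lerD2r lerB //.
by rewrite mulrC ler_pdivrMr // mul1r; exact: row_bound.
Qed.

(** As log B is diagonal in the joint eigenbasis, Tr A log B = sum p log s; the relative entropy is
    therefore D(p||s) plus the entropy gained by pinching. *)
Lemma pinch_renty : renty A B <= c + 1 - ln kap + ln T%:R.
Proof.
have -> : renty A B = \sum_i evals A i * flog (evals A i) - \sum_j p j * flog (s j).
  have -> : \sum_j p j * flog (s j) = trr A (adj V *m dg (@flog R \o s) *m V).
    have -> : trr A (adj V *m dg (@flog R \o s) *m V) = trr AV (dg (@flog R \o s)).
      rewrite /trr /AV; congr complex.Re.
      by rewrite -!mulmxA [RHS]mxtrace_mulC -!mulmxA.
    rewrite /trr /mxtrace Re_sum; apply: eq_bigr => j _.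
    by rewrite dgMr [AV j j * _]mulrC ReZ -pE [RHS]mulrC.
  have -> : adj V *m dg (@flog R \o s) *m V = adj U *m dg (@flog R \o evals B) *m U.
    have e : adj V *m dg s *m V = adj U *m dg (evals B) *m U := etrans (esym eBV) eB.
    exact: (spectral_calculus (@flog R) uV uU e).
  rewrite {4}eA /trr Re_tr_adjdg /renty -sumrB; apply: eq_bigr => i _.
  rewrite -[X in X - _]mulr1 -(ovl_row A B i) mulr_sumr -sumrB; apply: eq_bigr => j _.
  by rewrite /ovl -/U -/W /=; ring.
have := entropy_gain; have := cl_bound.
under eq_bigr do rewrite mulrBr.
rewrite sumrB; lra.
Qed.

(** For a square root A = adj(Ar) Ar, [p_s] makes the columns of Ar adj(V) vanish where s_j = 0; X
    is A times the pseudo-inverse of B. *)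
Lemma pinch_supp : exists X : 'M[C]_n, A = X *m B.
Proof.
have [v1 v2] := uV; have [Ar eAr] := psd_root A0.
have z0 j : s j = 0 -> forall l, (Ar *m adj V) l j = 0.
  move=> /p_s pj l; have : p j = \sum_l nsq ((Ar *m adj V) l j).
    rewrite pE /AV eAr; have -> : V *m (adj Ar *m Ar) *m adj V = adj (Ar *m adj V) *m (Ar *m adj V).
      by rewrite adjM adjK !mulmxA.
    by rewrite mxE Re_sum; apply: eq_bigr => m _; rewrite adjE mulrC mul_conj.
  rewrite pj (bigD1 l) //= => /esym/eqP; rewrite paddr_eq0 ?nsq_ge0 ?sumr_ge0 //; last by move=> m _; exact: nsq_ge0.
  by move=> /andP[/eqP /nsq_eq0].
exists (A *m (adj V *m dg (fun j => (s j)^-1) *m V)).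
have e : Ar *m adj V = Ar *m adj V *m (dg (fun j => (s j)^-1) *m dg s).
  apply/matrixP => l j; rewrite dgM dgMr.
  have [sj|sj] := eqVneq (s j) 0; first by rewrite z0 // mul0r.
  by rewrite mulVf // mulr1.
rewrite [in X in _ = _ *m X]eBV !mulmxA -[_ *m V *m adj V]mulmxA v1 mulmx1.
rewrite [in RHS]eAr -!(mulmxA (adj Ar)) -[Ar *m adj V *m _ *m _]mulmxA -e.
by rewrite -[Ar *m adj V *m V]mulmxA v2 mulmx1.
Qed.
End Pinch.
End Pinching.

(** * Permutation-invariant operators have polynomially many eigenvalues *)

Section FewEigenvalues.
Variables (R : realType) (d n : nat).
Local Notation C := (R[i]).

Definition ptype := {ffun 'I_d * 'I_d -> 'I_n.+1}.
Definition pairs (x y : Idx d n) : n.-tuple ('I_d * 'I_d) := [tuple (x i, y i) | i < n].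
(** The joint type of a row and a column index, a complete invariant under simultaneous permutation
    of both. *)
Definition ty (x y : Idx d n) : ptype := [ffun z => inord (count_mem z (pairs x y))].

Lemma ty_perm x y x' y' : ty x y = ty x' y' ->
  exists p : 'S_n, x = [ffun i => x' (p i)] /\ y = [ffun i => y' (p i)].
Proof.
move=> /ffunP e; have : perm_eq (pairs x y) (pairs x' y').
  apply/allP => z _ /=; have := e z; rewrite !ffunE => /(congr1 val) /=.
  have cs u v : (count_mem z (pairs u v) < n.+1)%N.
    by rewrite ltnS -[leqRHS](size_tuple (pairs u v)) count_size.
  by rewrite !inordK; [move=> ->|exact: cs|exact: cs].
move=> /tuple_permP[p /val_inj ep]; exists p.
by split; apply/ffunP => i; rewrite ffunE;
   have := congr1 (fun t => tnth t i) ep; rewrite !tnth_mktuple => -[].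
Qed.

Lemma perminv_ty (X : Op R d n) x y x' y' : perminv X -> ty x y = ty x' y' ->
  ent X x y = ent X x' y'.
Proof. by move=> hX /ty_perm[p [-> ->]]; rewrite -[X in RHS](hX p) entE. Qed.

Definition coords (X : Op R d n) : 'rV[C]_#|{: ptype}| :=
  \row_t (if [pick z : Idx d n * Idx d n | ty z.1 z.2 == enum_val t] is Some z
          then ent X z.1 z.2 else 0).

Lemma coordsE (X : Op R d n) x y : perminv X -> ent X x y = coords X 0 (enum_rank (ty x y)).
Proof.
move=> hX; rewrite mxE enum_rankK; case: pickP => [z /eqP hz|/(_ (x, y))].
  exact/esym/perminv_ty.
by rewrite eqxx.
Qed.

(** The powers of A are permutation invariant, hence determined by one entry per joint type. With
    more distinct eigenvalues than types, that many powers would be linearly dependent, and a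
    nonzero polynomial would have more roots than its degree allows. *)
Lemma few_evals (A : Op R d n) : psdm A -> perminv A ->
  (size (undup [seq evals A i | i : 'I_#|Idx d n|]) <= n.+1 ^ (d * d))%N.
Proof.
move=> hA iA; set L := undup _; set m := size L.
have [eA _] := psd_spec hA; have [u1 u2] := unit2_spectral A.
set U := spectralmx A in eA u1 u2; set l := evals A in eA.
pose S i : Op R d n := adj U *m dg (fun j => l j ^+ i) *m U.
have S0 : S 0%N = 1%:M.
  by rewrite /S; under eq_fun do rewrite expr0; rewrite dg1 mulmx1.
have SS i : S i.+1 = A *m S i.
  rewrite [A in RHS]eA /S !mulmxA -[_ *m U *m adj U]mulmxA u1 mulmx1.
  rewrite -[_ *m dg l *m dg _]mulmxA dgM; congr (_ *m dg _ *m _).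
  by apply/funext => j; rewrite exprS.
have iS i : perminv (S i).
  elim: i => [|i ih] p; first by rewrite S0 rx_1 //; exists (p^-1)%g => x; rewrite ?permK ?permKV.
  by rewrite SS rx_mul ?iA ?ih //; exists (p^-1)%g => x; rewrite ?permK ?permKV.
have cardT : #|{: ptype}| = (n.+1 ^ (d * d))%N.
  by rewrite card_ffun card_prod !card_ord.
rewrite -cardT leqNgt; apply/negP => mT.
pose K : 'M[C]_(m, #|{: ptype}|) := \matrix_(i < m) coords (S i).
have : kermx K != 0.
  by rewrite kermx_eq0 /row_free neq_ltn (leq_ltn_trans (rank_leq_col K) mT).
move=> /rowV0Pn[a /sub_kermxP aK a0].
have sum0 : \sum_(i < m) a 0 i *: S i = 0.
  apply: op_ext => x y; rewrite ent_sum.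
  have : (a *m K) 0 (enum_rank (ty x y)) = 0 by rewrite aK mxE.
  rewrite mxE => e; rewrite [RHS]mxE -[RHS]e; apply: eq_bigr => i _.
  by rewrite entZ coordsE // [K _ _]mxE.
have ev j : \sum_(i < m) a 0 i * ((l j)%:C%C) ^+ i = 0.
  have : (U *m (\sum_(i < m) a 0 i *: S i) *m adj U) j j = 0.
    by rewrite sum0 mulmx0 mul0mx mxE.
  rewrite mulmx_sumr mulmx_suml summxE => e; rewrite -[RHS]e; apply: eq_bigr => i _.
  rewrite -scalemxAr -scalemxAl [RHS]mxE /S !mulmxA u1 mul1mx -[_ *m U *m adj U]mulmxA u1 mulmx1.
  by rewrite dgE eqxx mulr1n rmorphXn.
pose p : {poly C} := \poly_(i < m) (if insub i is Some i' then a 0 i' else 0).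
have pE (i : 'I_m) : p`_i = a 0 i.
  by rewrite coef_poly ltn_ord valK.
have p0 : p != 0.
  apply: contra a0 => /eqP p0; apply/eqP/rowP => i.
  by rewrite -pE p0 coef0 mxE.
have rp : all (root p) [seq x%:C%C | x <- L].
  apply/allP => _ /mapP[x xL ->]; rewrite mem_undup in xL; have /mapP[j _ ->] := xL.
  rewrite /root horner_poly -[X in _ == X](ev j); apply/eqP; apply: eq_bigr => i _.
  by rewrite -pE coef_poly ltn_ord.
have up : uniq [seq x%:C%C : C | x <- L].
  by rewrite map_inj_uniq ?undup_uniq //; exact: complexI.
have := max_poly_roots p0 rp up; rewrite size_map -/m ltnNge.
by rewrite size_poly.
Qed.
End FewEigenvalues.

(** * Mixtures of i.i.d. states *)

Section Borel.
Variables (R : realType) (d : nat).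
Local Notation C := (R[i]).
Local Notation T := (BorelOp R d).

Lemma open_measurable_op (U : set T) : openS (U : set (Op R d 1)) -> measurable U.
Proof. by move=> oU; apply: sub_sigma_algebra. Qed.

Lemma closed_measurable_op (B : set T) : closedS (B : set (Op R d 1)) -> measurable B.
Proof.
move=> cB; rewrite -[B]setCK; apply: measurableC; apply: open_measurable_op => X nX.
apply: contrapT => /forall2NP h; apply: nX; apply: cB => e e0.
have [//|/existsNP[Y /not_implyP[hY /contrapT BY]]] := h e.
by exists Y.
Qed.

Lemma measurable_part (i j : 'I_#|Idx d 1|) :
  measurable_fun [set: T] (fun s : T => complex.Re ((s : Op R d 1) i j)) /\
  measurable_fun [set: T] (fun s : T => complex.Im ((s : Op R d 1) i j)).
Proof.
have key (f : T -> R) : (forall X Y e, (forall a b, `|(X : Op R d 1) a b - (Y : Op R d 1) a b| < e%:C%C) -> `|f X - f Y| < e) ->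
    measurable_fun [set: T] f.
  move=> hf _; apply: (measurability _ (RGenOInfty.measurableE R)) => //.
  move=> _ [_ [x ->] <-]; rewrite setTI; apply: open_measurable_op => X /=.
  rewrite in_itv /= andbT => hx; exists (f X - x); first by rewrite subr_gt0.
  move=> Y hY /=; rewrite in_itv /= andbT.
  by have := hf X Y _ hY; rewrite ltr_norml; lra.
split; apply: key => X Y e h; have := h i j.
  by move=> /lt_norm_Re; rewrite ReD ReN.
by move=> /lt_norm_Im; rewrite ImD ImN.
Qed.

Section Integral.
Variables (mu : probability T R) (S : set T).
Hypothesis mS : measurable S.
Hypothesis dS : (S : set (Op R d 1)) `<=` @dens R d 1.
Hypothesis muS : mu S = 1%E.

(** Measurability is asked everywhere but boundedness only on S, where the arguments are states. The
    class is stable under sums and products, which makes the entries of tensor powers integrable. *)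
Definition okf (f : T -> R) := measurable_fun [set: T] f /\ exists B, forall s, S s -> `|f s| <= B.

Lemma okf_int f : okf f -> mu.-integrable S (EFin \o f).
Proof.
move=> [mf [B hB]]; apply: measurable_bounded_integrable => //.
- by apply: le_lt_trans (probability_le1 mu mS) _; rewrite ltry.
- exact: measurable_funS mf.
- by exists B; split; [exact: num_real|move=> M BM s Ss /=; apply: le_trans (hB s Ss) (ltW BM)].
Qed.

Lemma okf_cst c : okf (fun=> c).
Proof. by split; [exact: measurable_cst|exists `|c|]. Qed.

Lemma okfD f g : okf f -> okf g -> okf (fun s => f s + g s).
Proof.
move=> [mf [B hB]] [mg [B' hB']]; split; first exact: measurable_funD.
by exists (B + B') => s Ss; apply: le_trans (ler_normD _ _) _; apply: lerD; auto.
Qed.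

Lemma okfM f g : okf f -> okf g -> okf (fun s => f s * g s).
Proof.
move=> [mf [B hB]] [mg [B' hB']]; split; first exact: measurable_funM.
by exists (B * B') => s Ss; rewrite normrM ler_pM ?hB ?hB'.
Qed.

Lemma okfZ c f : okf f -> okf (fun s => c * f s).
Proof. by move=> hf; apply: okfM => //; exact: okf_cst. Qed.

Lemma okf_sum I (r : seq I) (f : I -> T -> R) : (forall i, okf (f i)) ->
  okf (fun s => \sum_(i <- r) f i s).
Proof.
move=> h; elim: r => [|i r ih].
  by under eq_fun do rewrite big_nil; exact: okf_cst.
by under eq_fun do rewrite big_cons; exact: okfD.
Qed.

Definition okc (f : T -> C) := okf (fun s => complex.Re (f s)) /\ okf (fun s => complex.Im (f s)).

Lemma okc_cst c : okc (fun=> c). Proof. by split; exact: okf_cst. Qed.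
Lemma okcD f g : okc f -> okc g -> okc (fun s => f s + g s).
Proof.
move=> [h1 h2] [h3 h4]; split.
  by under eq_fun do rewrite ReD; exact: okfD.
by under eq_fun do rewrite ImD; exact: okfD.
Qed.
Lemma okcM f g : okc f -> okc g -> okc (fun s => f s * g s).
Proof.
move=> [h1 h2] [h3 h4]; split.
  under eq_fun do rewrite ReM -mulN1r.
  by apply: okfD; [exact: okfM|apply: okfZ; exact: okfM].
by under eq_fun do rewrite ImM; apply: okfD; exact: okfM.
Qed.
Lemma okc_sum I (r : seq I) (f : I -> T -> C) : (forall i, okc (f i)) ->
  okc (fun s => \sum_(i <- r) f i s).
Proof.
move=> h; elim: r => [|i r ih].
  by under eq_fun do rewrite big_nil; exact: okc_cst.
by under eq_fun do rewrite big_cons; exact: okcD.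
Qed.
Lemma okc_prod I (r : seq I) (f : I -> T -> C) : (forall i, okc (f i)) ->
  okc (fun s => \prod_(i <- r) f i s).
Proof.
move=> h; elim: r => [|i r ih].
  by under eq_fun do rewrite big_nil; exact: okc_cst.
by under eq_fun do rewrite big_cons; exact: okcM.
Qed.

Lemma okc_entry (x y : Idx d 1) : okc (fun s : T => ent (s : Op R d 1) x y).
Proof.
have [m1 m2] := measurable_part (enum_rank x) (enum_rank y).
by split; split => //; exists 1 => s Ss;
  have [] := dens_entry (dens_dens' (dS Ss)) (enum_rank x) (enum_rank y).
Qed.

Lemma okc_ipow n (x y : Idx d n) : okc (fun s : T => ent (ipow n (s : Op R d 1)) x y).
Proof.
under eq_fun do rewrite ent_ipow.
by apply: okc_prod => i; exact: okc_entry.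
Qed.

Local Notation Int := (Rintegral mu S).

Lemma IntD f g : okf f -> okf g -> Int (fun s => f s + g s) = Int f + Int g.
Proof. by move=> /okf_int h1 /okf_int h2; rewrite RintegralD. Qed.
Lemma IntZ c f : okf f -> Int (fun s => c * f s) = c * Int f.
Proof. by move=> /okf_int h1; rewrite RintegralZl. Qed.
Lemma Int_cst c : Int (fun=> c) = c.
Proof. by rewrite Rintegral_cst // [X in fine X]muS mulr1. Qed.
Lemma Int_sum I (r : seq I) (f : I -> T -> R) : (forall i, okf (f i)) ->
  Int (fun s => \sum_(i <- r) f i s) = \sum_(i <- r) Int (f i).
Proof.
move=> h; elim: r => [|i r ih].
  by rewrite big_nil; under eq_fun do rewrite big_nil; exact: Int_cst.
by rewrite big_cons -ih -IntD //; [under eq_fun do rewrite big_cons|exact: okf_sum].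
Qed.
Lemma Int_le f g : okf f -> okf g -> (forall s, S s -> f s <= g s) -> Int f <= Int g.
Proof. by move=> /okf_int h1 /okf_int h2; exact: le_Rintegral. Qed.
Lemma Int_eq f g : (forall s, S s -> f s = g s) -> Int f = Int g.
Proof. by move=> h; apply: eq_Rintegral => s; rewrite inE; exact: h. Qed.

Lemma ent_mix n (x y : Idx d n) : ent (mixpow mu S n) x y =
  (Int (fun s : T => complex.Re (ent (ipow n (s : Op R d 1)) x y)) +i*
   Int (fun s : T => complex.Im (ent (ipow n (s : Op R d 1)) x y)))%C.
Proof. exact: entE. Qed.

Lemma okf_lin n (e : Idx d n -> Idx d n -> C) :
  okf (fun s : T => complex.Re (\sum_x \sum_y e x y * ent (ipow n (s : Op R d 1)) x y)).
Proof.
have [h _] : okc (fun s : T => \sum_x \sum_y e x y * ent (ipow n (s : Op R d 1)) x y).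
  apply: okc_sum => x; apply: okc_sum => y; apply: okcM; first exact: okc_cst.
  exact: okc_ipow.
exact: h.
Qed.

(** The mixture is defined entry by entry through real and imaginary parts; this turns it into an
    integral of operators for every linear functional. *)
Lemma mix_lin n (e : Idx d n -> Idx d n -> C) :
  complex.Re (\sum_x \sum_y e x y * ent (mixpow mu S n) x y) =
  Int (fun s : T => complex.Re (\sum_x \sum_y e x y * ent (ipow n (s : Op R d 1)) x y)).
Proof.
have h x y : okf (fun s : T => complex.Re (e x y * ent (ipow n (s : Op R d 1)) x y)).
  by have [] : okc (fun s : T => e x y * ent (ipow n (s : Op R d 1)) x y)
    by apply: okcM; [exact: okc_cst|exact: okc_ipow].
transitivity (\sum_x \sum_y Int (fun s : T => complex.Re (e x y * ent (ipow n (s : Op R d 1)) x y))).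
  rewrite Re_sum; apply: eq_bigr => x _; rewrite Re_sum; apply: eq_bigr => y _.
  have [h1 h2] := okc_ipow x y.
  rewrite ent_mix ReM /= -!IntZ // -mulN1r -IntZ; last exact: okfZ.
  rewrite -IntD; [|exact: okfZ|by do 2!apply: okfZ].
  by congr Int; apply/funext => s; rewrite ReM mulN1r.
under eq_bigr do rewrite -Int_sum //.
rewrite -Int_sum; last by move=> x; exact: okf_sum.
congr Int; apply/funext => s; rewrite Re_sum; apply: eq_bigr => x _.
by rewrite Re_sum.
Qed.

Lemma mix_trr n (E : Op R d n) :
  trr (mixpow mu S n) E = Int (fun s : T => trr (ipow n (s : Op R d 1)) E).
Proof.
have h (X : Op R d n) : trr X E = complex.Re (\sum_x \sum_y ent E y x * ent X x y).
  by rewrite trr_ent; congr complex.Re; apply: eq_bigr => x _; apply: eq_bigr => y _; rewrite mulrC.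
by rewrite h mix_lin; congr Int; apply/funext => s; rewrite h.
Qed.

Lemma okf_trr n (E : Op R d n) : okf (fun s : T => trr (ipow n (s : Op R d 1)) E).
Proof.
have h (X : Op R d n) : trr X E = complex.Re (\sum_x \sum_y ent E y x * ent X x y).
  by rewrite trr_ent; congr complex.Re; apply: eq_bigr => x _; apply: eq_bigr => y _; rewrite mulrC.
by under eq_fun do rewrite h; exact: okf_lin.
Qed.

Lemma mix_herm n : adj (mixpow mu S n) = mixpow mu S n.
Proof.
apply: op_ext => x y; rewrite ent_adj !ent_mix.
have hs s : S s -> adj (ipow n s) = ipow n s by move=> /dS /(dens_ipow n) /dens_psd /psd_herm.
have he s : S s -> ent (ipow n s) x y = conjC (ent (ipow n s) y x).
  by move=> /hs h; rewrite -{1}h ent_adj.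
apply: eqc; rewrite ?Re_conj ?Im_conj /=.
  by apply: Int_eq => s /he ->; rewrite Re_conj.
rewrite -mulN1r -IntZ; last by have [] := okc_ipow y x.
by apply: Int_eq => s /he ->; rewrite Im_conj mulN1r.
Qed.

Lemma herm_psd n (A : 'M[C]_n) : adj A = A ->
  (forall v : 'rV[C]_n, 0 <= trr A (adj v *m v)) -> psdm A.
Proof.
move=> hA h v; apply: ge0cP.
  have : conjC ((v *m A *m adj v) 0 0) = (v *m A *m adj v) 0 0.
    by rewrite -adjE !adjM adjK hA mulmxA.
  by move=> /(congr1 (@complex.Im R)); rewrite Im_conj; lra.
have -> : (v *m A *m adj v) 0 0 = \tr (A *m (adj v *m v)); last exact: h.
by rewrite mulmxA mxtrace_mulC mulmxA /mxtrace big_ord1.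
Qed.

Lemma mix_sub_psd n (W : Op R d n) : adj W = W ->
  (forall E : Op R d n, psdm E -> trr W E <= trr (mixpow mu S n) E) ->
  psdm (mixpow mu S n - W).
Proof.
move=> hW h; apply: herm_psd => [|v]; first by rewrite adjD adjN hW mix_herm.
by rewrite trrBl subr_ge0; apply: h; exact: psd_gram'.
Qed.

Lemma mix_dens n : dens' (mixpow mu S n).
Proof.
split.
  rewrite -[mixpow _ _ _]subr0; apply: mix_sub_psd => [|E hE]; first exact: adj0.
  rewrite trr0l mix_trr; apply: Rintegral_ge0 => s /dS /(dens_ipow n) /dens_psd h.
  exact: trr_ge0.
rewrite -trr1 mix_trr -[RHS]Int_cst; apply: Int_eq => s /dS /(dens_ipow n)[_ h].
by rewrite trr1 h.
Qed.

Lemma mix_perminv n : perminv (mixpow mu S n).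
Proof.
move=> p; apply: op_ext => x y; rewrite entE !ent_mix.
have h (s : T) : ent (ipow n (s : Op R d 1)) x y =
    ent (ipow n (s : Op R d 1)) [ffun i => x (p i)] [ffun i => y (p i)].
  by rewrite -{1}(ipow_perminv s p) entE.
by under [in RHS]eq_fun do rewrite h; under [X in _ = (_ +i* X)%C]eq_Rintegral do rewrite h.
Qed.

Lemma mix_trr_le n (E : Op R d n) b : (forall s, S s -> trr (ipow n s) E <= b) ->
  trr (mixpow mu S n) E <= b.
Proof.
move=> h; rewrite mix_trr -[leRHS]Int_cst; apply: Int_le => //.
  exact: okf_trr.
exact: okf_cst.
Qed.
End Integral.
Arguments okf_trr : clear implicits.

(** * A countable mixture of finitely supported measures *)

Section Mixture.
Variable S : set T.
Hypothesis mS : measurable S.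
Hypothesis dS : (S : set (Op R d 1)) `<=` @dens R d 1.
Variables (N : nat -> nat) (w : nat -> nat -> {nonneg R}) (s : nat -> nat -> T).
Hypothesis sS : forall k j, S (s k j).
Hypothesis w1 : forall k, \sum_(j < N k) (w k j)%:num = 1.

Lemma cweight_ge0 (k : nat) : 0 <= ((k.+1 * k.+2)%:R^-1 : R).
Proof. by rewrite invr_ge0 ler0n. Qed.
(** These weights telescope to total mass 1 and decay only polynomially, so isolating the k-th
    component costs a logarithm. *)
Definition cweight k : {nonneg R} := NngNum (cweight_ge0 k).

Definition atoms k : {measure set T -> \bar R} := msum (fun j => mscale (w k j) (dirac (s k j))) (N k).
Definition mixture := mseries (fun k => mscale (cweight k) (atoms k)) 0.

Lemma atoms1 k (B : set T) : (forall j, B (s k j)) -> atoms k B = 1%E.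
Proof.
move=> hB; rewrite /atoms /= /msum.
under eq_bigr do rewrite /= /mscale /= diracE mem_set // mule1.
by rewrite sumEFin w1.
Qed.

Lemma mixture1 (B : set T) : (forall k j, B (s k j)) -> mixture B = 1%E.
Proof.
move=> hB; rewrite /mixture /= /mseries.
under eq_eseriesr do rewrite /= /mscale /= atoms1 // mule1.
apply/cvg_lim => //.
have tele n : \sum_(0 <= k < n) ((k.+1 * k.+2)%:R^-1 : R) = 1 - n.+1%:R^-1.
  elim: n => [|n ih]; first by rewrite big_nil invr1 subrr.
  rewrite big_nat_recr //= ih natrM.
  have h1 : n.+1%:R != 0 :> R by rewrite pnatr_eq0.
  have h2 : n.+2%:R != 0 :> R by rewrite pnatr_eq0.
  have e : n.+2%:R = n.+1%:R + 1 :> R by rewrite -natr1.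
  by rewrite e in h2 *; move: (n.+1%:R : R) h1 h2 => a h1 h2; field; rewrite h1 h2.
rewrite [X in X @ _ --> _](_ : _ = EFin \o (fun n => 1 - n.+1%:R^-1)); last first.
  by apply/funext => n /=; rewrite sumEFin tele.
apply: cvg_EFin; first by apply: nearW.
rewrite -[X in _ --> X]subr0; apply: cvgB; first exact: cvg_cst.
exact: cvg_harmonic.
Qed.

HB.instance Definition _ := Measure.on mixture.
HB.instance Definition _ := Measure_isProbability.Build _ _ _ mixture (mixture1 (fun _ _ => I)).
Definition mixture_prob : probability T R := mixture.

Lemma mixture_S : mixture_prob S = 1%E.
Proof. exact: mixture1. Qed.

(** All terms of the series are nonnegative, and only the k-th is kept. *)
Lemma mixture_ge k n (E : Op R d n) : psdm E ->
  (k.+1 * k.+2)%:R^-1 * trr (\sum_(j < N k) (((w k j)%:num)%:C)%C *: ipow n (s k j : Op R d 1)) E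
  <= trr (mixpow mixture_prob S n) E.
Proof.
move=> hE; rewrite (mix_trr (mu := mixture_prob) mS dS mixture_S).
pose f (x : T) := trr (ipow n (x : Op R d 1)) E.
have f0 x : S x -> 0 <= f x by move=> /dS /(dens_ipow n) /dens_psd h; exact: trr_ge0.
have [mf _] := okf_trr S dS n E.
have mfS : measurable_fun S (EFin \o f) by apply/measurable_EFinP; exact: measurable_funS mf.
have intE := okf_int mixture_prob mS (okf_trr S dS n E).
rewrite -lee_fin /Rintegral fineK; last exact: integrable_fin_num.
rewrite (ge0_integral_measure_series _ mS) //.
apply: (@le_trans _ _ (\int[mscale (cweight k) (atoms k)]_(x in S) (f x)%:E)%E); last first.
  rewrite (@nneseriesD1 _ _ k) //=.
    by rewrite leeDl // nneseries_ge0 // => i _ _; apply: integral_ge0.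
  by move=> i _; apply: integral_ge0.
rewrite ge0_integral_mscale //= EFinM lee_wpmul2l //.
rewrite ge0_integral_measure_sum // trr_suml -sumEFin; apply: lee_sum => j _.
rewrite ge0_integral_mscale // integral_dirac // diracE mem_set //= mul1e trrZl EFinM //.
Qed.
End Mixture.
End Borel.

(** * Convex hulls *)

Section ConvexHull.
Variables (R : realType) (d n : nat).
Local Notation C := (R[i]).
Implicit Types S Q : set (Op R d n).

Lemma co_sub S : S `<=` co S.
Proof.
move=> X SX; exists 1%N, (fun=> 1), (fun=> X); split=> //; rewrite big_ord1 //.
by rewrite rmorph1 scale1r.
Qed.

Lemma co_min S Q : convexS Q -> S `<=` Q -> co S `<=` Q.
Proof.
move=> cQ sQ _ [m [w [s [w0 w1 sS ->]]]].
by apply: conv_sum => // j; apply: sQ.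
Qed.

Lemma co_conv S : convexS (co S).
Proof.
move=> X Y t [m [w [s [w0 w1 sS ->]]]] [m' [w' [s' [w0' w1' sS' ->]]]] /andP[t0 t1].
exists (m + m')%N, (fun i => match fintype.split i with inl x => t * w x | inr x => (1 - t) * w' x end),
  (fun i => match fintype.split i with inl x => s x | inr x => s' x end).
have sL (x : 'I_m) : fintype.split (lshift m' x) = inl x by rewrite -[lshift _ _]/(unsplit (inl _)) unsplitK.
have sR (x : 'I_m') : fintype.split (rshift m x) = inr x by rewrite -[rshift _ _]/(unsplit (inr _)) unsplitK.
split.
- by move=> i; case: (fintype.split i) => a; apply: mulr_ge0 => //; lra.
- rewrite big_split_ord /=; under eq_bigr do rewrite sL.
  under [X in _ + X]eq_bigr do rewrite sR.
  by rewrite -!mulr_sumr w1 w1' !mulr1 addrC subrK.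
- by move=> i; case: (fintype.split i).
- rewrite big_split_ord /= !scaler_sumr; congr (_ + _); apply: eq_bigr => i _.
    by rewrite sL scalerA rmorphM.
  by rewrite sR scalerA rmorphM.
Qed.

Lemma dens_conv : convexS (@dens R d n).
Proof.
move=> X Y t [pX tX] [pY tY] /andP[t0 t1]; split.
  by apply: psdD; apply: psdZ => //; rewrite subr_ge0.
by rewrite linearD !linearZ /= tX tY !mulr1 -rmorphD addrC subrK rmorph1.
Qed.

Lemma co_dens S : S `<=` @dens R d n -> co S `<=` @dens R d n.
Proof. exact: co_min dens_conv. Qed.
End ConvexHull.

(** * Measurability of the convex hull *)

Section HullMeasurable.
Variables (R : realType) (d : nat).
Local Notation C := (R[i]).
Variable S : set (Op R d 1).
Hypothesis dS : S `<=` @dens R d 1.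
Hypothesis cS : closedS S.
Local Notation V := 'rV[R]_(cdim #|Idx d 1|).

Let seg (p : R * (V * V)) : V := p.1 *: p.2.1 + (1 - p.1) *: p.2.2.
(** Iterated formation of segments. Each stage is a continuous image of a compact set, and the hull
    is their countable union; this gives measurability without bounding the number of points in a
    convex combination. *)
Fixpoint hull_stage (m : nat) : set V :=
  if m is m'.+1 then seg @` (`[0, 1] `*` (hull_stage m' `*` hull_stage m')) else @enc R #|Idx d 1| @` S.

Lemma dens_enc_le n (X : Op R d n) q : dens X -> `|enc X 0 q| <= 1.
Proof.
move=> /dens_dens' h; rewrite mxE /part.
by case: ifP => _; have [] := dens_entry h (enum_val q).2.1 (enum_val q).2.2.
Qed.

Lemma hull_stage_compact m : compact (hull_stage m).
Proof.
elim: m => [|m ih] /=.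
  apply: (@subclosed_compact _ _ [set v : V | forall q, `[- 1, 1]%classic (v ord0 q)]).
  - rewrite closure_id; apply/seteqP; split; first exact: subset_closure.
    move=> v hv; exists (dec v); last exact: decK.
    apply: cS => e e0; have e2 : 0 < e / 2 by lra.
    have [u [[X SX <-] [_ bu]]] := hv _ (nbhsx_ballx v _ e2).
    exists X => //; rewrite -[X](@encK _ _); apply: dec_close => q; exact: bu.
  - by apply: (@rV_compact R _ (fun=> `[- 1, 1]%classic)) => _; exact: segment_compact.
  - move=> _ [X /dS dX <-] q /=; rewrite in_itv /= -ler_norml; exact: dens_enc_le.
apply: continuous_compact; last by apply: compact_setX; [exact: segment_compact|exact: compact_setX].
apply: continuous_subspaceT => p; rewrite /seg.
have c1 : {for p, continuous (fun p : R * (V * V) => p.1)} by exact: cvg_fst.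
have c2 : {for p, continuous (fun p : R * (V * V) => p.2)} by exact: cvg_snd.
have c3 : {for p, continuous (fun p : R * (V * V) => p.2.1)}.
  by apply: (continuous_comp c2); exact: cvg_fst.
have c4 : {for p, continuous (fun p : R * (V * V) => p.2.2)}.
  by apply: (continuous_comp c2); exact: cvg_snd.
apply: cvgD; apply: cvgZ => //.
by apply: cvgB => //; exact: cst_continuous.
Qed.

Lemma hull_stage_closed m : closedS [set X : Op R d 1 | hull_stage m (enc X)].
Proof.
move=> X hX /=.
have : closed (hull_stage m) by apply: compact_closed; [exact: norm_hausdorff|exact: hull_stage_compact].
rewrite closure_id => ->; move=> B /nbhs_ballP[e /= e0 eB].
have [Y hY h] := hX e e0; exists (enc Y); split => //; apply: eB.
split => //= i q; rewrite (ord1 i); exact: enc_close.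
Qed.

Lemma co_hull : co S = \bigcup_m [set X : Op R d 1 | hull_stage m (enc X)].
Proof.
have mono m p v : hull_stage m v -> hull_stage (p + m) v.
  move=> h; elim: p => // p ih; exists (0, (v, v)) => /=.
    by split => //=; rewrite in_itv /= lexx ler01.
  by rewrite /seg /= scale0r add0r subr0 scale1r.
apply/seteqP; split.
  apply: co_min.
    move=> X Y t [a _ ha] [b _ hb] t01; exists (maxn a b).+1 => //=.
    exists (t, (enc X, enc Y)); last by rewrite /seg /= encD !encZ.
    split; first by rewrite /= in_itv.
    split; first by rewrite /= -[maxn a b](subnK (leq_maxl a b)); exact: mono.
    by rewrite /= -[maxn a b](subnK (leq_maxr a b)); exact: mono.
  by move=> X SX; exists 0%N => //; exists X.
move=> X [m _ /=]; elim: m X => [|m ih] X.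
  by case=> Y SY /(can_inj (@encK _ _)) <-; exact: co_sub.
case=> -[t [u v]] [/= t01 [hu hv]] e.
have -> : X = t%:C%C *: dec u + (1 - t)%:C%C *: dec v.
  by apply: (can_inj (@encK _ _)); rewrite -e encD !encZ !decK.
apply: co_conv; [apply: ih|apply: ih|by move: t01; rewrite in_itv]; by rewrite /= decK.
Qed.

Lemma co_measurable : measurable (co S : set (BorelOp R d)).
Proof.
rewrite co_hull; apply: bigcupT_measurable => m; apply: closed_measurable_op.
exact: hull_stage_closed.
Qed.
End HullMeasurable.

(** * Stein exponents against i.i.d. states *)

Section ExtendedLimits.
Local Open Scope ereal_scope.
Variable R : realType.

Lemma ereal_dense (x y : \bar R) : x < y -> exists z : R, x < z%:E < y.
Proof.
case: x => [x| |]; case: y => [y| |] //= xy.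
- by exists ((x + y) / 2)%R; rewrite !lte_fin; move: xy; rewrite lte_fin => xy; apply/andP; split; lra.
- by exists (x + 1)%R; rewrite lte_fin ltrDl ltr01 ltry.
- by exists (y - 1)%R; rewrite ltNyr lte_fin ltrBlDr ltrDl ltr01.
- by exists 0%R; rewrite ltNyr ltry.
Qed.

Lemma ereal_le_of (l m : \bar R) : (forall x : R, m < x%:E -> l <= x%:E) -> l <= m.
Proof.
move=> h; rewrite leNgt; apply/negP => /ereal_dense[x /andP[mx xl]].
by have := h _ mx; rewrite leNgt xl.
Qed.

(** Comparison with real test points only, so that finite and infinite limits are handled alike. *)
Lemma cvg_ereal_between (T : Type) (F : set_system T) (FF : ProperFilter F) (u : T -> \bar R) (l : \bar R) :
  (forall x : R, x%:E < l -> \forall t \near F, x%:E <= u t) ->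
  (forall x : R, l < x%:E -> \forall t \near F, u t <= x%:E) -> u @ F --> l.
Proof.
case: l => [r| |] lo up.
- have h e : (0 < e)%R -> \forall t \near F, (r - e)%:E <= u t <= (r + e)%:E.
    move=> e0; have h1 := lo (r - e)%R; have h2 := up (r + e)%R.
    rewrite !lte_fin in h1 h2.
    have {}h1 := h1 ltac:(by rewrite ltrBlDr ltrDl); have {}h2 := h2 ltac:(by rewrite ltrDl).
    by near=> t; apply/andP; split; near: t.
  apply/fine_cvgP; split.
    have h1 := h 1%R ltr01; near=> t.
    have : (r - 1)%:E <= u t <= (r + 1)%:E by near: t.
    by case: (u t) => //= /andP[]; rewrite ?leye_eq ?leeNy_eq.
  apply/cvgrPdist_le => e e0; have h1 := h e e0; near=> t.
  have : (r - e)%:E <= u t <= (r + e)%:E by near: t.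
  rewrite /=; case: (u t) => [x| |] /andP[]; rewrite ?leye_eq ?leeNy_eq // !lee_fin => h2 h3; rewrite /=.
  by rewrite ler_norml; lra.
- by apply/cvgeyPge => A; apply: lo; rewrite ltry.
- by apply/cvgeNyPle => A; apply: up; rewrite ltNyr.
Unshelve. all: by end_near. Qed.

Lemma cvg_ereal_lt (T : Type) (F : set_system T) (FF : Filter F) (u : T -> \bar R) (l : \bar R) (x : R) :
  u @ F --> l -> l < x%:E -> \forall t \near F, u t < x%:E.
Proof.
move=> ul lx; apply: (ul [set y | y < x%:E]); apply: open_nbhs_nbhs; split => //.
exact: open_ereal_lt_ereal.
Qed.
End ExtendedLimits.

(** Collects the losses of the upper bound on the rate. The 2 is made of the 1 in k L + 1 and the 1
    lost in [cl_bound]; the logarithms come from the weight of the k-th component, halved by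
    domination, and from the number of eigenvalues. *)
Lemma log_overhead (R : realType) (D : nat) (eta : R) : 0 < eta -> exists N, forall k, (N <= k)%N ->
  2 - ln ((k.+1 * k.+2)%:R^-1 / 2) + ln (k.+1 ^ D)%:R <= eta * k%:R.
Proof.
move=> eta0; have D0 : 0 < D.+2%:R :> R by rewrite ltr0n.
pose th := eta / 2 / D.+2%:R; have th0 : 0 < th by rewrite !divr_gt0.
have [N hN] := nat_above ((2 + ln 2 + eta - D.+2%:R * ln th) / (eta / 2)).
exists N => k /hN; rewrite ler_pdivrMr ?divr_gt0 // => hk.
have p1 : 0 < k.+1%:R :> R by rewrite ltr0n.
have p2 : 0 < k.+2%:R :> R by rewrite ltr0n.
have l12 : ln k.+1%:R <= ln k.+2%:R :> R by rewrite ler_ln ?posrE // ler_nat.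
have e1 : ln ((k.+1 * k.+2)%:R^-1 / 2) = - (ln k.+1%:R + ln k.+2%:R + ln 2) :> R.
  by rewrite -invfM lnV ?posrE ?mulr_gt0 ?ltr0n // natrM !lnM ?posrE ?mulr_gt0.
have e2 : ln (k.+1 ^ D)%:R = D%:R * ln k.+1%:R :> R.
  by rewrite natrX lnXn // mulr_natl.
have l2 : ln k.+2%:R <= th * k.+2%:R - ln th.
  by have := ln_sublinear (mulr_gt0 th0 p2); rewrite lnM ?posrE // => /ltW; lra.
have l3 : D%:R * ln k.+1%:R <= D%:R * ln k.+2%:R :> R by rewrite ler_wpM2l.
have l4 : D.+2%:R * ln k.+2%:R <= D.+2%:R * (th * k.+2%:R - ln th) by rewrite ler_wpM2l.
have e3 : D.+2%:R * (th * k.+2%:R - ln th) = eta / 2 * (k%:R + 2) - D.+2%:R * ln th.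
  rewrite mulrBr mulrA [D.+2%:R * th]mulrC /th divfK ?gt_eqF //.
  by rewrite -[k.+2]addn2 natrD.
have e4 : D.+2%:R = D%:R + 2 :> R by rewrite -addn2 natrD.
have e5 : D.+2%:R * ln k.+2%:R = D%:R * ln k.+2%:R + 2 * ln k.+2%:R :> R by rewrite e4 mulrDl.
rewrite e3 e5 in l4; rewrite e1 e2; move: hk l4 l3 l12.
set a := D%:R * ln k.+1%:R; set b := D%:R * ln k.+2%:R; set c := D.+2%:R * ln th.
move: a b c (ln k.+1%:R) (ln k.+2%:R) (ln 2) (k%:R : R) => a b c x y z w.
lra.
Qed.

(** * The exponent of a measurable set of states as a minimum over measures *)

Section SteinFormula.
Variables (R : realType) (d : nat).
Local Notation C := (R[i]).
Local Notation T := (BorelOp R d).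
Unset Implicit Arguments.
Variable A : forall n, set (Op R d n).
Set Implicit Arguments.
Hypothesis dA : forall n, (0 < n)%N -> A n `<=` @dens R d n.
Hypothesis clA : forall n, (0 < n)%N -> closedS (A n).
Hypothesis cA : forall n, (0 < n)%N -> convexS (A n).
Hypothesis q1 : axQI A.
Hypothesis q2 : axQII A.
Hypothesis q3 : axQIII A.
Hypothesis q4 : axQIV A.

Lemma A_nonempty n : (0 < n)%N -> A n !=set0.
Proof.
move=> n0; have [tau At _] := q1; rewrite -[n]muln1.
by exists (@tpow R d n 1 tau); exact: q2.
Qed.

Variable S : set T.
Hypothesis mS : measurable S.
Hypothesis dS : (S : set (Op R d 1)) `<=` @dens R d 1.
Hypothesis Sne : S !=set0.

Lemma supp_leP' n (X Y : Op R d n) : psd X -> psd Y ->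
  (exists W : 'M[C]_#|Idx d n|, X = W *m Y) -> supp_le X Y.
Proof.
move=> /psd_herm hX /psd_herm hY [W e]; rewrite /supp_le hX hY e; exact: submxMl.
Qed.

(** A test that is good against every power s^n is equally good against their mixture, so
    [weak_converse] applies to any state nearly attaining the infimum in the rate. *)
Lemma stein_le_of_rate (mu : probability T R) n (eps del x : R) : mu S = 1%E -> (0 < n)%N ->
  0 < del -> eps <= del / (4 * (1 + del)) -> (rate A mu S n < x%:E)%E ->
  (stein_seq A (@iid R d S) eps n <=
   ((1 + del) * x + ((1 + del) - ln (del / (4 * (1 + del)))) / n%:R)%:E)%E.
Proof.
move=> muS n0 d0 heps; have n0' : 0 < n%:R :> R by rewrite ltr0n.
rewrite /rate lte_pdivrMl // => /ereal_inf_lt[_ [r Ar <-]].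
rewrite /relent; case: ifPn => // hsupp.
have hm := mix_dens mS dS muS n; set sg := mixpow mu S n in hsupp hm *.
have hr := dens_dens' (dA n0 Ar).
rewrite (relent_val hr.1 hm.1) -/(renty r sg) -EFinM lte_fin => hx.
set kp := del / (4 * (1 + del)) in heps *.
have kp0 : 0 < kp by rewrite divr_gt0 // mulr_gt0 // ltr_wpDl.
have [X eX] := supp_leP hr.1 hm.1 hsupp.
have hb : ((expR (- ((1 + del) * (n%:R * x + 1) - ln kp)))%:E <= Defs.beta (A n) (@iid R d S n) eps)%E.
  apply: beta_ge; last by have [s Ss] := Sne; exists (ipow n s), s.
  move=> E hE hE1 hAE t ht.
  have h1 : trr sg E <= t.
    by apply: (mix_trr_le mS dS muS) => s Ss; apply: ht; exists s.
  apply: le_trans h1; have hl : trr r (1%:M - E) <= kp by apply: le_trans heps; exact: hAE.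
  have := @weak_converse _ _ r sg E del hr hm (fun i j => @supp_le_evals _ _ r sg X i j hr.1 hm.1 eX) hE hE1 d0 hl.
  apply: le_trans; rewrite -/kp opprB expRD lnK ?posrE // ler_pM2l // ler_expR lerN2.
  by rewrite ler_pM2l ?lerD2r ?(ltW hx) // ltr_wpDl.
rewrite /stein_seq; apply: le_trans (lee_wpmul2l _ (mlog_le hb)) _.
  by rewrite lee_fin invr_ge0 ltW.
by rewrite -EFinM lee_fin -subr_ge0 le_eqVlt; apply/orP; left; apply/eqP; field; rewrite gt_eqF.
Qed.

Lemma stein_le_eventually (mu : probability T R) (x y : R) : mu S = 1%E -> x < y ->
  exists2 eps0 : R, 0 < eps0 & forall eps, eps <= eps0 ->
    \forall n \near \oo, (rate A mu S n < x%:E)%E -> (stein_seq A (@iid R d S) eps n <= y%:E)%E.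
Proof.
move=> muS xy; have [del d0 hd] : exists2 del : R, 0 < del & (1 + del) * x < y.
  (* Dividing by |x| + 1 bounds del x by (y - x)/2 whatever the sign and size of x. *)
  exists ((y - x) / (`|x| + 1) / 2); first by rewrite !divr_gt0 ?subr_gt0 // ltr_wpDl.
  have h : x / (`|x| + 1) <= 1.
    by rewrite ler_pdivrMr ?ltr_wpDl // mul1r; apply: le_trans (ler_norm _) _; rewrite lerDl.
  have -> : (1 + (y - x) / (`|x| + 1) / 2) * x = x + (y - x) / 2 * (x / (`|x| + 1)) by ring.
  have : (y - x) / 2 * (x / (`|x| + 1)) <= (y - x) / 2 * 1 by rewrite ler_pM2l // divr_gt0 ?subr_gt0.
  by lra.
exists (del / (4 * (1 + del))); first by rewrite divr_gt0 // mulr_gt0 // ltr_wpDl.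
move=> eps heps; set K := (1 + del) - ln (del / (4 * (1 + del))).
have [N hN] := nat_above (K / (y - (1 + del) * x)).
exists N.+1 => // n /= Nn hr; have n0 : (0 < n)%N by apply: leq_trans Nn.
apply: le_trans (stein_le_of_rate muS n0 d0 heps hr) _; rewrite -/K lee_fin.
have := hN n (ltnW Nn); rewrite ler_pdivrMr ?subr_gt0 // => h.
by rewrite -lerBrDl ler_pdivrMr ?ltr0n // mulrC.
Qed.

Local Notation F eps := (limn_einf (stein_seq A (@iid R d S) eps)).

(** If the rate is below x at some large n, then the Stein sequence is at most y at that n, although
    it is eventually at least z > y. This is the lower half of convergence for every measure, so
    only an upper bound on the rate of the constructed mu remains to be shown. *)
Lemma rate_ge (mu : probability T R) (l : \bar R) (x : R) : mu S = 1%E ->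
  (forall eps : R, 0 < eps -> (l <= F eps)%E) -> (x%:E < l)%E ->
  \forall n \near \oo, (x%:E <= rate A mu S n)%E.
Proof.
move=> muS hl /ereal_dense[z /andP[xz zl]].
have [y /andP[xy yz]] := ereal_dense xz.
have [eps e0 h] := stein_le_eventually muS xy.
have h1 := h _ (lexx eps); have h2 := einf_lt (lt_le_trans zl (hl _ e0)).
near=> n; rewrite leNgt; apply/negP => hr.
have h3 : (stein_seq A (@iid R d S) eps n <= y%:E)%E by move: hr; near: n.
have h4 : (z%:E <= stein_seq A (@iid R d S) eps n)%E by near: n.
by have := lt_le_trans yz (le_trans h4 h3); rewrite ltxx.
Unshelve. all: by end_near. Qed.

Lemma stein_le_rate (mu : probability T R) (x y : R) : mu S = 1%E -> x < y ->
  (\forall n \near \oo, rate A mu S n < x%:E)%E ->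
  exists2 eps0 : R, 0 < eps0 & forall eps, eps <= eps0 -> (F eps <= y%:E)%E.
Proof.
move=> muS xy hr; have [eps0 e0 h] := stein_le_eventually muS xy.
exists eps0 => // eps /h {}h; apply: einf_le; near=> n.
have : (rate A mu S n < x%:E)%E by near: n.
by near: n.
Unshelve. all: by end_near. Qed.

Lemma stein_ge0 eps : 0 <= eps -> (0 <= F eps)%E.
Proof.
move=> e0; apply: einf_ge; exists 1%N => // n /= n0.
apply: mule_ge0; first by rewrite lee_fin invr_ge0 ler0n.
apply: mlog_ge; rewrite oppr0 expR0; apply: (@beta_le _ _ _ _ _ _ _ 1%:M).
- exact: psd1.
- by rewrite subrr; exact: psd0.
- by move=> r _; rewrite subrr trr0r.
- by move=> _ [s Ss <-]; rewrite trr1; have [_ ->] := dens_dens' (dens_ipow n (dS Ss)).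
Qed.

(** An upper bound: no measurement with scores separates X from Y beyond level c, that is, their
    measured relative entropy is at most c. *)
Definition testable k (c : R) (X Y : Op R d k) := forall G H, achv 1 G H ->
  trr X G - trr Y H + 1 <= c.

Lemma stein_or_untestable k (c : R) : (0 < k)%N -> 0 < c ->
  (forall eps : R, 0 < eps -> ((c / k%:R)%:E <= F eps)%E) \/
  exists rho om, [/\ A k rho, clS (co (@iid R d S k)) om & testable c rho om].
Proof.
move=> k0 c0; have [h|nh] := pselect (exists rho om, [/\ A k rho, clS (co (@iid R d S k)) om & testable c rho om]).
  by right.
left=> eps e0.
have dQ : co (@iid R d S k) `<=` @dens R d k.
  by apply: co_dens => _ [s /dS Ss <-]; exact: dens_ipow.
have [s0 Ss0] := Sne.
have [|||||||||G [H [[n [M [f [M0 M1 eG eH]]]] hc]]] := @povm_minimax R d k (A k) (clS (co (@iid R d S k))) c.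
- exact: clA.
- exact: clS_closed.
- exact: cA.
- by apply: clS_conv; exact: co_conv.
- exact: A_nonempty.
- by exists (ipow k s0); apply: clS_sub; apply: co_sub; exists s0.
- by move=> X q /(dA k0) /dens_enc_le -/(_ q) h; apply: le_trans h _; rewrite ler1n.
- move=> X q /(_ 1 ltr01)[Y /dQ /dens_enc_le -/(_ q) hY] /enc_close -/(_ q) hXY.
  rewrite -[enc X 0 q](subrK (enc Y 0 q)); apply: le_trans (ler_normD _ _) _.
  by rewrite -[2]/(1 + 1 : R); apply: lerD => //; exact: ltW.
- move=> r w Ar Qw; apply: contrapT => hn; apply: nh; exists r, w; split => // G H hGH.
  by rewrite leNgt; apply/negP => hlt; apply: hn; exists G, H.
have hS rho s : A k rho -> S s -> c <= trr rho G - trr (ipow k s) H + 1.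
  by move=> Ar Ss; apply: hc => //; apply: clS_sub; apply: co_sub; exists s.
have M1' : \sum_x M x = 1%:M by rewrite M1 scale1r.
rewrite leNgt; apply/negP => /ereal_dense[z /andP[Fz]]; rewrite lte_fin => zc.
have k0' : 0 < k%:R :> R by rewrite ltr0n.
have z0 : 0 < z by rewrite -lte_fin; apply: le_lt_trans Fz; apply: stein_ge0; exact: ltW.
have del0 : 0 < c - z * k%:R by rewrite subr_gt0 -ltr_pdivlMr.
have delc : c - z * k%:R < c by rewrite ltrBlDr ltrDl mulr_gt0.
have := einf_ge (stein_lower dA cA q3 q4 k0 M0 M1' eG eH dS Sne (A_nonempty k0) hS e0 del0 delc).
by rewrite opprB addrCA subrr addr0 mulfK ?gt_eqF // leNgt Fz.
Qed.

Lemma rate_upper (c : nat -> R) :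
  (forall k, (0 < k)%N -> exists rho om,
    [/\ A k rho, clS (co (@iid R d S k)) om & testable (c k) rho om]) ->
  exists mu : probability T R, mu S = 1%E /\ forall k, (0 < k)%N ->
    (rate A mu S k <= ((c k + 1 - ln ((k.+1 * k.+2)%:R^-1 / 2) + ln (k.+1 ^ (d * d))%:R) / k%:R)%:E)%E.
Proof.
move=> h; have [s0 Ss0] := Sne.
pose good k (D : nat * (nat -> {nonneg R}) * (nat -> T)) :=
  [/\ forall j, S (D.2 j), \sum_(j < D.1.1) (D.1.2 j)%:num = 1 &
    (0 < k)%N -> exists2 rho, A k rho & exists2 om, testable (c k) rho om &
      psdm (2%:C%C *: (\sum_(j < D.1.1) ((D.1.2 j)%:num)%:C%C *: ipow k (D.2 j : Op R d 1)) - om)].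
have exD k : exists D, good k D.
  case: (posnP k) => [->|k0].
    by exists (1%N, fun=> 1%:nng, fun=> s0); split => //=; rewrite big_ord1.
  have [rho [om [Ar Qom tst]]] := h k k0.
  have dQ : co (@iid R d S k) `<=` @dens R d k.
    by apply: co_dens => _ [s /dS Ss <-]; exact: dens_ipow.
  have Q0 : co (@iid R d S k) !=set0 by exists (ipow k s0); apply: co_sub; exists s0.
  (* With eta = 1, omega <= Y + t for some Y in the hull near omega; (Y + t)/2 is a finite mixture
     of powers, which explains the factor 2 in [good] and the half in kap. *)
  have [t Qt /(_ 1 ltr01)[del del0 dom]] := domination Q0 (fun X hX => dens_psd (dQ X hX)) (@co_conv _ _ _ _).
  have [Y QY hY] := Qom _ del0.
  have half : is_true (0 <= (2^-1 : R) <= 1) by rewrite invr_ge0 ler0n invf_le1 ?ler1n.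
  have [m [w [s [w0 w1 sS e]]]] := co_conv QY Qt half.
  have /choice[s' hs'] : forall j, exists s' : T, S s' /\ ipow k (s' : Op R d 1) = s j.
    by move=> j; have [s' Ss' e'] := sS j; exists s'.
  have [m0|m0] := posnP m.
    by move: w1; rewrite m0 in w w0 s sS e s' hs' *; rewrite big_ord0 => /esym/eqP; rewrite oner_eq0.
  (* Atoms and weights have to be sequences over all naturals; beyond m they repeat cyclically and
     are never summed. *)
  pose ix (j : nat) : 'I_m := Ordinal (ltn_pmod j m0).
  have ixE (j : 'I_m) : ix j = j by apply: val_inj; rewrite /= modn_small.
  exists (m, fun j => NngNum (w0 (ix j)), fun j => s' (ix j)); split => /=.
  - by move=> j; have [] := hs' (ix j).
  - by under eq_bigr do rewrite ixE.
  - move=> _; exists rho => //; exists om => //.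
    under eq_bigr => j _ do rewrite ixE (hs' j).2.
    rewrite -e scalerDr !scalerA -!rmorphM /=.
    have -> : 2 * (1 - 2^-1) = 1 :> R by field.
    have -> : 2 * 2^-1 = 1 :> R by field.
    by move: (dom om Y Qom QY hY); rewrite rmorph1 !scale1r.
have /choice[D hD] := exD.
have sS k j : S ((D k).2 j) by have [] := hD k.
have w1 k : \sum_(j < (D k).1.1) ((D k).1.2 j)%:num = 1 by have [] := hD k.
pose mu := @mixture_prob R d (fun k => (D k).1.1) (fun k => (D k).1.2) (fun k => (D k).2) w1.
have muS : mu S = 1%E by exact: mixture_S.
exists mu; split => // k k0; have [_ _ /(_ k0)[rho Ar [om tst dom]]] := hD k.
rewrite /rate lee_pdivrMl ?ltr0n // -EFinM.
have hm := mix_dens mS dS muS k; have hr := dens_dens' (dA k0 Ar).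
set sg := mixpow mu S k in hm *; set kap := (k.+1 * k.+2)%:R^-1 / 2.
have kap0 : 0 < kap by rewrite divr_gt0 // invr_gt0 ltr0n.
have few := few_evals hm.1 (mix_perminv mu S (n := k)).
have var (M : 'I_#|Idx d k| -> Op R d k) (f : 'I_#|Idx d k| -> R) : (forall x, psdm (M x)) ->
    \sum_x M x = 1%:M ->
    trr rho (\sum_x (f x)%:C%C *: M x) - kap^-1 * trr sg (\sum_x (expR (f x))%:C%C *: M x) + 1 <= c k.
  move=> M0 M1; set G := \sum_x _; set H := \sum_x (expR _)%:C%C *: _.
  have aGH : achv 1 G H by exists #|Idx d k|, M, f; split => //; rewrite M1 scale1r.
  have hH : psdm H by apply: psd_sum => x _; apply: psdZ => //; exact: expR_ge0.
  apply: le_trans (tst _ _ aGH); rewrite lerD2r lerD2l lerN2.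
  have := @mixture_ge R d S mS dS _ (fun k => (D k).1.2) _ sS w1 k k H hH; have := trr_ge0 dom hH.
  rewrite -/mu -/sg trrBl trrZl subr_ge0 => h1 h2; apply: le_trans h1 _.
  rewrite ler_pdivlMl //; apply: le_trans h2; rewrite le_eqVlt; apply/orP; left; apply/eqP.
  by rewrite /kap mulrA divfK.
apply: le_trans (ereal_inf_lbound (ex_intro2 _ _ rho Ar erefl)) _.
have hsupp := pinch_supp hr hm kap0 var.
rewrite /relent (supp_leP' hr.1 hm.1 hsupp) (relent_val hr.1 hm.1) -/(renty rho sg) lee_fin.
have -> : forall a : R, k%:R * (a / k%:R) = a by move=> a; rewrite mulrC divfK // pnatr_eq0 -lt0n.
by have := pinch_renty hr hm few kap0 var; rewrite natrX.
Qed.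

Lemma stein_formula : exists l : \bar R, SteinIs A (@iid R d S) l /\ MinStarIs A S l.
Proof.
(* As an infimum, l bounds every [F eps] from below, while [stein_le_rate] bounds [F eps] from above
   for all small eps; together they give the limit without a monotonicity argument. *)
pose l := ereal_inf [set F eps | eps in [set e : R | 0 < e]].
have lF (eps : R) : 0 < eps -> (l <= F eps)%E by move=> e0; apply: ereal_inf_lbound; exists eps.
have l0 : (0 <= l)%E by apply: le_ereal_inf_tmp => _ [e /= /ltW e0 <-]; exact: stein_ge0.
have small (eps0 : R) : 0 < eps0 -> \forall e \near 0^'+, 0 < e /\ e <= eps0.
  move=> h; near=> e; split; first by near: e; exact: nbhs_right_gt.
  by near: e; exact: nbhs_right_le.
have main : SteinIs A (@iid R d S) l /\ exists mu : probability T R, mu S = 1%E /\ rate A mu S n @[n --> \oo] --> l.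
  have lower x : (x%:E < l)%E -> \forall e \near 0^'+, (x%:E <= F e)%E.
    move=> xl; have sm := small 1 ltr01; near=> e.
    by apply: le_trans (ltW xl) (lF _ _); have [] : 0 < e /\ e <= 1 by near: e.
  have [ly|[L eL]] : l = +oo%E \/ exists L : R, l = L%:E.
    by case: (l) l0 => [L| |] // _; [right; exists L|left].
    (* For an infinite exponent [rate_ge] forces the rate of every measure to infinity, so a point
       mass will do. *)
    have [s0 Ss0] := Sne; pose mu : probability T R := dirac s0.
    have muS : mu S = 1%E by rewrite /mu /= diracE mem_set.
    split; last first.
      exists mu; split => //; apply: cvg_ereal_between => x xl.
        exact: rate_ge muS lF xl.
      by move: xl; rewrite ly ltNge leey.
    by apply: cvg_ereal_between => // x; rewrite ly ltNge leey.
  have L0 : 0 <= L by rewrite -lee_fin -eL.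
  (* The level k L + 1 exceeds k L, so the first alternative of [stein_or_untestable] would push l
     above L; the excess disappears after division by k. *)
  have [mu [muS hmu]] : exists mu : probability T R, mu S = 1%E /\ forall k, (0 < k)%N ->
    (rate A mu S k <= (((k%:R * L + 1) + 1 - ln ((k.+1 * k.+2)%:R^-1 / 2) + ln (k.+1 ^ (d * d))%:R) / k%:R)%:E)%E.
    apply: rate_upper => k k0; have k0' : 0 < k%:R :> R by rewrite ltr0n.
    have c0 : 0 < k%:R * L + 1 by rewrite ltr_wpDl // mulr_ge0 // ltW.
    have [h|//] := stein_or_untestable k0 c0.
    have : (((k%:R * L + 1) / k%:R)%:E <= l)%E by apply: le_ereal_inf_tmp => _ [e /= e0 <-]; exact: h.
    by rewrite eL lee_fin ler_pdivrMr // mulrC gerDl ler10.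
  have rup (x : R) : (l < x%:E)%E -> \forall n \near \oo, (rate A mu S n < x%:E)%E.
    rewrite eL lte_fin => Lx; have eta0 : 0 < (x - L) / 2 by rewrite divr_gt0 ?subr_gt0.
    have [N hN] := log_overhead (d * d) eta0.
    exists N.+1 => // n /= Nn; have n0 : (0 < n)%N by apply: leq_trans Nn.
    have n0' : 0 < n%:R :> R by rewrite ltr0n.
    apply: le_lt_trans (hmu n n0) _; rewrite lte_fin ltr_pdivrMr //.
    have := hN n (ltnW Nn); set u := ln _; set v := ln _ => h.
    have h2 : (x - L) / 2 * n%:R < (x - L) * n%:R by rewrite ltr_pM2r //; lra.
    have e : x * n%:R = n%:R * L + (x - L) * n%:R by ring.
    rewrite e; move: h h2; lra.
  split; last first.
    exists mu; split => //; apply: cvg_ereal_between => x xl; first exact: rate_ge muS lF xl.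
    by have h := rup _ xl; near=> n; apply/ltW; near: n.
  apply: cvg_ereal_between => // x lx.
  have [y /andP[ly yx]] := ereal_dense lx.
  have yx' : y < x by rewrite -lte_fin.
  have [eps0 e0 h] := stein_le_rate muS yx' (rup _ ly).
  have sm := small _ e0; near=> e; apply: h.
  by have [] : 0 < e /\ e <= eps0 by near: e.
exists l; have [h1 h2] := main; split => //; split => // mu l' muS hl.
apply: ereal_le_of => x /ereal_dense[y /andP[ly yx]].
have yx' : y < x by rewrite -lte_fin.
have [eps0 e0 h] := stein_le_rate muS yx' (cvg_ereal_lt _ hl ly).
exact: le_trans (lF _ e0) (h _ (lexx _)).
Unshelve. all: by end_near. Qed.
End SteinFormula.

(** * The method of types and products of different states *)

Section Types.
Local Open Scope nat_scope.
Variable J : finType.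

(** For fixed a, the quantity a^b / b! is largest at b = a, the mode of a Poisson law with mean
    a. *)
Lemma fact_exp_le a b : a`! * a ^ b <= b`! * a ^ a.
Proof.
have up x k : x`! * x ^ k <= (x + k)`!.
  elim: k => [|k ih]; first by rewrite expn0 muln1 addn0.
  rewrite expnS addnS factS mulnCA; apply: leq_mul => //.
  by rewrite leqW // leq_addr.
have dn x k : (x + k)`! <= x`! * (x + k) ^ k.
  have aux l m : l <= m -> (x + l)`! <= x`! * (x + m) ^ l.
    elim: l => [|l ih] lm; first by rewrite addn0 expn0 muln1.
    rewrite addnS factS expnS mulnCA; apply: leq_mul (ih (ltnW lm)).
    by rewrite -addnS leq_add2l.
  exact: aux.
case: (leqP a b) => ab.
  have := up a (b - a); rewrite subnKC // => h.
  rewrite -{1}(subnK ab) expnD mulnA; apply: leq_mul => //.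
have := dn b (a - b); rewrite subnKC ?(ltnW ab) // => h.
apply: leq_trans (leq_mul h (leqnn _)) _.
by rewrite -mulnA -expnD subnK // ltnW.
Qed.

(** The multinomial coefficient, by recursion on the first letter of a rearrangement. *)
Lemma size_permutations_count (s : seq J) :
  size (permutations s) * \prod_j (count_mem j s)`! = (size s)`!.
Proof.
have [m] := ubnP (size s); elim: m s => // m ih s ltm.
case: (altP (s =P [::])) => [->|sne].
  by rewrite /= big1 // => j _; rewrite fact0.
rewrite (perm_size (permutationsE _)) //; last by case: (s) sne.
rewrite size_allpairs_dep sumnE big_map big_distrl /=.
transitivity (\sum_(x <- undup s) count_mem x s * (size s).-1`!).
  apply: eq_big_seq => x; rewrite mem_undup => xs.
  have szr : size (rem x s) = (size s).-1 by rewrite size_rem.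
  have s0 : 0 < size s by case: (s) sne.
  have := ih (rem x s); rewrite szr prednK // => /(_ ltm) <-.
  rewrite mulnCA; congr (_ * _); rewrite (bigD1 x) //= [in RHS](bigD1 x) //=.
  have cx : count_mem x s = (count_mem x (rem x s)).+1.
    by rewrite (seq.permP (perm_to_rem xs)) /= eqxx.
  rewrite cx factS -mulnA; congr (_ * (_ * _)); apply: eq_bigr => j jx.
  by rewrite (seq.permP (perm_to_rem xs)) /= eq_sym (negbTE jx).
rewrite -big_distrl /=.
have -> : \sum_(x <- undup s) count_mem x s = size s.
  rewrite -sum1_size -[in RHS]big_undup_iterop_count; apply: eq_bigr => x _.
  by rewrite Monoid.iteropE iter_addn_0 mul1n.
by case: (s) sne => // x t _; rewrite /= factS.
Qed.

Definition word n (f : {ffun 'I_n -> J}) : seq J := [seq f i | i : 'I_n].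

Lemma size_word n (f : {ffun 'I_n -> J}) : size (word f) = n.
Proof. by rewrite size_map size_enum_ord. Qed.

Lemma nth_word n (f : {ffun 'I_n -> J}) x0 (i : 'I_n) : nth x0 (word f) i = f i.
Proof. by rewrite (nth_map i) ?size_enum_ord // nth_ord_enum. Qed.

Lemma word_inj n : injective (@word n).
Proof. by move=> f g e; apply/ffunP => i; rewrite -(nth_word f (f i)) e nth_word. Qed.

Lemma card_class n (g : {ffun 'I_n -> J}) :
  #|[pred f : {ffun 'I_n -> J} | perm_eq (word f) (word g)]| = size (permutations (word g)).
Proof.
rewrite cardE -(size_map (@word n)); apply/perm_size/uniq_perm.
- by rewrite map_inj_uniq ?enum_uniq //; exact: word_inj.
- exact: permutations_uniq.
move=> t; rewrite mem_permutations; apply/mapP/idP => [[f]|ht].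
  by rewrite mem_enum inE => h ->.
have st : size t = n by rewrite (perm_size ht) size_word.
case: n g ht st => [|n] g ht st.
  exists g; first by rewrite mem_enum inE.
  by have := size_word g; case: (t) st => // _; case: (word g).
exists [ffun i : 'I_n.+1 => nth (g i) t i]; last first.
  apply: (@eq_from_nth _ (g ord0)); rewrite ?size_word // => k; rewrite st => ltk.
  rewrite -[k]/(val (Ordinal ltk)) nth_word ffunE; apply: set_nth_default.
  by rewrite st.
rewrite mem_enum inE; suff -> : word [ffun i : 'I_n.+1 => nth (g i) t i] = t by [].
apply: (@eq_from_nth _ (g ord0)); rewrite ?size_word // => k ltk.
rewrite -[k]/(val (Ordinal ltk)) nth_word ffunE; apply: set_nth_default.
by rewrite st.
Qed.

Lemma prod_word n (f : {ffun 'I_n -> J}) (a : J -> nat) :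
  \prod_i a (f i) = \prod_j a j ^ count_mem j (word f).
Proof.
transitivity (\prod_(x <- word f) a x); first by rewrite big_image.
rewrite -big_undup_iterop_count (big_uniq _ (undup_uniq _)) /= big_mkcond /=.
apply: eq_bigr => j _; rewrite mem_undup; case: ifPn => // /count_memPn ->.
by rewrite expn0.
Qed.

Lemma sum_count_word n (f : {ffun 'I_n -> J}) : \sum_j count_mem j (word f) = n.
Proof.
rewrite -[RHS](size_word f) -sum1_size -[RHS]big_undup_iterop_count [RHS](big_uniq _ (undup_uniq _)) /= [RHS]big_mkcond /=.
apply: eq_bigr => j _; rewrite mem_undup Monoid.iteropE iter_addn_0 mul1n.
by case: ifPn => // /count_memPn.
Qed.

Definition typ n (f : {ffun 'I_n -> J}) : {ffun J -> 'I_n.+1} :=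
  [ffun j => inord (count_mem j (word f))].

Lemma typ_eq n (f g : {ffun 'I_n -> J}) : typ f = typ g -> perm_eq (word f) (word g).
Proof.
move=> /ffunP e; apply/allP => j _ /=; apply/eqP; have := congr1 val (e j).
have cn (h : {ffun 'I_n -> J}) : count_mem j (word h) < n.+1.
  by rewrite ltnS -[X in _ <= X](size_word h) count_size.
by rewrite !ffunE /= !inordK.
Qed.


(** Letters drawn with the frequencies of g make the type class of g the most likely one. Counts
    replace probabilities, so everything stays in the naturals and the total weight is n^n. *)
Lemma class_bound n (f g : {ffun 'I_n -> J}) (a := fun j => count_mem j (word g)) :
  #|[pred h : {ffun 'I_n -> J} | perm_eq (word h) (word f)]| * \prod_i a (f i) <=
  #|[pred h : {ffun 'I_n -> J} | perm_eq (word h) (word g)]| * \prod_i a (g i).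
Proof.
pose P (h : {ffun 'I_n -> J}) := \prod_j (count_mem j (word h))`!.
have P0 h : 0 < P h by apply: prodn_gt0 => j; exact: fact_gt0.
rewrite -(@leq_pmul2r (P f * P g)) ?muln_gt0 ?P0 //.
have e h : #|[pred h' : {ffun 'I_n -> J} | perm_eq (word h') (word h)]| * P h = n`!.
  by rewrite card_class size_permutations_count size_word.
rewrite mulnACA e [P f * P g]mulnC mulnACA e leq_mul2l; apply/orP; right.
rewrite !prod_word mulnC -!big_split /=; apply: leq_prod => j _.
by rewrite [leqRHS]mulnC; exact: fact_exp_le.
Qed.

(** The total weight n^n is spread over at most (n + 1)^|J| classes, of which that of g is the
    heaviest. *)
Lemma types_bound n (g : {ffun 'I_n -> J}) (a := fun j => count_mem j (word g)) :
  n ^ n <= n.+1 ^ #|J| *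
    (#|[pred h : {ffun 'I_n -> J} | perm_eq (word h) (word g)]| * \prod_i a (g i)).
Proof.
have -> : n ^ n = \sum_(f : {ffun 'I_n -> J}) \prod_i a (f i).
  by rewrite -(bigA_distr_bigA (fun _ : 'I_n => a)) /= sum_count_word prod_nat_const card_ord.
rewrite (partition_big (@typ n) xpredT) //=.
have <- : #|{ffun J -> 'I_n.+1}| = n.+1 ^ #|J| by rewrite card_ffun card_ord.
rewrite -sum_nat_const; apply: leq_sum => t _.
case: (pickP [pred f : {ffun 'I_n -> J} | typ f == t]) => [f0 /eqP <-|none]; last first.
  by rewrite big1 // => f; have := none f; rewrite /= => ->.
apply: leq_trans (class_bound f0 g); rewrite -sum_nat_const.
rewrite big_mkcond [leqRHS]big_mkcond; apply: leq_sum => f _.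
case: ifP => // /eqP /typ_eq h; rewrite inE h -[leqRHS]/(\prod_i a (f0 i)) !prod_word.
by apply: leq_prod => j _; rewrite (seq.permP h).
Qed.
End Types.

(** * Tests against products of different states *)

Section ProductTests.
Variables (R : realType) (d : nat).
Local Notation C := (R[i]).

(** Expanding every factor as s i + (s' i - s i) writes the larger product as the smaller one plus
    products of positive operators. *)
Lemma tprod_mono n (s s' : 'I_n -> Op R d 1) : (forall i, psdm (s i)) ->
  (forall i, psdm (s' i - s i)) -> psdm (tprod s' - tprod s).
Proof.
move=> h1 h2; pose P (i : 'I_n) (z : bool) : Op R d 1 := if z then s i else s' i - s i.
have -> : tprod s' = \sum_(f : {ffun 'I_n -> bool}) bt (@pr1 d n) (fun i => P i (f i)).
  rewrite tprodE -bt_sum; apply: eq_bt => i.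
  by rewrite big_bool /= addrC subrK.
rewrite (bigD1 [ffun=> true]) //= tprodE.
have -> : bt (@pr1 d n) (fun i => P i ([ffun=> true] i)) = bt (@pr1 d n) s.
  by apply: eq_bt => i; rewrite ffunE.
rewrite addrAC subrr add0r; apply: psd_sum => f _; apply: psd_bt; first exact: pr1_bij.
by move=> i; rewrite /P; case: (f i).
Qed.

Lemma ipow_mix n (J : finType) (p : J -> R) (tau : J -> Op R d 1) :
  ipow n (\sum_j (p j)%:C%C *: tau j) =
  \sum_(f : {ffun 'I_n -> J}) (\prod_i p (f i))%:C%C *: tprod (fun i => tau (f i)).
Proof.
rewrite /ipow tprodE bt_sum; apply: eq_bigr => f _.
by rewrite bt_scale tprodE rmorph_prod.
Qed.

Lemma trr_word n (J : finType) (tau : J -> Op R d 1) (E : Op R d n) (f g : {ffun 'I_n -> J}) :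
  perminv E -> perm_eq (word f) (word g) ->
  trr (tprod (fun i => tau (f i))) E = trr (tprod (fun i => tau (g i))) E.
Proof.
move=> hE.
have e (h : {ffun 'I_n -> J}) : word h = [tuple h i | i < n] by [].
rewrite !e => /tuple_permP[p hp].
have {}hp i : f i = g (p i).
  have /(congr1 (fun t => tnth t i)) : [tuple f i | i < n] = [tuple tnth [tuple g i | i < n] (p i) | i < n].
    exact: val_inj.
  by rewrite !tnth_mktuple.
rewrite !tprodE -(trr_rx (bt _ (fun i => tau (g i))) E (permb (p^-1)%g)) rx_bt1 hE; congr trr.
by apply: eq_bt => i; rewrite hp invgK.
Qed.

Section ConvexFamily.
Variable Q : set (Op R d 1).
Hypothesis dQ : Q `<=` @dens R d 1.
Hypothesis cQ : convexS Q.
Hypothesis Q0 : Q !=set0.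

Lemma trr_word_le n (J : finType) (tau : J -> Op R d 1) (E : Op R d n) (t : R) (f : {ffun 'I_n -> J}) :
  (0 < n)%N -> (forall j, Q (tau j)) -> psdm E -> perminv E ->
  (forall s, Q s -> trr (ipow n s) E <= t) ->
  trr (tprod (fun i => tau (f i))) E <= (n.+1 ^ #|J|)%:R * t.
Proof.
move=> n0 Qt hE pE ht; set v := trr _ E.
have v0 h : 0 <= trr (tprod (fun i => tau (h i))) E.
  by apply: trr_ge0 => //; apply: dens_psd; apply: dens_tprod => i; exact: dQ.
pose a j := count_mem j (word f).
have n0' : 0 < n%:R :> R by rewrite ltr0n.
pose p j : R := (a j)%:R / n%:R.
have p0 j : 0 <= p j by rewrite divr_ge0 ?ler0n.
have p1 : \sum_j p j = 1.
  by rewrite -mulr_suml -natr_sum sum_count_word divff ?gt_eqF.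
(* W / n^n is the probability of the type class of f under letters drawn with its own frequencies;
   on that class the invariant test has the constant value v. *)
pose W := (#|[pred h : {ffun 'I_n -> J} | perm_eq (word h) (word f)]| * \prod_i a (f i))%N.
have hW : W%:R * v <= (n ^ n)%:R * t.
  have Qs : Q (\sum_j (p j)%:C%C *: tau j) by exact: conv_sum.
  apply: le_trans (ler_wpM2l _ (ht _ Qs)); last exact: ler0n.
  rewrite ipow_mix trr_suml mulr_sumr.
  under eq_bigr do rewrite trrZl.
  have pe (h : {ffun 'I_n -> J}) : \prod_i p (h i) = (\prod_i a (h i))%:R / (n ^ n)%:R.
    rewrite /p prodf_div natr_prod; congr (_ / _).
    by rewrite prodr_const card_ord natrX.
  rewrite (bigID (fun h : {ffun 'I_n -> J} => perm_eq (word h) (word f))) /=.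
  apply: (@le_trans _ _ (\sum_(h : {ffun 'I_n -> J} | perm_eq (word h) (word f)) (\prod_i a (f i))%:R * v)).
    by rewrite sumr_const -mulrnAl -mulrnA /W mulnC.
  rewrite -[leLHS]addr0; apply: lerD.
    apply: ler_sum => h hf; rewrite pe (trr_word tau pE hf) -/v mulrA [_%:R * (_ / _)]mulrC divfK; last first.
      by rewrite pnatr_eq0 -lt0n expn_gt0 n0.
    rewrite !prod_word; apply: ler_wpM2r; first exact: v0.
    by rewrite ler_nat; apply: leq_prod => j _; rewrite (seq.permP hf).
  by apply: sumr_ge0 => h _; do 2!apply: mulr_ge0 => //; apply: prodr_ge0.
have nn : 0 < (n ^ n)%:R :> R by rewrite ltr0n expn_gt0 n0.
rewrite -(ler_pM2l nn); apply: le_trans (_ : (n.+1 ^ #|J| * W)%:R * v <= _).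
  by apply: ler_wpM2r; [exact: v0|rewrite ler_nat; exact: types_bound].
by rewrite natrM -mulrA [leRHS]mulrCA ler_pM2l // ltr0n expn_gt0.
Qed.

(** One representative Y is chosen in each occupied cell of a grid on the encoded states.
    [domination] gives X <= Y + eta t throughout the cell, and the net consists of the normalised
    operators (Y + eta t)/(1 + eta). *)
Lemma upper_net (eta : R) : 0 < eta -> exists (J : finType) (tau : J -> Op R d 1),
  (forall j, Q (tau j)) /\ forall X, Q X -> exists j, psdm ((1 + eta)%:C%C *: tau j - X).
Proof.
move=> eta0; have [t Qt /(_ _ eta0)[del del0 dom]] := domination Q0 (fun X hX => dens_psd (dQ hX)) cQ.
have K0 : 0 < 2 / del by rewrite divr_gt0.
(* Cells have width del/2, as [dec_close] asks for half the distance in each real coordinate; M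
   bounds the cell number since encoded entries lie in [-1, 1]. *)
pose N := cdim #|Idx d 1|; pose M := Num.truncn (2 * (2 / del)).
pose g (X : Op R d 1) (q : 'I_N) : R := (enc X 0 q + 1) * (2 / del).
pose cell (X : Op R d 1) : {ffun 'I_N -> 'I_M.+1} :=
  [ffun q => inord (Num.truncn (g X q))].
have eX X q : Q X -> 0 <= enc X 0 q + 1 <= 2.
  by move=> /dQ /dens_enc_le -/(_ q); rewrite ler_norml => /andP[h1 h2]; apply/andP; split; lra.
have close X Y : Q X -> Q Y -> cell X = cell Y -> forall i j, `|X i j - Y i j| < del%:C%C.
  move=> QX QY /ffunP hc; rewrite -[X](@encK _ _) -[Y](@encK _ _); apply: dec_close => q.
  have := congr1 val (hc q); rewrite !ffunE /=.
  have tr Z : Q Z -> (Num.truncn (g Z q) < M.+1)%N.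
    move=> QZ; rewrite ltnS; apply: le_truncn; rewrite ler_pM2r //.
    by have /andP[] := eX Z q QZ.
  have itv Z : Q Z -> (Num.truncn (g Z q))%:R <= g Z q < (Num.truncn (g Z q)).+1%:R.
    by move=> QZ; apply: truncn_itv; apply: mulr_ge0; [have /andP[] := eX Z q QZ|exact: ltW].
  rewrite !inordK ?tr // => e; have := itv X QX; have := itv Y QY; rewrite e.
  move=> /andP[a1 a2] /andP[b1 b2]; rewrite -natr1 in a2 b2; rewrite /g in a1 a2 b1 b2.
  have : `|(enc X 0 q - enc Y 0 q) * (2 / del)| < 1 by rewrite ltr_norml; apply/andP; split; lra.
  rewrite normrM (gtr0_norm K0) -ltr_pdivlMr // => h; apply: lt_le_trans h _.
  by rewrite div1r invf_div.
have /choice[Y hY] : forall c, exists Y, Q Y /\ forall X, Q X -> cell X = c -> cell Y = c.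
  move=> c; have [[X [QX e]]|n] := pselect (exists X, Q X /\ cell X = c).
    by exists X.
  by exists t; split => // X QX e; exfalso; apply: n; exists X.
have e1 : 0 < 1 + eta by rewrite ltr_wpDl.
exists {ffun 'I_N -> 'I_M.+1}, (fun c => ((1 + eta)^-1)%:C%C *: Y c + (1 - (1 + eta)^-1)%:C%C *: t); split.
  move=> c; apply: cQ => //; first by have [] := hY c.
  by rewrite invr_ge0 (ltW e1) invf_le1 // lerDl ltW.
move=> X QX; exists (cell X); have [QY /(_ X QX erefl) eY] := hY (cell X).
rewrite scalerDr !scalerA -!rmorphM /= mulfV ?gt_eqF // mulrBr mulr1 mulfV ?gt_eqF // rmorph1 scale1r.
rewrite [1 + eta - 1]addrAC subrr add0r.
by apply: dom => //; [exact: clS_sub|exact: close].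
Qed.

Lemma product_test_le (eta : R) : 0 < eta -> exists r : nat, forall n (E : Op R d n) t, (0 < n)%N ->
  psdm E -> perminv E -> (forall s, Q s -> trr (ipow n s) E <= t) ->
  forall s : 'I_n -> Op R d 1, (forall i, Q (s i)) ->
  trr (tprod s) E <= (1 + eta) ^+ n * ((n.+1 ^ r)%:R * t).
Proof.
move=> eta0; have [J [tau [Qtau net]]] := upper_net eta0; exists #|J| => n E t n0 hE pE ht s Qs.
have /choice[j hj] : forall i, exists j, psdm ((1 + eta)%:C%C *: tau j - s i) by move=> i; exact: net.
have := tprod_mono (fun i => dens_psd (dQ (Qs i))) hj.
move=> /trr_ge0 -/(_ _ hE); rewrite trrBl subr_ge0 => h; apply: le_trans h _.
rewrite tprodE bt_scale big_const_ord iter_mulr_1 -rmorphXn /= trrZl -tprodE.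
have e1 : 0 < 1 + eta by rewrite ltr_wpDl.
rewrite ler_pM2l ?exprn_gt0 //.
have := @trr_word_le n J tau E t [ffun i => j i] n0 Qtau hE pE ht.
by under [X in trr (tprod X)]eq_fun do rewrite ffunE.
Qed.
End ConvexFamily.

(** A product is affine in each factor, so the bound passes to the hull one position at a time; in
    [key], only the first k positions range over the hull. *)
Lemma tprod_hull n (B1 : set (Op R d 1)) (E : Op R d n) t :
  (forall s : 'I_n -> Op R d 1, (forall i, B1 (s i)) -> trr (tprod s) E <= t) ->
  forall s : 'I_n -> Op R d 1, (forall i, co B1 (s i)) -> trr (tprod s) E <= t.
Proof.
move=> h; suff key k : forall s : 'I_n -> Op R d 1, (forall i, co B1 (s i)) ->
    (forall i : 'I_n, (k <= i)%N -> B1 (s i)) -> trr (tprod s) E <= t.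
  by move=> s hs; apply: (key n) => // i; rewrite leqNgt ltn_ord.
elim: k => [|k ih] s hs hk; first by apply: h => i; exact: hk.
case: (ltnP k n) => kn; last first.
  by apply: ih => // i; rewrite leqNgt (leq_trans (ltn_ord i) kn).
pose k' := Ordinal kn; pose upd X (i : 'I_n) := if i == k' then X else s i.
have -> : s = upd (s k') by apply/funext => i; rewrite /upd; case: eqP => // ->.
pose G : set (Op R d 1) := [set X | trr (tprod (upd X)) E <= t].
suff : co B1 `<=` G by apply; exact: hs.
have [cG bG] : convexS G /\ B1 `<=` G; last exact: co_min.
split; last first.
  move=> X BX; rewrite /G /=; apply: ih => i; rewrite /upd.
    by case: eqP => [_|_]; [exact: co_sub|exact: hs].
  case: eqP => // ne ki; apply: hk; rewrite ltn_neqAle ki andbT; apply/eqP => e.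
  by apply: ne; exact: val_inj.
move=> X Y u hX hY /andP[u0 u1]; rewrite /G /=.
have -> : tprod (upd (u%:C%C *: X + (1 - u)%:C%C *: Y)) =
    u%:C%C *: tprod (upd X) + (1 - u)%:C%C *: tprod (upd Y).
  apply: op_ext => x y; rewrite entD !entZ.
  have fac Z : ent (tprod (upd Z)) x y = ent Z [ffun=> x k'] [ffun=> y k'] *
      \prod_(i < n | i != k') ent (s i) [ffun=> x i] [ffun=> y i].
    rewrite entE (bigD1 k') //= /upd eqxx; congr (_ * _).
    by apply: eq_bigr => i /negbTE ->.
  by rewrite !fac entD !entZ mulrDl !mulrA.
rewrite trrDl !trrZl; have := ler_wpM2l u0 hX.
have u1' : 0 <= 1 - u by rewrite subr_ge0.
by have := ler_wpM2l u1' hY; lra.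
Qed.
End ProductTests.

Section SteinProducts.
Variables (R : realType) (d : nat).
Local Notation C := (R[i]).
Unset Implicit Arguments.
Variable A : forall n, set (Op R d n).
Set Implicit Arguments.
Hypothesis dA : forall n, (0 < n)%N -> A n `<=` @dens R d n.
Hypothesis cA : forall n, (0 < n)%N -> convexS (A n).
Hypothesis q3 : axQIII A.

Local Open Scope ereal_scope.

Lemma beta_mono n (X B B' : set (Op R d n)) eps : B `<=` B' -> Defs.beta X B eps <= Defs.beta X B' eps.
Proof.
move=> h; apply: le_ereal_inf_tmp => _ [E hE <-].
apply: (@le_trans _ _ (ereal_sup [set (trR s E)%:E | s in B])).
  by apply: ereal_inf_lbound; exists E.
by apply: ge_ereal_sup => _ [s Bs <-]; apply: ereal_sup_ubound; exists s => //; exact: h.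
Qed.

Lemma mlog_anti (b b' : \bar R) : b <= b' -> mlog b' <= mlog b.
Proof.
case: b b' => [b| |] [b'| |] //=; rewrite ?leey ?leNye ?leye_eq ?leeNy_eq //.
rewrite lee_fin => bb; case: ifPn => [b0|]; last rewrite -ltNge => b0.
  by rewrite (le_trans bb b0).
by case: ifPn => [|]; rewrite ?leey // -ltNge => c0; rewrite lee_fin lerN2 ler_ln ?posrE.
Qed.

Lemma lt_mlog (b : \bar R) (y : R) : y%:E < mlog b -> b < (expR (- y))%:E.
Proof.
case: b => [b| |] //=; last by rewrite ltNyr.
case: ifPn => [b0 _|]; first by rewrite lte_fin; apply: le_lt_trans b0 (expR_gt0 _).
rewrite -ltNge => b0; rewrite !lte_fin => h.
by rewrite -(lnK b0) ltr_expR ltrNr.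
Qed.

Lemma beta_hull n (X : set (Op R d n)) (B1 : set (Op R d 1)) eps :
  Defs.beta X (@av R d (co B1) n) eps = Defs.beta X (@av R d B1 n) eps.
Proof.
apply/eqP; rewrite eq_le; apply/andP; split; last first.
  by apply: beta_mono => _ [s hs <-]; exists s => // j; apply: co_sub; exact: hs.
apply: le_ereal_inf_tmp => _ [E hE <-].
apply: (@le_trans _ _ (ereal_sup [set (trR s E)%:E | s in @av R d (co B1) n])).
  by apply: ereal_inf_lbound; exists E.
apply: ge_ereal_sup => _ [_ [s hs <-] <-]; apply: ereal_le_of => t ht.
rewrite lee_fin; apply: tprod_hull hs => s' hs'; rewrite -lee_fin; apply: ltW.
by apply: le_lt_trans ht; apply: ereal_sup_ubound; exists (tprod s') => //; exists s'.
Qed.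

Section ConvexNull.
Variable Q : set (Op R d 1).
Hypothesis dQ : Q `<=` @dens R d 1.
Hypothesis cQ : convexS Q.
Hypothesis Q0 : Q !=set0.

(** A good i.i.d. test is symmetrised, which preserves both of its error bounds, and then reused
    against products; (1 + eta)^n <= exp(eta n) gives the linear loss. *)
Lemma mlog_product_ge (eta : R) : (0 < eta)%R -> exists r : nat, forall n eps (y : R), (0 < n)%N ->
  y%:E < mlog (Defs.beta (A n) (@iid R d Q n) eps) ->
  (y - eta * n%:R - ln (n.+1 ^ r)%:R)%:E <= mlog (Defs.beta (A n) (@av R d Q n) eps).
Proof.
move=> eta0; have [r hr] := product_test_le dQ cQ Q0 eta0; exists r => n eps y n0.
move=> /lt_mlog /ereal_inf_lt[_ [E [hE hE1 hA] <-]] hs.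
have ht s : Q s -> (trr (ipow n s) E <= expR (- y))%R.
  move=> Qs; rewrite -lee_fin; apply: ltW; apply: le_lt_trans hs.
  by apply: ereal_sup_ubound; exists (ipow n s) => //; exists s.
apply: mlog_ge; apply: (@beta_le _ _ _ _ _ _ _ (twirl E)).
- exact: twirl_psd.
- by rewrite -[1%:M](twirl_1 R d n) -twirlB; exact: twirl_psd.
- move=> rho Ar; rewrite -[1%:M](twirl_1 R d n) -twirlB -trr_twirl -lee_fin.
  apply: le_trans hA; apply: ereal_sup_ubound; exists (twirl rho) => //.
  by apply: (twirl_mem q3 (cA n0) n0).
move=> _ [s Qs <-].
have ht' s' : Q s' -> (trr (ipow n s') (twirl E) <= expR (- y))%R.
  by move=> Qs'; rewrite -trr_twirl (twirl_id (ipow_perminv s')); exact: ht.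
apply: le_trans (hr n (twirl E) _ n0 (twirl_psd hE) (@twirl_perminv _ _ _ E) ht' s Qs) _.
have -> : (- (y - eta * n%:R - ln (n.+1 ^ r)%:R) = n%:R * eta + (ln (n.+1 ^ r)%:R + - y))%R.
  by ring.
rewrite !expRD lnK ?posrE ?ltr0n ?expn_gt0 // expRM_natl.
apply: ler_wpM2r; first by rewrite mulr_ge0 ?expR_ge0 // ler0n.
apply: lerXn2r; rewrite ?nnegrE ?expR_ge0 //; first by rewrite addr_ge0 // ltW.
exact: expR_ge1Dx.
Qed.

Lemma stein_product eps : (0 < eps)%R ->
  limn_einf (stein_seq A (@av R d Q) eps) = limn_einf (stein_seq A (@iid R d Q) eps).
Proof.
move=> e0; have pinv n : (0 < n)%N -> 0 <= ((n%:R : R)^-1)%:E.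
  by move=> _; rewrite lee_fin invr_ge0 ler0n.
apply/eqP; rewrite eq_le; apply/andP; split; rewrite leNgt; apply/negP => /ereal_dense[z /andP[hz zl]].
  have h := einf_lt zl; move: hz; rewrite ltNge => /negP; apply; apply: einf_ge.
  near=> n; have hn : z%:E <= stein_seq A (@av R d Q) eps n by near: n.
  have n0 : (0 < n)%N by near: n; exists 1%N.
  apply: le_trans hn _; apply: lee_wpmul2l; first exact: pinv.
  apply: mlog_anti; apply: beta_mono => _ [s Qs <-].
  by exists (fun=> s).
have [x /andP[hx xz]] := ereal_dense hz.
(* The gap z - x is split in three: strictness needed to choose a test, the factor (1 + eta)^n, and
   the polynomial number of types. *)
rewrite lte_fin in xz; pose eta := ((z - x) / 3)%R.
have eta0 : (0 < eta)%R by rewrite divr_gt0 ?subr_gt0.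
have [r hr] := mlog_product_ge eta0; have [N hN] := log_overhead r eta0.
have h := einf_lt zl; move: hx; rewrite ltNge => /negP; apply; apply: einf_ge.
near=> n; have n0 : (0 < n)%N by near: n; exists 1%N.
have n0' : (0 < n%:R :> R)%R by rewrite ltr0n.
have hn : z%:E <= stein_seq A (@iid R d Q) eps n by near: n.
have Nn : (N <= n)%N by near: n; exists N.
rewrite /stein_seq lee_pdivlMl // in hn; rewrite /stein_seq lee_pdivlMl //.
have lt : (n%:R * (z - eta))%:E < mlog (Defs.beta (A n) (@iid R d Q n) eps).
  by apply: lt_le_trans hn; rewrite -EFinM lte_fin ltr_pM2l // ltrBlDr ltrDl.
apply: le_trans (hr n eps _ n0 lt); rewrite -EFinM lee_fin.
have ov : (0 <= 2 - ln ((n.+1 * n.+2)%:R^-1 / 2) :> R)%R.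
  rewrite subr_ge0; apply: le_trans (_ : 0 <= 2)%R => //; apply: ln_le0.
  rewrite ler_pdivrMr // mul1r; apply: le_trans (_ : 1 <= 2)%R; last by rewrite ler1n.
  by rewrite invf_le1 ?ltr0n // ler1n.
have := hN n Nn; have -> : (x = z - 3 * eta)%R by rewrite /eta; field.
move: ov; set a := (2 - _)%R; set b := ln _ => ov ov2.
have e : (n%:R * (z - 3 * eta) = n%:R * (z - eta) - eta * n%:R - eta * n%:R)%R by ring.
by rewrite e lerD2l lerN2; lra.
Unshelve. all: by end_near. Qed.
End ConvexNull.
End SteinProducts.

Theorem mainTheorem1 (R : realType) (d : nat)
    (A : forall n : nat, set (Op R d n)) (B1 : set (Op R d 1)) :
  B1 `<=` @dens R d 1 ->
  B1 !=set0 ->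
  closedS B1 ->
  (forall n, (0 < n)%N -> A n `<=` @dens R d n) ->
  (forall n, (0 < n)%N -> closedS (A n)) ->
  (forall n, (0 < n)%N -> convexS (A n)) ->
  axQI A -> axQII A -> axQIII A -> axQIV A ->
  (exists l : \bar R, SteinIs A (iid B1) l /\ MinStarIs A B1 l) /\
  (exists l : \bar R,
     [/\ SteinIs A (av B1) l, SteinIs A (av (co B1)) l,
         SteinIs A (iid (co B1)) l & MinStarIs A (co B1) l]).
Proof.
move=> dB B0 cB dA clA cA q1 q2 q3 q4.
have mB : measurable (B1 : set (BorelOp R d)) by exact: closed_measurable_op.
split; first exact: (stein_formula dA clA cA q1 q2 q3 q4 mB dB B0).
have dC : co B1 `<=` @dens R d 1 by exact: co_dens.
have C0 : co B1 !=set0 by have [s Bs] := B0; exists s; exact: co_sub.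
have mC : measurable (co B1 : set (BorelOp R d)) by exact: co_measurable dB cB.
have [l [hl ml]] := stein_formula dA clA cA q1 q2 q3 q4 mC dC C0.
have hav : SteinIs A (av (co B1)) l.
  (* [stein_product] compares the exponents for eps > 0, which is all the right-sided limit sees. *)
  apply: cvg_trans hl; apply: near_eq_cvg; near=> eps.
  by rewrite (stein_product cA q3 dC (@co_conv _ _ _ _) C0) //; near: eps; exact: nbhs_right_gt.
exists l; split; [|exact: hav|exact: hl|exact: ml].
rewrite /SteinIs.
suff -> : (fun eps => limn_einf (stein_seq A (av B1) eps)) =
    (fun eps => limn_einf (stein_seq A (av (co B1)) eps)) by [].
by apply/funext => eps; congr limn_einf; apply/funext => n; rewrite /stein_seq beta_hull.
Unshelve. all: by end_near. Qed.
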